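(* Let $A(z)$ and $B(z)$ be non-constant meromorphic functions on $\mathbb{C}$, and suppose that the difference equation $$(\Delta f(z))^2=A(z)\bigl(f(z)f(z+1)-B(z)\bigr)$$ possesses two distinct admissible solutions $f_1(z)$ and $f_2(z)$. For a meromorphic function $f$ put $G(f)=(A(z)+4)f(z)^2-4B(z)$. Then at least one of the following holds: (i) $T(r,f_1)=T(r,f_2)(1+o(1))$ as $r\to\infty$, $r\notin E$, where $E$ is an exceptional set of finite logarithmic measure; (ii) $\overline{N}_{\mathrm{O}}(r,G(f_1))=\overline{N}_{\mathrm{O}}(r,G(f_2))$.
   Context: ''Meromorphic'' means meromorphic in the whole complex plane $\mathbb{C}$, and $\Delta f(z)=f(z+1)-f(z)$. $T(r,f)$ denotes the Nevanlinna characteristic of $f$. $S(r,f)$ denotes any quantity that is $o(T(r,f))$ as $r\to\infty$ outside a possible exceptional set of $r$ of finite logarithmic measure (a set $E\subset[1,\infty)$ has finite logarithmic measure if $\int_E dr/r<\infty$). A transcendental (i.e. non-rational) meromorphic solution $f$ of the difference equation is called admissible if $T(r,A)=S(r,f)$ and $T(r,B)=S(r,f)$. For a meromorphic function $f$, let $\overline{n}_{\mathrm{odd}}(r,f)$ be the number of poles of $f$ in $|z|<r$ whose multiplicity is odd, each such pole counted once (ignoring multiplicity). The integrated counting function $\overline{N}_{\mathrm{odd}}(r,f)$ is defined in the usual manner: $$\overline{N}_{\mathrm{odd}}(r,f)=\int_0^r\frac{\overline{n}_{\mathrm{odd}}(t,f)-\overline{n}_{\mathrm{odd}}(0,f)}{t}\,dt+\overline{n}_{\mathrm{odd}}(0,f)\log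 r,$$ where $\overline{n}_{\mathrm{odd}}(0,f)$ is $1$ if the origin is a pole of odd multiplicity and $0$ otherwise. Finally, $$\overline{N}_{\mathrm{O}}(r,f)=\overline{N}_{\mathrm{odd}}(r,f)+\overline{N}_{\mathrm{odd}}(r,1/f),$$ so that $\overline{N}_{\mathrm{O}}$ counts the distinct poles and zeros of odd multiplicity. *)

(* Defs.v *)
From HB Require Import structures.
From mathcomp Require Import all_boot all_order all_algebra.
From mathcomp Require Import complex.
From mathcomp Require Import all_classical all_reals all_analysis.

Set Implicit Arguments.
Unset Strict Implicit.
Unset Printing Implicit Defensive.

Import Order.TTheory GRing.Theory Num.Theory.
Import numFieldNormedType.Exports.

Local Open Scope classical_set_scope.
Local Open Scope ring_scope.

(** * Meromorphic functions on the complex plane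

    The complex field is [R[i]]; the local notions are stated over any
    [numFieldType], whose canonical topology [R[i]] then receives.

    A meromorphic function is represented by a total function of which only the
    germs on punctured neighbourhoods matter: its values on a closed discrete
    set (its poles in particular) are irrelevant.  Equality of meromorphic
    functions is accordingly [mero_eq], pointwise field operations and shifts
    represent those of meromorphic functions, and none of the notions below
    distinguishes two [mero_eq] representatives of a meromorphic function. *)

Definition mero_eq (K : numFieldType) (f g : K -> K) : Prop :=
  forall z0 : K, \forall z \near z0^', f z = g z.

Definition holomorphic_near (K : numFieldType) (g : K -> K) (z0 : K) :
    Prop :=
  \forall z \near z0, derivable (g : K^o -> K^o) z 1.

Definition meromorphic (K : numFieldType) (f : K -> K) : Prop :=
  forall z0 : K, exists (k : nat) (g : K -> K),
    holomorphic_near g z0 /\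
    \forall z \near z0^', f z = g z / (z - z0) ^+ k.

Definition nonconstant (K : numFieldType) (f : K -> K) : Prop :=
  ~ exists c : K, mero_eq f (fun=> c).

Definition rational (K : numFieldType) (f : K -> K) : Prop :=
  exists p q : {poly K}, q != 0 /\ mero_eq f (fun z => p.[z] / q.[z]).

Definition transcendental (K : numFieldType) (f : K -> K) : Prop :=
  ~ rational f.

Definition has_pole (K : numFieldType) (f : K -> K) (z0 : K) (k : nat) :
    Prop :=
  (0 < k)%N /\
  exists g : K -> K,
    [/\ holomorphic_near g z0, g z0 != 0
      & \forall z \near z0^', f z = g z / (z - z0) ^+ k].

(** The multiplicity [k] in [has_pole] is unique; it is [0] when there is no
    pole. *)
Definition pole_mult (K : numFieldType) (f : K -> K) (z0 : K) : nat :=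
  xget 0%N [set k | has_pole f z0 k].

(** * Counting functions

    [mu z] is the weight with which the point [z] is counted; the sum is
    finite when [mu] has finitely many nonzero values in the disc.  Counting in
    the open or in the closed disc gives the same [Ncount], since the two
    counts differ for at most countably many [t]. *)

Definition ncount (R : realType) (mu : R[i] -> nat) (r : R) : R :=
  \sum_(z \in [set z : R[i] | Normc.normc z < r]) ((mu z)%:R : R).

Definition Ncount (R : realType) (mu : R[i] -> nat) (r : R) : R :=
  \int[@lebesgue_measure R]_(t in `]0, r[) ((ncount mu t - (mu 0)%:R) / t)
  + (mu 0)%:R * ln r.

Definition pole_counting (R : realType) (f : R[i] -> R[i]) : R -> R :=
  Ncount (pole_mult f).

Definition odd_pole_counting (R : realType) (f : R[i] -> R[i]) : R -> R :=
  Ncount (fun z => odd (pole_mult f z) : nat).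

Definition odd_counting (R : realType) (f : R[i] -> R[i]) (r : R) : R :=
  odd_pole_counting f r + odd_pole_counting (fun z => (f z)^-1) r.

(** * Nevanlinna characteristic *)

(** [ln 0 = 0] in the library, so [log_plus 0 = 0] as it should be. *)
Definition log_plus (R : realType) (x : R) : R := Num.max 0 (ln x).

Definition circle_point (R : realType) (r t : R) : R[i] :=
  Complex (r * cos t) (r * sin t).

Definition proximity (R : realType) (f : R[i] -> R[i]) (r : R) : R :=
  (2 * pi)^-1 *
  \int[@lebesgue_measure R]_(t in `[0, 2 * pi])
    log_plus (Normc.normc (f (circle_point r t))).

Definition characteristic (R : realType) (f : R[i] -> R[i]) (r : R) : R :=
  proximity f r + pole_counting f r.

(** * Exceptional sets and small functions *)

Definition finite_log_measure (R : realType) (E : set R) : Prop :=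
  [/\ measurable E, E `<=` `[1, +oo[
    & (\int[@lebesgue_measure R]_(t in E) (t^-1)%:E < +oo)%E].

(** [r] tends to infinity while staying outside [E] *)
Definition infty_outside (R : realType) (E : set R) : set_system R :=
  within (~` E) (pinfty_nbhs R).

Definition small_quantity (R : realType) (phi : R -> R) (f : R[i] -> R[i]) :
    Prop :=
  exists E : set R, finite_log_measure E /\
    forall eps : R, 0 < eps -> \forall r \near infty_outside E,
      `|phi r| <= eps * `|characteristic f r|.

(** * The difference equation *)

Definition fdelta (R : realType) (f : R[i] -> R[i]) (z : R[i]) : R[i] :=
  f (z + 1) - f z.

Definition solution (R : realType) (A B f : R[i] -> R[i]) : Prop :=
  meromorphic f /\
  mero_eq (fun z => fdelta f z ^+ 2) (fun z => A z * (f z * f (z + 1) - B z)).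

Definition admissible_solution (R : realType) (A B f : R[i] -> R[i]) : Prop :=
  [/\ solution A B f, transcendental f,
      small_quantity (characteristic A) f
    & small_quantity (characteristic B) f].

Definition Gfun (R : realType) (A B f : R[i] -> R[i]) (z : R[i]) : R[i] :=
  (A z + 4) * f z ^+ 2 - 4 * B z.

(* Main.v *)
(** The equation is quadratic in [f (z + 1)] with discriminant [A * G f], so
    [A * G f] is the square of a meromorphic function for every solution [f].
    Hence [A] and [G f] have orders of the same parity at every point, unless
    [G f] vanishes identically, and the points of odd order of [G f1] and of
    [G f2] are both those of [A]: alternative (ii) always holds.

    If [G f = 0] then [(A + 4) f ^ 2 = 4 B].  Jensen's formula gives
    [2 T(r, f) <= T(r, A) + T(r, B) + O(1)], which with admissibility bounds
    [T(r, f)], and then [T(r, A)], along a sequence of radii going to infinity;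
    but [T(r, A) >= ln r - O(1)] since [A] is not constant.  Jensen's formula is
    only needed on circles without zeros or poles, which excludes countably many
    radii.

    Complex derivability is not assumed continuous, so that Goursat's lemma is
    needed.  Path integrals are increments of antiderivatives; Cauchy's formula
    follows from the existence of primitives of
    [z |-> (f z - f w) / (z - w)] on discs, continuous at the exceptional
    point [w]. *)

Require Import Defs.
From mathcomp Require Import all_boot all_order all_algebra.
From mathcomp Require Import complex.
From mathcomp Require Import all_classical all_reals all_analysis.
From mathcomp Require Import ring lra.
From mathcomp Require Import measurable_realfun zify.
Import Order.TTheory GRing.Theory Num.Theory.
Import numFieldNormedType.Exports.
Local Open Scope classical_set_scope.
Local Open Scope ring_scope.

(** Orders are factorizations [h x * (x - z) ^ m] with [h] holomorphic and nonzero at [z]; no power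
    series occur. A holomorphic germ without finite order vanishes, because it can be divided by x -
    z indefinitely while Cauchy's formula bounds every quotient on a smaller disc. The passage from
    one point to the whole plane is made along a segment.

    Jensen's formula is reduced to zero-free functions by Blaschke factors: these have modulus one
    on the circle, so multiplying by their powers removes the zeros and poles inside and leaves the
    integral unchanged.

    Representatives are reliable only off a discrete set, so pointwise estimates on a circle are
    made only where all functions involved are holomorphic and nonzero. The excluded radii are
    countable, hence null, whereas a half-line has infinite logarithmic measure; so there are large
    radii avoiding them and both exceptional sets.

    Smallness is used with the constant 1/2 for both A and B: then 2 T(r, f) <= T(r, f) + K, hence
    T(r, f) <= K and T(r, A) <= K / 2, against the growth of ln r. *)

(** A copy of [R[i]] on which unification finds the topology of a
    [numFieldType]; on [R[i]] itself it does not. *)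
Definition Cx (R : realType) : numFieldType := R[i].
Local Notation normc := Normc.normc.
Local Notation Re := complex.Re.
Local Notation Im := complex.Im.
Local Notation "x %:C" := (real_complex _ x) : ring_scope.

(** * Complex numbers *)

Section Norm.
Context {R : realType}.
Local Notation C := (Cx R).
Implicit Types (x y z : C) (r : R).

Lemma normrC z : `|z| = (normc z)%:C.
Proof. by []. Qed.

Lemma normcD x y : normc (x + y) <= normc x + normc y.
Proof. by rewrite -lecR rmorphD/=; exact: (@ler_normD _ R[i]). Qed.

Lemma normcZ x y : normc (x * y) = normc x * normc y.
Proof. exact: Normc.normcM. Qed.

Lemma normcI x : normc x^-1 = (normc x)^-1.
Proof. exact: Normc.normcV. Qed.

Lemma normc_opp x : normc (- x) = normc x.
Proof. by apply: complexI; rewrite -!normrC normrN. Qed.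

Lemma normc_dist x y : normc (x - y) = normc (y - x).
Proof. by rewrite -normc_opp opprB. Qed.

Lemma normc_ge0 x : 0 <= normc x.
Proof. by rewrite -lecR; exact: (@normr_ge0 _ R[i]). Qed.

Lemma normc_eq0 x : (normc x == 0) = (x == 0).
Proof.
apply/eqP/eqP => [/Normc.eq0_normc//|->]; exact: Normc.normc0.
Qed.

Lemma normc_zero : normc (0 : C) = 0.
Proof. exact: Normc.normc0. Qed.

Lemma normc_one : normc (1 : C) = 1.
Proof. exact: Normc.normc1. Qed.

Lemma normc_gt0 x : (0 < normc x) = (x != 0).
Proof. by rewrite lt_neqAle normc_ge0 andbT eq_sym normc_eq0. Qed.

Lemma normc_real r : normc (r%:C : C) = `|r|.
Proof. by rewrite /= expr0n addr0 sqrtr_sqr. Qed.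

Lemma normcX x n : normc (x ^+ n) = normc x ^+ n.
Proof.
elim: n => [|n IH]; first by rewrite !expr0 normc_one.
by rewrite !exprS normcZ IH.
Qed.

Lemma normcXz x (n : int) : normc (x ^ n) = normc x ^ n.
Proof.
case: n => n; first by rewrite -[x ^ _]/(x ^+ n) normcX.
by rewrite -[x ^ _]/((x ^+ n.+1)^-1) normcI normcX.
Qed.

Lemma normcB x y : normc x - normc y <= normc (x - y).
Proof. by rewrite lerBlDr -{1}(subrK y x) normcD. Qed.

Lemma Cx_ind (P : C -> Prop) : (forall a b : R, P (Complex a b)) -> forall z, P z.
Proof. exact: (fun h z => match (z : R[i]) with Complex a b => h a b end). Qed.

Lemma ReD x y : Re (x + y) = Re x + Re y.
Proof. by elim/Cx_ind: x => a b; elim/Cx_ind: y. Qed.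
Lemma ReB x y : Re (x - y) = Re x - Re y.
Proof. by elim/Cx_ind: x => a b; elim/Cx_ind: y. Qed.
Lemma ImB x y : Im (x - y) = Im x - Im y.
Proof. by elim/Cx_ind: x => a b; elim/Cx_ind: y. Qed.
Lemma ReM x y : Re (x * y) = Re x * Re y - Im x * Im y.
Proof. by elim/Cx_ind: x => a b; elim/Cx_ind: y. Qed.
Lemma ImM x y : Im (x * y) = Re x * Im y + Im x * Re y.
Proof. by elim/Cx_ind: x => a b; elim/Cx_ind: y. Qed.

Lemma Cx_eq x y : Re x = Re y -> Im x = Im y -> x = y.
Proof. by elim/Cx_ind: x => a b; elim/Cx_ind: y => c d /= -> ->. Qed.

Lemma normc_Re z : `|Re z| <= normc z.
Proof. by rewrite -lecR; exact: normc_ge_Re. Qed.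

Lemma sqr_normcE z : normc z ^+ 2 = Re z ^+ 2 + Im z ^+ 2.
Proof. by elim/Cx_ind: z => a b /=; rewrite sqr_sqrtr ?addr_ge0 ?sqr_ge0. Qed.

Lemma normc_Im z : `|Im z| <= normc z.
Proof.
rewrite -ler_sqr ?nnegrE ?normc_ge0// sqr_normcE real_normK ?num_real//.
by rewrite lerDr sqr_ge0.
Qed.

Lemma normc_ReIm z : normc z <= `|Re z| + `|Im z|.
Proof.
rewrite -ler_sqr ?nnegrE ?normc_ge0 ?addr_ge0// sqr_normcE sqrrD.
by rewrite !real_normK ?num_real// lerD2r lerDl mulrn_wge0// mulr_ge0.
Qed.

Lemma normc_conj z : normc (z^*%C : C) = normc z.
Proof. by elim/Cx_ind: z => a b /=; rewrite sqrrN. Qed.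

Lemma mulC_conj z : z * (z^*%C : C) = (normc z ^+ 2)%:C.
Proof.
by rewrite sqr_normcE; elim/Cx_ind: z => a b; apply: Cx_eq; rewrite ?ReM ?ImM /=; ring.
Qed.

(** Balls of [Cx R] have radii in the complex field, but a positive element of that field is real,
    so real radii define the same neighbourhoods. *)
Lemma nbhsCP z (A : set C) :
  nbhs z A <-> exists2 d : R, 0 < d & forall w, normc (w - z) < d -> A w.
Proof.
split=> [/nbhs_ballP[e /= e0 eA]|[d d0 dA]].
  have eR : (Re e)%:C = e by rewrite RRe_real// gtr0_real.
  exists (Re e); first by rewrite -ltcR eR.
  by move=> w wz; apply: eA; rewrite /ball/= distrC normrC -eR ltcR.
apply/nbhs_ballP; exists d%:C => /=; first by rewrite ltcR.
by move=> w; rewrite /ball/= distrC normrC ltcR => /dA.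
Qed.

Lemma dnbhsCP z (A : set C) :
  nbhs z^' A <->
  exists2 d : R, 0 < d & forall w, w != z -> normc (w - z) < d -> A w.
Proof.
rewrite /dnbhs /within/=; split=> [/nbhsCP[d d0 dA]|[d d0 dA]].
  by exists d => // w wz wd; exact: dA.
by apply/nbhsCP; exists d => // w wd wz; exact: dA.
Qed.

End Norm.

(** * Limits of complex-valued functions *)

Section Limits.
Context {R : realType}.
Local Notation C := (Cx R).
Context {X : Type} {F : set_system X} {FF : Filter F}.
Implicit Types (f g : X -> C) (a b : C).

Lemma cvgCP f a :
  f @ F --> a <->
  forall e : R, 0 < e -> \forall x \near F, normc (f x - a) < e.
Proof.
split=> [/cvgrPdist_lt fa e e0|fa].
  have /fa : 0 < e%:C :> C by rewrite ltcR.
  by apply: filterS => x; rewrite normrC ltcR normc_dist.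
apply/cvgrPdist_lt => e e0.
have eR : (Re e)%:C = e by rewrite RRe_real// gtr0_real.
have /fa : 0 < Re e by rewrite -ltcR eR.
by apply: filterS => x h; rewrite normrC -eR ltcR normc_dist.
Qed.

Lemma cvgC_Re f a : f @ F --> a -> (fun x => Re (f x)) @ F --> Re a.
Proof.
move=> /cvgCP fa; apply/cvgrPdist_lt => e /fa; apply: filterS => x.
by apply: le_lt_trans; rewrite distrC -ReB normc_Re.
Qed.

Lemma cvgC_Im f a : f @ F --> a -> (fun x => Im (f x)) @ F --> Im a.
Proof.
move=> /cvgCP fa; apply/cvgrPdist_lt => e /fa; apply: filterS => x.
by apply: le_lt_trans; rewrite distrC -ImB normc_Im.
Qed.

Lemma cvgC_normc f a : f @ F --> a -> (fun x => normc (f x)) @ F --> normc a.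
Proof.
move=> /cvgCP fa; apply/cvgrPdist_lt => e /fa; apply: filterS => x.
apply: le_lt_trans; rewrite ler_norml -{1}(opprB (normc (f x))).
by rewrite lerN2 normcB normc_dist normcB.
Qed.

Lemma cvgC_ReIm (u v : X -> R) (c d : R) :
  u @ F --> c -> v @ F --> d ->
  (fun x => Complex (u x) (v x) : C) @ F --> (Complex c d : C).
Proof.
move=> /cvgrPdist_lt uc /cvgrPdist_lt vd; apply/cvgCP => e e0.
have e20 : 0 < e / 2 by rewrite divr_gt0.
apply: filterS2 (uc _ e20) (vd _ e20) => x ux vx.
apply: le_lt_trans (normc_ReIm _) _; rewrite /= (splitr e) ltrD//.
  by rewrite distrC.
by rewrite distrC.
Qed.

End Limits.

Lemma cvgC_nbhsP {R : realType} (f : Cx R -> Cx R) (z a : Cx R) :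
  f @ nbhs z --> a <->
  forall e : R, 0 < e ->
    exists2 d : R, 0 < d & forall w, normc (w - z) < d -> normc (f w - a) < e.
Proof.
split=> [fa e e0|h].
  by apply/nbhsCP; move/cvgCP : fa => /(_ e e0).
by apply/cvgCP => e /h hd; apply/nbhsCP.
Qed.

(** * Differentiation rules, common to complex functions and curves *)

Section Deriv.
Context {R : realType}.
Local Notation C := (Cx R).

(** Carathéodory's form of differentiability: [i = id] and [F = nbhs x] for
    complex derivatives, [i] the embedding of the reals for curves. *)
Definition cderiv {X : Type} (F : set_system X) (i f : X -> C) (x : X)
    (d : C) : Prop :=
  exists q : X -> C, [/\ \forall y \near F, f y - f x = q y * (i y - i x),
     q @ F --> d & q x = d].

Definition hder (f : C -> C) (z d : C) := cderiv (nbhs z) id f z d.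
Definition rder (f : R -> C) (t : R) (d : C) :=
  cderiv (nbhs t) (fun s => s%:C) f t d.

Context {X : Type} {F : set_system X} {FF : Filter F} {i : X -> C} {x : X}.
Hypothesis ix : i @ F --> i x.
Local Notation D := (cderiv F i).
Implicit Types (f g : X -> C) (d e c : C).

Lemma cderiv_cst c : D (fun=> c) x 0.
Proof.
exists (fun=> 0); split; [|exact: cvg_cst|by []].
by apply: nearW => y; rewrite subrr mul0r.
Qed.

Lemma cderiv_id : D i x 1.
Proof.
exists (fun=> 1); split; [|exact: cvg_cst|by []].
by apply: nearW => y; rewrite mul1r.
Qed.

Lemma cderiv_near_eq f g d :
  (\forall y \near F, f y = g y) -> f x = g x -> D f x d -> D g x d.
Proof.
move=> fg fgx [q [qe qd qx]]; exists q; split; [|exact: qd|exact: qx].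
by apply: filterS2 fg qe => y <- <-; rewrite fgx.
Qed.

Lemma cderiv_cvg f d : D f x d -> f @ F --> f x.
Proof.
move=> [q [qe qd qx]].
have : (fun y => f x + q y * (i y - i x)) @ F --> f x + d * (i x - i x).
  by apply: cvgD; [exact: cvg_cst|apply: cvgM; [exact: qd|apply: cvgB; [exact: ix|exact: cvg_cst]]].
rewrite subrr mulr0 addr0; apply: cvg_trans; apply: near_eq_cvg.
by apply: filterS qe => y <-; rewrite addrC subrK.
Qed.

Lemma cderivD f g d e : D f x d -> D g x e -> D (fun y => f y + g y) x (d + e).
Proof.
move=> [q [qe qd qx]] [p [pe pd px]]; exists (fun y => q y + p y); split.
- by apply: filterS2 qe pe => y h1 h2; rewrite mulrDl -h1 -h2; ring.
- by apply: cvgD; [exact: qd|exact: pd].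
- by rewrite ?qx ?px.
Qed.

Lemma cderivM f g d e :
  D f x d -> D g x e -> D (fun y => f y * g y) x (d * g x + f x * e).
Proof.
move=> df dg; have cg := cderiv_cvg _ _ dg.
move: df dg => [q [qe qd qx]] [p [pe pd px]].
exists (fun y => q y * g y + f x * p y); split.
- apply: filterS2 qe pe => y h1 h2.
  by rewrite mulrDl -(mulrA (f x)) -h2 mulrAC -h1; ring.
- apply: cvgD; apply: cvgM; [exact: qd|exact: cg|exact: cvg_cst|exact: pd].
- by rewrite ?qx ?px.
Qed.

Lemma cderivZ f d c : D f x d -> D (fun y => c * f y) x (c * d).
Proof.
move=> df; have := cderivM _ _ _ _ (cderiv_cst c) df.
by rewrite mul0r add0r.
Qed.

Lemma cderivN f d : D f x d -> D (fun y => - f y) x (- d).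
Proof.
move=> /(cderivZ _ _ (-1)); rewrite mulN1r; apply: cderiv_near_eq.
  by apply: nearW => y; rewrite mulN1r.
by rewrite mulN1r.
Qed.

Lemma cderivB f g d e : D f x d -> D g x e -> D (fun y => f y - g y) x (d - e).
Proof. by move=> df dg; apply: cderivD => //; exact: cderivN. Qed.

(** Carathéodory's factorization involves no division, so points y with f y = f x need no separate
    treatment. The outer function is complex differentiable; the inner one may be a curve. *)
Lemma cderiv_comp h f d e :
  hder h (f x) e -> D f x d -> D (fun y => h (f y)) x (e * d).
Proof.
move=> dh df; have cf := cderiv_cvg _ _ df.
move: dh df => [p [pe pd px]] [q [qe qd qx]].
exists (fun y => p (f y) * q y); split.
- have : \forall y \near F, h (f y) - h (f x) = p (f y) * (f y - f x).
    exact: cf _ pe.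
  by apply: filterS2 qe => y h1 ->; rewrite h1 mulrA.
- by apply: cvgM; [exact: cvg_comp cf pd|exact: qd].
- by rewrite ?qx ?px.
Qed.

End Deriv.

(** * Antiderivatives of curves *)

Section Slopes.
Context {K : numFieldType}.
Implicit Types (f q : K -> K) (t d : K).

Lemma shift_dnbhs t : (fun y : K => y - t) @ t^' --> (0 : K)^'.
Proof.
have c : (fun y : K => y - t) @ t --> (0 : K).
  by rewrite -[X in _ --> X](subrr t); apply: (@cvgB _ _ _ (nbhs t)); [by move=> ?|exact: cvg_cst].
move=> A /c; apply: (@filterS _ (nbhs t)) => y h yt.
by apply: h; rewrite subr_eq0.
Qed.

(** Bridge to the derivatives of the library, over any [numFieldType] because it serves both the
    real components of curves and complex functions. *)
Lemma slope_is_derive f q t d :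
  (\forall y \near t, f y - f t = q y * (y - t)) -> q @ t --> d ->
  is_derive t 1 (f : K^o -> K^o) (d : K^o).
Proof.
move=> fq qd.
have sh : (fun h : K => h + t) @ (0 : K)^' --> t.
  apply: cvg_within_filter.
  have : (fun h : K => h + t) @ (0 : K) --> 0 + t.
    by apply: (@cvgD _ _ _ (nbhs (0 : K))); [by move=> ?|exact: cvg_cst].
  by rewrite add0r.
have h : (fun h : K => h^-1 *: (((f (h *: 1 + t) - f t) : K^o))) @ (0 : K)^' --> (d : K^o).
  refine (cvg_trans _ (cvg_comp _ _ sh qd)); apply: near_eq_cvg.
  have fq' : \forall h \near (0 : K)^', f (h + t) - f t = q (h + t) * (h + t - t).
    exact: sh _ fq.
  have h0 : \forall h \near (0 : K)^', h != 0 by exact: nbhs_dnbhs_neq.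
  apply: filterS2 h0 fq' => h h0 /= fq'.
  by rewrite /GRing.scale /= mulr1 fq' addrK mulrC mulfK.
by split; [apply: cvgP h|exact: (cvg_lim (@norm_hausdorff _ K^o) h)].
Qed.

Lemma derivable_slope f t : derivable (f : K^o -> K^o) t 1 ->
  exists q : K -> K, (forall y, f y - f t = q y * (y - t)) /\ q @ t --> q t.
Proof.
move=> /cvg_ex[/= d fd].
pose q y := if y == t then d else (f y - f t) / (y - t).
exists q; split=> [y|].
  rewrite /q; case: eqVneq => [->|yt]; first by rewrite !subrr mulr0.
  by rewrite divfK// subr_eq0.
have -> : q t = d by rewrite /q eqxx.
have h : q @ t^' --> d.
  refine (cvg_trans _ (cvg_comp _ _ (shift_dnbhs t) fd)); apply: near_eq_cvg.
  have yt : \forall y \near t^', y != t by exact: nbhs_dnbhs_neq.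
  apply: filterS yt => y yt /=.
  by rewrite /q (negbTE yt) /GRing.scale /= mulr1 subrK mulrC.
move=> A hA; have := h _ hA; apply: (@filterS _ (nbhs t)) => y; case: (eqVneq y t) => [-> _|yt]; last exact.
by rewrite /= /q eqxx; exact: nbhs_singleton hA.
Qed.

End Slopes.

Section Integral.
Context {R : realType}.
Local Notation C := (Cx R).
Implicit Types (g G : R -> C) (f P : C -> C) (a b c z : C) (s t M : R).

Lemma rderRe G t d : rder G t d -> is_derive t 1 (fun s => Re (G s)) (Re d).
Proof.
move=> [q [qe qd _]]; apply: (@slope_is_derive _ _ (fun s => Re (q s))).
  apply: filterS qe => y; rewrite -ReB => ->.
  by rewrite ReM ImB subrr mulr0 subr0 ReB.
exact: cvgC_Re.
Qed.

Lemma rder_ReIm (u v : R -> R) t (d e : R) :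
  is_derive t 1 u d -> is_derive t 1 v e ->
  rder (fun s => Complex (u s) (v s)) t (Complex d e).
Proof.
have slope (w : R -> R) (d' : R) : is_derive t 1 w d' ->
    exists q, [/\ forall y, w y - w t = q y * (y - t), q @ t --> d' & q t = d'].
  move=> wd; have [q [qe qt]] := derivable_slope w t (@ex_derive _ _ _ _ _ _ _ wd).
  have qe' : \forall y \near t, w y - w t = q y * (y - t) by apply: (@nearW _ (nbhs t)).
  have wq := slope_is_derive w q t (q t) qe' qt.
  have qd : q t = d' by rewrite -(@derive_val _ _ _ _ _ _ _ wd) -(@derive_val _ _ _ _ _ _ _ wq).
  by exists q; split=> //; rewrite -qd.
move=> /slope[q [qe qd qt]] /slope[p [pe pd pt]].
exists (fun s => Complex (q s) (p s)); split.
- apply: nearW => y; apply: Cx_eq; rewrite !(ReB, ImB, ReM, ImM) /= ?qe ?pe; ring.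
- exact: cvgC_ReIm.
- by rewrite qt pt.
Qed.

Lemma real_cvg t : (fun s : R => s%:C : C) @ t --> (t%:C : C).
Proof. by apply: cvgC_ReIm; [by move=> ?|exact: cvg_cst]. Qed.

(** Curves are defined on the whole line and derivatives at 0 and 1 are two-sided; the continuity
    hypotheses on integrands are two-sided there as well. *)
Definition prim g G := forall s, 0 <= s <= 1 -> rder G s (g s).

(** The mean value inequality for complex curves. The real mean value theorem is applied to the
    component of [G] along v = G 1 - G 0, that is to Re (u G) with u the conjugate of v / |v|, so
    that Re (u v) = |v|. *)
Lemma prim_bound g G M : prim g G ->
  (forall s, 0 <= s <= 1 -> normc (g s) <= M) -> normc (G 1 - G 0) <= M.
Proof.
move=> gG gM; have [v vE] : exists v, v = G 1 - G 0 by exists (G 1 - G 0).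
rewrite -vE.
have [->|v0] := eqVneq v 0.
  by rewrite normc_zero (le_trans (normc_ge0 (g 0))) ?gM ?lexx ?ler01.
have nv : normc v != 0 by rewrite normc_eq0.
pose u : C := (v^*%C : C) * ((normc v)^-1)%:C.
have nu : normc u = 1.
  by rewrite normcZ normc_conj normc_real ger0_norm ?invr_ge0 ?normc_ge0// mulfV.
have uv : Re (u * v) = normc v.
  rewrite /u mulrAC (mulrC _ v) mulC_conj -rmorphM /= expr2.
  by rewrite mulfK.
clearbody u.
pose h t := Re (u * G t).
have hd t : t \in `[0, 1] -> is_derive t 1 h (Re (u * g t)).
  rewrite in_itv/= => t01; apply: rderRe; apply: cderivZ; [exact: real_cvg|exact: gG].
have hoo t : t \in `]0, 1[ -> is_derive t 1 h (Re (u * g t)).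
  by move=> /subset_itv_oo_cc t01; exact: hd.
have hcont : {within `[0, 1], continuous h}.
  apply: derivable_within_continuous => t t01.
  by have := hd _ t01; case.
have [c c01 hc] := MVT ltr01 hoo hcont.
have e : h 1 - h 0 = normc v.
  by rewrite -uv vE mulrBr ReB.
rewrite -e hc subr0 mulr1.
apply: le_trans (ler_norm _) _; apply: le_trans (normc_Re _) _.
by rewrite normcZ nu mul1r gM// ltW ?(itvP c01).
Qed.

Lemma real_prim (f : R -> R) :
  (forall s, 0 <= s <= 1 -> {for s, continuous f}) ->
  exists F : R -> R, forall s, 0 <= s <= 1 -> is_derive s 1 F (f s).
Proof.
(* Composing with the retraction onto [0, 1] makes the integrand continuous on the whole line. *)
move=> cf; pose cl s := Num.max 0 (Num.min 1 s) : R.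
have cl01 s : 0 <= cl s <= 1.
  by rewrite /cl le_max lexx ge_max ler01 ge_min lexx.
have cle s : 0 <= s <= 1 -> cl s = s.
  by move=> /andP[s0 s1]; rewrite /cl; rewrite min_r// max_r.
have ccl s : {for s, continuous cl}.
  apply: (@continuous_max _ _ (fun=> 0) (fun s => Num.min 1 s)); first exact: cst_continuous.
  by apply: (@continuous_min _ _ (fun=> 1) id); [exact: cst_continuous|by move=> ?].
have cfc : continuous (f \o cl).
  by move=> s; apply: continuous_comp; [exact: ccl|apply: cf; exact: cl01].
(* The integral is taken inside [-1, 2], so that 0 and 1 are interior points and the derivative
   there is two-sided. *)
exists (fun x => \int[lebesgue_measure]_(t in `[-1, x]) (f \o cl) t) => s s01.
have [s0 s1] := andP s01.
have [] := @continuous_FTC1_closed R (f \o cl) (-1) s 2.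
- by lra.
- apply: (@continuous_compact_integrable R (f \o cl) `[-1, 2]).
    exact: segment_compact.
  exact: continuous_subspaceT.
- by lra.
- exact: cfc.
move=> h1 h2; split; first exact: h1.
by move: h2; rewrite derive1E /= cle.
Qed.

Lemma ex_prim g : (forall s, 0 <= s <= 1 -> {for s, continuous g}) ->
  exists G, prim g G.
Proof.
move=> cg.
have [U hU] : exists U : R -> R, forall s, 0 <= s <= 1 -> is_derive s 1 U (Re (g s)).
  by apply: real_prim => s s01; apply: cvgC_Re; exact: cg.
have [V hV] : exists V : R -> R, forall s, 0 <= s <= 1 -> is_derive s 1 V (Im (g s)).
  by apply: real_prim => s s01; apply: cvgC_Im; exact: cg.
exists (fun s => Complex (U s) (V s)) => s s01.
have -> : g s = Complex (Re (g s)) (Im (g s)) by exact: Cx_eq.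
by apply: rder_ReIm; [exact: hU|exact: hV].
Qed.

(** The choice of the antiderivative is harmless by [prim_cint]; the value is 0 when there is
    none. *)
Definition cint g : C := xget 0 [set v | exists G, prim g G /\ v = G 1 - G 0].

Lemma prim_cint g G : prim g G -> cint g = G 1 - G 0.
Proof.
move=> gG; rewrite /cint; case: xgetP => [v ->[H [gH ->]]|/(_ (G 1 - G 0))h]; last first.
  by case: h; exists G.
have : normc ((H 1 - G 1) - (H 0 - G 0)) <= 0.
  apply: (@prim_bound (fun s => g s - g s) (fun s => H s - G s)).
    by move=> s s01; apply: cderivB; [exact: real_cvg|exact: gH|exact: gG].
  by move=> s _; rewrite subrr normc_zero.
rewrite le_eqVlt ltNge normc_ge0 orbF normc_eq0 => /eqP h.
by apply/eqP; rewrite -subr_eq0 -h; apply/eqP; ring.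
Qed.

End Integral.

(** * Integrals of curves and integrals along segments *)

Section Cint.
Context {R : realType}.
Local Notation C := (Cx R).
Implicit Types (g h G : R -> C) (f P : C -> C) (a b c z : C) (s t M : R).

Definition cont01 g := forall s, 0 <= s <= 1 -> {for s, continuous g}.

Lemma cont01_prim g : cont01 g -> exists2 G, prim g G & cint g = G 1 - G 0.
Proof. by move=> /ex_prim[G gG]; exists G => //; exact: prim_cint. Qed.

Lemma cintD g h : cont01 g -> cont01 h ->
  cint (fun s => g s + h s) = cint g + cint h.
Proof.
move=> /cont01_prim[G gG ->] /cont01_prim[H hH ->].
rewrite (prim_cint _ (fun s => G s + H s)); first by ring.
by move=> s s01; apply: cderivD; [exact: gG|exact: hH].
Qed.

Lemma cintZ a g : cont01 g -> cint (fun s => a * g s) = a * cint g.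
Proof.
move=> /cont01_prim[G gG ->]; rewrite (prim_cint _ (fun s => a * G s)).
  by rewrite mulrBr.
by move=> s s01; apply: cderivZ; [exact: real_cvg|exact: gG].
Qed.

Lemma cont01Z a g : cont01 g -> cont01 (fun s => a * g s).
Proof.
move=> cg s s01; apply: (@cvgM _ _ (nbhs s)); first exact: cvg_cst.
exact: cg.
Qed.

Lemma cont01D g h : cont01 g -> cont01 h -> cont01 (fun s => g s + h s).
Proof.
by move=> cg ch s s01; apply: (@cvgD _ _ _ (nbhs s)); [exact: cg|exact: ch].
Qed.

Lemma cont01M g h : cont01 g -> cont01 h -> cont01 (fun s => g s * h s).
Proof.
by move=> cg ch s s01; apply: (@cvgM _ _ (nbhs s)); [exact: cg|exact: ch].
Qed.

Lemma cont01V g : cont01 g -> (forall s, 0 <= s <= 1 -> g s != 0) ->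
  cont01 (fun s => (g s)^-1).
Proof.
by move=> cg g0 s s01; apply: (@cvgV _ _ (nbhs s)); [exact: g0|exact: cg].
Qed.

Lemma cont01_cst a : cont01 (fun=> a).
Proof. by move=> s s01; exact: cvg_cst. Qed.

Lemma cont01B g h : cont01 g -> cont01 h -> cont01 (fun s => g s - h s).
Proof.
by move=> cg ch s s01; apply: (@cvgB _ _ _ (nbhs s)); [exact: cg|exact: ch].
Qed.

Lemma cintB g h : cont01 g -> cont01 h ->
  cint (fun s => g s - h s) = cint g - cint h.
Proof.
move=> /cont01_prim[G gG ->] /cont01_prim[H hH ->].
rewrite (prim_cint _ (fun s => G s - H s)); first by ring.
by move=> s s01; apply: cderivB; [exact: real_cvg|exact: gG|exact: hH].
Qed.

Lemma cint_bound g M : cont01 g ->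
  (forall s, 0 <= s <= 1 -> normc (g s) <= M) -> normc (cint g) <= M.
Proof. by move=> /cont01_prim[G gG ->]; exact: prim_bound. Qed.

Lemma eq_cint g h : (forall s, 0 <= s <= 1 -> g s = h s) -> cint g = cint h.
Proof.
move=> gh; rewrite /cint; congr (xget _ _).
apply/seteqP; split=> v [G [gG ->]]; exists G; split=> // s s01.
  by rewrite -gh//; exact: gG.
by rewrite gh//; exact: gG.
Qed.

Lemma cint_cst a : cint (fun=> a) = a.
Proof.
rewrite (prim_cint _ (fun s => a * s%:C)); first by rewrite mulr1 mulr0 subr0.
move=> s s01; rewrite -[a in X in rder _ _ X]mulr1.
by apply: cderivZ; [exact: real_cvg|apply: cderiv_id; exact: real_cvg].
Qed.

Definition pt a b s : C := a + s%:C * (b - a).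

Definition seg f a b : C := (b - a) * cint (fun s => f (pt a b s)).

Definition contat f z := f @ nbhs z --> f z.

Lemma pt0 a b : pt a b 0 = a. Proof. by rewrite /pt mul0r addr0. Qed.
Lemma pt1 a b : pt a b 1 = b. Proof. by rewrite /pt mul1r addrC subrK. Qed.

Lemma rder_affine a b s : rder (fun t => a + t%:C * b) s b.
Proof.
have h : rder (fun t => a + b * t%:C) s (0 + b * 1).
  apply: cderivD; first exact: cderiv_cst.
  by apply: cderivZ; [exact: real_cvg|apply: cderiv_id; exact: real_cvg].
rewrite add0r mulr1 in h; apply: cderiv_near_eq h; last by rewrite mulrC.
by apply: (@nearW _ (nbhs s)) => t; rewrite mulrC.
Qed.

Lemma cont_pt f a b s : contat f (pt a b s) ->
  {for s, continuous (fun s => f (pt a b s))}.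
Proof.
move=> cf; apply: (@cvg_comp _ _ _ (pt a b) f (nbhs s) (nbhs (pt a b s))); last exact: cf.
by apply: cderiv_cvg (rder_affine a (b - a) s); exact: real_cvg.
Qed.

Lemma cont01_pt f a b : (forall s, 0 <= s <= 1 -> contat f (pt a b s)) ->
  cont01 (fun s => f (pt a b s)).
Proof. by move=> cf s s01; apply: cont_pt; exact: cf. Qed.

Lemma hder_contat f z d : hder f z d -> contat f z.
Proof. by apply: cderiv_cvg; move=> ?. Qed.

(** One antiderivative along the whole segment computes the integrals over all its oriented
    subsegments; splitting and reversing a segment then become algebra with its increments. *)
Lemma seg_sub f a b : (forall s, 0 <= s <= 1 -> contat f (pt a b s)) ->
  exists G : R -> C, forall p q, 0 <= p <= 1 -> 0 <= q <= 1 ->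
    seg f (pt a b p) (pt a b q) = G q - G p.
Proof.
move=> cf; have [G gG _] := cont01_prim _ (cont01_pt _ _ _ cf).
exists (fun s => (b - a) * G s) => p q p01 q01; rewrite /seg.
have [->|pq] := eqVneq p q; first by rewrite !subrr mul0r.
have qp0 : (q - p)%:C != 0 :> C by rewrite (inj_eq (@complexI _)) subr_eq0 eq_sym.
have -> : pt a b q - pt a b p = (b - a) * (q - p)%:C by rewrite /pt rmorphB /=; ring.
have ptE s : pt (pt a b p) (pt a b q) s = pt a b (p + s * (q - p)).
  by rewrite /pt rmorphD rmorphM rmorphB /=; ring.
rewrite (prim_cint _ (fun s => ((q - p)%:C)^-1 * G (p + s * (q - p)))).
  rewrite mul1r mul0r addr0 -mulrBr -mulrA mulVKf// [p + _]addrC subrK.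
  by rewrite mulrBr.
move=> s s01; rewrite ptE.
have r01 : 0 <= p + s * (q - p) <= 1.
  case/andP: p01 => p0 p1; case/andP: q01 => q0 q1; case/andP: s01 => s0 s1.
  apply/andP; split; nra.
have [k [ke kd kx]] := gG _ r01.
exists (fun t => k (p + t * (q - p))); split=> //.
- have cv : (fun t => p + t * (q - p)) @ s --> p + s * (q - p).
    apply: (@cvgD _ _ _ (nbhs s)); first exact: cvg_cst.
    by apply: (@cvgM _ _ (nbhs s)); [by move=> ?|exact: cvg_cst].
  have : \forall t \near s, G (p + t * (q - p)) - G (p + s * (q - p)) =
     k (p + t * (q - p)) * ((p + t * (q - p))%:C - (p + s * (q - p))%:C).
    exact: cv _ ke.
  apply: filterS => t e; rewrite -mulrBr e !rmorphD !rmorphM /= !rmorphB /=.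
  by field; rewrite -rmorphB.
- apply: (@cvg_comp _ _ _ (fun t => p + t * (q - p)) k (nbhs s) (nbhs (p + s * (q - p)))); last exact: kd.
  apply: (@cvgD _ _ _ (nbhs s)); first exact: cvg_cst.
  by apply: (@cvgM _ _ (nbhs s)); [by move=> ?|exact: cvg_cst].
Qed.

Lemma seg_mid f a b : (forall s, 0 <= s <= 1 -> contat f (pt a b s)) ->
  seg f a b = seg f a (pt a b 2^-1) + seg f (pt a b 2^-1) b.
Proof.
move=> /seg_sub[G h].
have := h 0 1 _ _; rewrite pt0 pt1 => ->; rewrite ?lexx ?ler01//.
have := h 0 2^-1 _ _; rewrite pt0 => ->; rewrite ?lexx ?ler01//; last by lra.
have := h 2^-1 1 _ _; rewrite pt1 => ->; rewrite ?lexx ?ler01//; last by lra.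
by ring.
Qed.

Lemma seg_rev f a b : (forall s, 0 <= s <= 1 -> contat f (pt a b s)) ->
  seg f b a = - seg f a b.
Proof.
move=> /seg_sub[G h].
have := h 0 1 _ _; rewrite pt0 pt1 => ->; rewrite ?lexx ?ler01//.
have := h 1 0 _ _; rewrite pt0 pt1 => ->; rewrite ?lexx ?ler01//.
by ring.
Qed.

Lemma rder_pt P a b s d : hder P (pt a b s) d ->
  rder (fun t => P (pt a b t)) s (d * (b - a)).
Proof.
by move=> hP; apply: cderiv_comp hP _; [exact: real_cvg|exact: rder_affine].
Qed.

(** Compares the integral of [f] with the increment of a known primitive [P] of a nearby function
    [h]. The mean value inequality is applied to the difference of the two antiderivatives, so [h]
    itself is never integrated. *)
Lemma seg_approx f (h : C -> C) P a b M :
  (forall s, 0 <= s <= 1 -> contat f (pt a b s)) ->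
  (forall s, 0 <= s <= 1 -> hder P (pt a b s) (h (pt a b s))) ->
  (forall s, 0 <= s <= 1 -> normc (f (pt a b s) - h (pt a b s)) <= M) ->
  normc (seg f a b - (P b - P a)) <= M * normc (b - a).
Proof.
move=> cf hP fhM; have [G gG e] := cont01_prim _ (cont01_pt _ _ _ cf).
rewrite /seg e.
have -> : (b - a) * (G 1 - G 0) - (P b - P a) =
    ((b - a) * G 1 - P (pt a b 1)) - ((b - a) * G 0 - P (pt a b 0)).
  by rewrite pt0 pt1; ring.
apply: (@prim_bound _ (fun s => (b - a) * f (pt a b s) - h (pt a b s) * (b - a))
  (fun s => (b - a) * G s - P (pt a b s))) => s s01.
  apply: cderivB; [exact: real_cvg| |exact/rder_pt/hP].
  by apply: cderivZ; [exact: real_cvg|exact: gG].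
rewrite [h _ * _]mulrC -mulrBr normcZ mulrC ler_wpM2r ?normc_ge0//; exact: fhM.
Qed.

Lemma seg_bound f a b M :
  (forall s, 0 <= s <= 1 -> contat f (pt a b s)) ->
  (forall s, 0 <= s <= 1 -> normc (f (pt a b s)) <= M) ->
  normc (seg f a b) <= M * normc (b - a).
Proof.
move=> cf fM; rewrite /seg normcZ mulrC ler_wpM2r ?normc_ge0//.
by apply: cint_bound => //; exact: cont01_pt.
Qed.

End Cint.

(** * Goursat's lemma and primitives *)

Section Dyadic.
Context {R : realType}.
Local Notation C := (Cx R).

(** The intervals of centre u n and radius c / 2 ^ n are nested; [p] is the supremum of their left
    ends. *)
Lemma dyadic_lim_real (u : nat -> R) (c : R) :
  (forall n, `|u n.+1 - u n| <= c / 2 ^+ n.+1) ->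
  exists p, forall n, `|u n - p| <= c / 2 ^+ n.
Proof.
move=> uc; have half n : c / 2 ^+ n = c / 2 ^+ n.+1 + c / 2 ^+ n.+1.
  by rewrite exprS; field; rewrite expf_neq0// pnatr_eq0.
have c0 n : 0 <= c / 2 ^+ n.+1 by exact: le_trans (normr_ge0 _) (uc n).
have step n k : u n - c / 2 ^+ n <= u (n + k)%N - c / 2 ^+ (n + k)
    /\ u (n + k)%N + c / 2 ^+ (n + k) <= u n + c / 2 ^+ n.
  elim: k => [|k [h1 h2]]; first by rewrite addn0.
  have := uc (n + k)%N; rewrite addnS ler_norml => /andP[h3 h4].
  by split; move: h1 h2; rewrite (half (n + k)%N); lra.
have cn n : 0 <= c / 2 ^+ n by rewrite half addr_ge0.
have lu m n : u m - c / 2 ^+ m <= u n + c / 2 ^+ n.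
  have [/subnKC <-|/ltnW/subnKC <-] := leqP m n.
    by have [h _] := step m (n - m)%N; have := cn (m + (n - m))%N; lra.
  by have [_ h] := step n (m - n)%N; have := cn (n + (m - n))%N; lra.
pose A := [set x | exists n, x = u n - c / 2 ^+ n].
have supA : has_sup A.
  split; first by exists (u 0%N - c / 2 ^+ 0), 0%N.
  by exists (u 0%N + c / 2 ^+ 0) => x [n ->].
exists (sup A) => n; rewrite ler_norml; apply/andP; split.
  suff : sup A <= u n + c / 2 ^+ n by lra.
  by apply: ge_sup; [case: supA|move=> x [m ->]].
suff : u n - c / 2 ^+ n <= sup A by lra.
by apply: ub_le_sup; [case: supA|exists n].
Qed.

(** The factor 2 comes from bounding a modulus by the sum of its two components. *)
Lemma dyadic_lim (u : nat -> C) (c : R) :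
  (forall n, normc (u n.+1 - u n) <= c / 2 ^+ n.+1) ->
  exists p, forall n, normc (u n - p) <= 2 * (c / 2 ^+ n).
Proof.
move=> uc.
have [p hp] : exists p, forall n, `|Re (u n) - p| <= c / 2 ^+ n.
  apply: dyadic_lim_real => n; apply: le_trans (uc n).
  by rewrite -ReB; exact: normc_Re.
have [q hq] : exists p, forall n, `|Im (u n) - p| <= c / 2 ^+ n.
  apply: dyadic_lim_real => n; apply: le_trans (uc n).
  by rewrite -ImB; exact: normc_Im.
exists (Complex p q) => n; apply: le_trans (normc_ReIm _) _.
by rewrite ReB ImB mulr_natl mulr2n lerD.
Qed.

Lemma expr2_large (x : R) : exists n : nat, x < 2 ^+ n.
Proof.
exists (Num.bound `|x|); apply: le_lt_trans (ler_norm x) _.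
apply: lt_trans (archi_boundP (normr_ge0 x)) _.
by rewrite -natrX ltr_nat; exact: ltn_expl.
Qed.

End Dyadic.

Section Goursat.
Context {R : realType}.
Local Notation C := (Cx R).
Implicit Types (f P : C -> C) (a b c w z : C) (s t M : R).

Definition tri f a b c : C := seg f a b + seg f b c + seg f c a.

Definition conv (S : set C) :=
  forall a b, S a -> S b -> forall s, 0 <= s <= 1 -> S (pt a b s).

Lemma pt_dist a b z s M : 0 <= s <= 1 -> normc (a - z) <= M ->
  normc (b - z) <= M -> normc (pt a b s - z) <= M.
Proof.
move=> /andP[s0 s1] aM bM.
have -> : pt a b s - z = (1 - s)%:C * (a - z) + s%:C * (b - z).
  by rewrite /pt rmorphB /= rmorph1; ring.
apply: le_trans (normcD _ _) _; rewrite !normcZ !normc_real.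
rewrite !ger0_norm ?subr_ge0//; nra.
Qed.

Section Triangle.
Context {S : set C} {f : C -> C}.
Hypotheses (Sconv : conv S) (cS : forall z, S z -> contat f z).

Let cpt a b s : S a -> S b -> 0 <= s <= 1 -> contat f (pt a b s).
Proof. by move=> Sa Sb s01; apply: cS; exact: Sconv. Qed.

Let half01 : 0 <= (2^-1 : R) <= 1. Proof. by lra. Qed.

(** The midpoints of the sides cut the triangle into four; each side of the middle one is traversed
    once in each direction, and these contributions cancel. *)
Lemma tri_split a b c : S a -> S b -> S c ->
  let m x y := pt x y 2^-1 in
  tri f a b c = tri f a (m a b) (m c a) + tri f (m a b) b (m b c)
   + tri f (m c a) (m b c) c + tri f (m b c) (m c a) (m a b).
Proof.
move=> Sa Sb Sc m; rewrite /tri.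
have Sm x y : S x -> S y -> S (m x y) by move=> Sx Sy; apply: Sconv.
rewrite (seg_mid f a b) ?(seg_mid f b c) ?(seg_mid f c a); try by move=> s; exact: cpt.
rewrite -/(m a b) -/(m b c) -/(m c a).
rewrite (seg_rev f (m a b) (m c a)) ?(seg_rev f (m b c) (m c a)) ?(seg_rev f (m a b) (m b c));
  try by move=> s; apply: cpt; exact: Sm.
ring.
Qed.

(** One of the four triangles carries at least a quarter of the integral. The size of a triangle is
    measured by its two sides at the first vertex: both are halved, and the first vertex moves by at
    most half their sum, so the first vertices form a dyadic sequence. *)
Lemma tri_step a b c : S a -> S b -> S c ->
  exists a' b' c', [/\ S a', S b', S c',
    normc (tri f a b c) <= 4 * normc (tri f a' b' c') &
    [/\ normc (a' - a) <= (normc (b - a) + normc (c - a)) / 2,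
     normc (b' - a') = normc (b - a) / 2 & normc (c' - a') = normc (c - a) / 2]].
Proof.
move=> Sa Sb Sc; have := tri_split _ _ _ Sa Sb Sc.
pose m x y : C := pt x y 2^-1; rewrite /= -/(m a b) -/(m b c) -/(m c a) => E.
have Sm x y : S x -> S y -> S (m x y) by move=> Sx Sy; apply: Sconv.
have h2 : (2^-1)%:C = 2^-1 :> C by rewrite fmorphV rmorph_nat.
have n2 (x : C) : normc (x / 2) = normc x / 2.
  by rewrite -h2 normcZ normc_real ger0_norm// invr_ge0.
set n1 := normc (tri f a (m a b) (m c a)).
set n3 := normc (tri f (m a b) b (m b c)).
set n4 := normc (tri f (m c a) (m b c) c).
set n5 := normc (tri f (m b c) (m c a) (m a b)).
have le4 : normc (tri f a b c) <= n1 + n3 + n4 + n5.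
  rewrite E; apply: le_trans (normcD _ _) _; rewrite lerD2r.
  by apply: le_trans (normcD _ _) _; rewrite lerD2r normcD.
have [h|h1] := leP (normc (tri f a b c)) (4 * n1).
  exists a, (m a b), (m c a); split; [exact: Sa|exact: Sm|exact: Sm|exact: h|split].
  - by rewrite subrr normc_zero divr_ge0// addr_ge0// normc_ge0.
  - by rewrite -n2 /m /pt h2; congr normc; field.
  - by rewrite -n2 /m /pt h2; congr normc; field.
have [h|h3] := leP (normc (tri f a b c)) (4 * n3).
  exists (m a b), b, (m b c); split; [exact: Sm|exact: Sb|exact: Sm|exact: h|split].
  - have -> : m a b - a = (b - a) / 2 by rewrite /m /pt h2; field.
    by rewrite n2 ler_pM2r ?invr_gt0// lerDl normc_ge0.
  - by rewrite -n2 /m /pt h2; congr normc; field.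
  - by rewrite -n2 /m /pt h2; congr normc; field.
have [h|h4] := leP (normc (tri f a b c)) (4 * n4).
  exists (m c a), (m b c), c; split; [exact: Sm|exact: Sm|exact: Sc|exact: h|split].
  - have -> : m c a - a = (c - a) / 2 by rewrite /m /pt h2; field.
    by rewrite n2 ler_pM2r ?invr_gt0// lerDr normc_ge0.
  - by rewrite -n2 /m /pt h2; congr normc; field.
  - by rewrite -n2 /m /pt h2; congr normc; field.
exists (m b c), (m c a), (m a b); split; [exact: Sm|exact: Sm|exact: Sm|rewrite -/n5; move: le4 h1 h3 h4; lra|split].
- have -> : m b c - a = (b - a + (c - a)) / 2 by rewrite /m /pt h2; field.
  by rewrite n2 ler_pM2r ?invr_gt0// normcD.
- by rewrite -n2 -[RHS]normc_opp /m /pt h2; congr normc; field.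
- by rewrite -n2 -[RHS]normc_opp /m /pt h2; congr normc; field.
Qed.

Hypothesis Sclosed : forall z,
  (forall e : R, 0 < e -> exists2 w, S w & normc (w - z) < e) -> S z.
Hypothesis dS : forall z, S z -> exists d, hder f z d.

Lemma hder_quad z0 c0 d z :
  hder (fun z => c0 * z + d / 2 * ((z - z0) * (z - z0))) z (c0 + d * (z - z0)).
Proof.
have hz : hder (fun z : C => z - z0) z 1.
  rewrite -[X in hder _ _ X]subr0; apply: cderivB; first by move=> ?.
    by apply: cderiv_id; move=> ?.
  exact: cderiv_cst.
have -> : c0 + d * (z - z0) = c0 * 1 + d / 2 * (1 * (z - z0) + (z - z0) * 1) by field.
apply: cderivD; apply: cderivZ; try by move=> ?.
  by apply: cderiv_id; move=> ?.
by apply: cderivM; try by move=> ?.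
Qed.

Lemma goursat a b c : S a -> S b -> S c -> tri f a b c = 0.
Proof.
move=> Sa Sb Sc.
(* Triangles with vertices in [S] form a type, on which the subdivision step becomes a function by
   choice and can be iterated. *)
pose T := {x : C * C * C | [/\ S x.1.1, S x.1.2 & S x.2]}.
pose rel (x y : T) := let: (a, b, c) := sval x in let: (a', b', c') := sval y in
  normc (tri f a b c) <= 4 * normc (tri f a' b' c') /\
    [/\ normc (a' - a) <= (normc (b - a) + normc (c - a)) / 2,
     normc (b' - a') = normc (b - a) / 2 & normc (c' - a') = normc (c - a) / 2].
have [step stepP] : {step : T -> T & forall x, rel x (step x)}.
  apply: choice => -[[[x y] z] [/= Sx Sy Sz]].
  have [x' [y' [z' [Sx' Sy' Sz' h1 h2]]]] := tri_step _ _ _ Sx Sy Sz.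
  have S' : [/\ S (x', y', z').1.1, S (x', y', z').1.2 & S (x', y', z').2] by [].
  by exists (exist _ (x', y', z') S').
have S0 : [/\ S (a, b, c).1.1, S (a, b, c).1.2 & S (a, b, c).2] by [].
pose u n := iter n step (exist _ (a, b, c) S0).
pose A n := (sval (u n)).1.1; pose B n := (sval (u n)).1.2; pose D n := (sval (u n)).2.
pose l := normc (b - a) + normc (c - a).
have SA n : S (A n) by rewrite /A; case: (svalP (u n)).
have SB n : S (B n) by rewrite /B; case: (svalP (u n)).
have SD n : S (D n) by rewrite /D; case: (svalP (u n)).
have relu n : normc (tri f (A n) (B n) (D n)) <= 4 * normc (tri f (A n.+1) (B n.+1) (D n.+1)) /\
    [/\ normc (A n.+1 - A n) <= (normc (B n - A n) + normc (D n - A n)) / 2,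
     normc (B n.+1 - A n.+1) = normc (B n - A n) / 2 &
     normc (D n.+1 - A n.+1) = normc (D n - A n) / 2].
  have := stepP (u n); rewrite /rel /A /B /D /= -/(u n).
  by case: (sval (u n)) => [[? ?] ?]; case: (sval (step _)) => [[? ?] ?].
have size n : normc (B n - A n) + normc (D n - A n) = l / 2 ^+ n.
  elim: n => [|n IH]; first by rewrite expr0 divr1.
  by have [_ [_ -> ->]] := relu n; rewrite -mulrDl IH exprS invfM mulrCA mulrC mulrA.
have trin n : normc (tri f a b c) <= 4 ^+ n * normc (tri f (A n) (B n) (D n)).
  elim: n => [|n IH]; first by rewrite expr0 mul1r.
  apply: le_trans IH _; rewrite exprSr -mulrA ler_pM2l ?exprn_gt0//.
  by case: (relu n).
have [p hp] : exists p, forall n, normc (A n - p) <= 2 * (l / 2 ^+ n).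
  apply: dyadic_lim => n; have [_ [h _ _]] := relu n; apply: le_trans h _.
  by rewrite size exprS invfM mulrCA mulrC mulrA.
have l0 : 0 <= l by rewrite addr_ge0// normc_ge0.
have small (e : R) : 0 < e -> exists n, 3 * (l / 2 ^+ n) < e.
  move=> e0; have [n hn] := expr2_large (3 * l / e); exists n.
  have p0 : 0 < 2 ^+ n :> R by rewrite exprn_gt0.
  by rewrite mulrA ltr_pdivrMr// -ltr_pdivrMl// mulrC.
have Sp : S p.
  apply: Sclosed => e /small[n hn]; exists (A n) => //.
  apply: le_lt_trans (hp n) (le_lt_trans _ hn).
  by rewrite ler_wpM2r ?divr_ge0 ?exprn_ge0// ler_nat.
have [d [q [qe qd qp]]] := dS p Sp.
(* The constant is 6 = 3 * 2: the sides of the n-th triangle stay within 3 k of [p] and its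
   perimeter is at most 2 k, where k = l / 2 ^ n. The factor 4 ^ n lost in the subdivisions is
   compensated by k ^ 2. *)
suff bnd (e : R) : 0 < e -> normc (tri f a b c) <= e * (6 * l ^+ 2).
  apply/eqP; rewrite -normc_eq0 eq_le normc_ge0 andbT; apply/ler_addgt0Pr => e e0.
  rewrite add0r; have k0 : 0 < 6 * l ^+ 2 + 1 by rewrite ltr_wpDl// mulr_ge0// sqr_ge0.
  apply: le_trans (bnd (e / (6 * l ^+ 2 + 1)) _) _; first by rewrite divr_gt0.
  by rewrite -[X in _ <= X](mulr1 e) -mulrA ler_wpM2l ?(ltW e0)// mulrC ler_pdivrMr// mul1r lerDl.
move=> e0.
have [r r0 hr] : exists2 r : R, 0 < r & forall z, normc (z - p) < r ->
    normc (f z - (f p + d * (z - p))) <= e * normc (z - p).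
  have [r1 r10 h1] := (nbhsCP p _).1 qe; have [r2 r20 h2] := (cvgC_nbhsP q p d).1 qd e e0.
  exists (Num.min r1 r2); first by rewrite lt_min r10.
  move=> z; rewrite lt_min => /andP[/h1 zr1 /h2 zr2].
  have -> : f z - (f p + d * (z - p)) = (q z - d) * (z - p).
    by rewrite mulrBl -zr1; ring.
  by rewrite normcZ ler_wpM2r ?normc_ge0// ltW.
have [n hn] := small r r0.
set k := l / 2 ^+ n in hn.
have k0 : 0 <= k by rewrite divr_ge0// exprn_ge0.
have hA : normc (A n - p) <= 3 * k.
  by apply: le_trans (hp n) _; rewrite ler_wpM2r// ler_nat.
have near1 x : normc (x - A n) <= k -> normc (x - p) <= 3 * k.
  move=> xA; have -> : x - p = (x - A n) + (A n - p) by ring.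
  apply: le_trans (normcD _ _) _; have := hp n; rewrite -/k; lra.
have hB : normc (B n - p) <= 3 * k by apply: near1; rewrite /k -size lerDl normc_ge0.
have hD : normc (D n - p) <= 3 * k by apply: near1; rewrite /k -size lerDr normc_ge0.
(* A primitive of the affine approximation of [f] at [p]; its increments along the three sides
   cancel, so only the approximation error remains. *)
pose P z := f p * z + d / 2 * ((z - p) * (z - p)).
have app x y : S x -> S y -> normc (x - p) <= 3 * k -> normc (y - p) <= 3 * k ->
    normc (seg f x y - (P y - P x)) <= e * (3 * k) * normc (y - x).
  move=> Sx Sy xk yk; apply: (@seg_approx _ f (fun z => f p + d * (z - p))).
  - by move=> s; exact: cpt.
  - by move=> s _; exact: hder_quad.
  - move=> s s01; have zk := pt_dist _ _ _ _ _ s01 xk yk.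
    apply: le_trans (hr _ _) _; first exact: le_lt_trans zk hn.
    by rewrite ler_pM2l.
have AB : normc (B n - A n) <= k by rewrite /k -size lerDl normc_ge0.
have DA : normc (A n - D n) <= k by rewrite normc_dist /k -size lerDr normc_ge0.
have BD : normc (D n - B n) <= k.
  have -> : D n - B n = (D n - A n) - (B n - A n) by ring.
  by apply: le_trans (normcD _ _) _; rewrite normc_opp addrC /k -size.
have tot : normc (tri f (A n) (B n) (D n)) <= e * (3 * k) * (2 * k).
  have -> : tri f (A n) (B n) (D n) = (seg f (A n) (B n) - (P (B n) - P (A n)))
      + (seg f (B n) (D n) - (P (D n) - P (B n)))
      + (seg f (D n) (A n) - (P (A n) - P (D n))) by rewrite /tri; ring.
  apply: le_trans (normcD _ _) _; apply: le_trans (lerD (normcD _ _) (lexx _)) _.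
  have h1 := app _ _ (SA n) (SB n) hA hB.
  have h2 := app _ _ (SB n) (SD n) hB hD.
  have h3 := app _ _ (SD n) (SA n) hD hA.
  apply: le_trans (lerD (lerD h1 h2) h3) _; rewrite -!mulrDr ler_wpM2l//.
    by rewrite mulr_ge0 ?mulr_ge0// ltW.
  have := size n; rewrite -/k (normc_dist (D n)); move: BD; lra.
apply: le_trans (trin n) _.
apply: le_trans (ler_wpM2l (exprn_ge0 n (ler0n _ 4)) tot) _.
have -> : 6 * l ^+ 2 = 4 ^+ n * (6 * k ^+ 2).
  have -> : 4 = 2 ^+ 2 :> R by rewrite -natrX.
  by rewrite /k -exprM mulnC exprM; field; rewrite expf_neq0// pnatr_eq0.
by rewrite le_eqVlt; apply/orP; left; apply/eqP; ring.
Qed.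

End Triangle.
End Goursat.

(** * Primitives on discs with one exceptional point *)

Section Primitive.
Context {R : realType}.
Local Notation C := (Cx R).
Implicit Types (f F : C -> C) (a b c w z : C) (s t M : R).

Lemma pt_dist_lt a b z s M : 0 <= s <= 1 -> normc (a - z) < M ->
  normc (b - z) < M -> normc (pt a b s - z) < M.
Proof.
move=> s01 aM bM.
have [x xM [ax bx]] : exists2 x, x < M & normc (a - z) <= x /\ normc (b - z) <= x.
  by have [h|/ltW h] := leP (normc (a - z)) (normc (b - z)); [exists (normc (b - z))|exists (normc (a - z))].
exact: le_lt_trans (pt_dist _ _ _ _ _ s01 ax bx) xM.
Qed.

Lemma hder_cst a z : hder (fun=> a) z 0.
Proof. exact: cderiv_cst. Qed.
Lemma hder_id z : hder id z 1.
Proof. by apply: cderiv_id; move=> ?. Qed.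
Lemma hderZ a f z d : hder f z d -> hder (fun z => a * f z) z (a * d).
Proof. by apply: cderivZ; move=> ?. Qed.
Lemma hderM f g z d e : hder f z d -> hder g z e ->
  hder (fun z => f z * g z) z (d * g z + f z * e).
Proof. by apply: cderivM; move=> ?. Qed.
Lemma hderB f g z d e : hder f z d -> hder g z e ->
  hder (fun z => f z - g z) z (d - e).
Proof. by apply: cderivB; move=> ?. Qed.

Lemma hder_lin a c z : hder (fun w => a * (w - c)) z a.
Proof.
rewrite -[X in hder _ _ X]mulr1 -[1 in X in hder _ _ X]subr0; apply: hderZ.
by apply: hderB; [exact: hder_id|exact: hder_cst].
Qed.

(** The integral from [z] to y is compared with the increment of the primitive of the constant
    [f z]; by continuity the error is at most e / 2 times |y - z|. *)
Lemma hder_of_seg f F z (d : R) : 0 < d ->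
  (forall z', normc (z' - z) < d -> contat f z' /\ F z' - F z = seg f z z') ->
  hder F z (f z).
Proof.
move=> d0 h; pose q z' := if z' == z then f z else (F z' - F z) / (z' - z).
exists q; split; last by rewrite /q eqxx.
  apply: (@nearW _ (nbhs z)) => y; rewrite /q; case: eqVneq => [->|yz].
    by rewrite !subrr mulr0.
  by rewrite divfK// subr_eq0.
apply/cvgC_nbhsP => e e0.
have cz : contat f z by have [] := h z; rewrite ?subrr ?normc_zero.
have e20 : 0 < e / 2 by rewrite divr_gt0.
have [r r0 hr] := (cvgC_nbhsP f z (f z)).1 cz _ e20.
exists (Num.min d r); first by rewrite lt_min d0.
move=> y; rewrite lt_min => /andP[yd yr]; rewrite /q; case: eqVneq => [_|yz].
  by rewrite subrr normc_zero.
have yz0 : 0 < normc (y - z) by rewrite normc_gt0 subr_eq0.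
have zz m : 0 < m -> normc (z - z) < m by rewrite subrr normc_zero.
have close s : 0 <= s <= 1 -> normc (pt z y s - z) < d /\ normc (pt z y s - z) < r.
  by move=> s01; split; apply: pt_dist_lt => //; exact: zz.
have B : normc (seg f z y - (f z * (y - z) - f z * (z - z))) <= e / 2 * normc (y - z).
  apply: (@seg_approx _ f (fun=> f z) (fun w => f z * (w - z))) => s s01.
  - by have [/h[]] := close s s01.
  - exact: hder_lin.
  - by have [_ /hr/ltW] := close s s01.
have [_ ->] := h y yd.
have -> : seg f z y / (y - z) - f z = (seg f z y - (f z * (y - z) - f z * (z - z))) / (y - z).
  by field; rewrite subr_eq0.
rewrite normcZ normcI ltr_pdivrMr//; apply: le_lt_trans B _.
by rewrite ltr_pM2r// ltr_pdivrMr// mulr_natr mulr2n ltrDl.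
Qed.

(** The primitive is integrated from the exceptional point [w] itself, so the triangles to be closed
    have [w] as a vertex. A homothety of centre [w] and ratio s cuts such a triangle into a
    quadrilateral avoiding [w], where Goursat's lemma applies, and a small triangle whose integral
    is O(s) because [f] is bounded near [w]. *)
Lemma disc_prim z0 (rho : R) w f : normc (w - z0) < rho ->
  (forall z, normc (z - z0) < rho -> contat f z) ->
  (forall z, normc (z - z0) < rho -> z != w -> exists d, hder f z d) ->
  exists F, forall z, normc (z - z0) < rho -> hder F z (f z).
Proof.
move=> w0 cf df; exists (seg f w) => z z0r.
pose d1 := rho - normc (z - z0).
have d10 : 0 < d1 by rewrite subr_gt0.
have inD (d : R) z' : d <= d1 -> normc (z' - z) < d -> normc (z' - z0) < rho.
  move=> dd h; have -> : z' - z0 = (z' - z) + (z - z0) by ring.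
  by apply: le_lt_trans (normcD _ _) _; move: h dd; rewrite /d1; lra.
have [zw|zw] := eqVneq z w.
  apply: (@hder_of_seg _ _ _ d1) => // z' z'd; split; first by apply: cf; exact: inD z'd.
  by rewrite zw /seg subrr mul0r subr0.
have zw0 : 0 < normc (z - w) by rewrite normc_gt0 subr_eq0.
(* The half distance to [w] keeps z' on the same side of [w] as [z]: the linear form [lam] below
   stays at least |z - w| ^ 2 / 2 at z'. *)
pose d := Num.min d1 (normc (z - w) / 2).
have d0 : 0 < d by rewrite lt_min d10 divr_gt0.
apply: (@hder_of_seg _ _ _ d) => // z' z'd.
have z'0r : normc (z' - z0) < rho by apply: inD z'd; rewrite ge_min lexx.
split; first exact: cf.
have z'w : normc (z' - z) < normc (z - w) / 2.
  by apply: lt_le_trans z'd _; rewrite ge_min lexx orbT.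
have cseg a b : normc (a - z0) < rho -> normc (b - z0) < rho ->
    forall s, 0 <= s <= 1 -> contat f (pt a b s).
  by move=> ha hb s s01; apply: cf; exact: pt_dist_lt.
(* The closed disc of radius [m] contains the three vertices and lies inside the open disc, which
   gives the closed convex sets that Goursat's lemma requires. *)
pose m := Num.max (normc (w - z0)) (Num.max (normc (z - z0)) (normc (z' - z0))).
have mr : m < rho by rewrite !gt_max w0 z0r z'0r.
(* The real scalar product of x - w with z - w. It vanishes at [w], so a half-plane [k <= lam x]
   with k > 0 excludes the exceptional point. *)
pose lam x := Re ((((z - w)^*)%C : C) * (x - w)).
have lamz : lam z = normc (z - w) ^+ 2.
  by rewrite /lam mulrC mulC_conj.
have lam_pt a b s : lam (pt a b s) = (1 - s) * lam a + s * lam b.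
  rewrite /lam /pt.
  have -> : (((z - w)^*)%C : C) * (a + s%:C * (b - a) - w) =
    (1 - s)%:C * ((((z - w)^*)%C : C) * (a - w)) + s%:C * ((((z - w)^*)%C : C) * (b - w)).
    have -> : (1 - s)%:C = 1 - s%:C :> C by rewrite rmorphB /= rmorph1.
    by ring.
  by rewrite ReD !ReM /=; ring.
have lamw : lam w = 0 by rewrite /lam subrr mulr0.
have lam_lip x y : lam x - lam y <= normc (z - w) * normc (x - y).
  rewrite /lam -ReB -mulrBr.
  have -> : x - w - (y - w) = x - y by ring.
  apply: le_trans (ler_norm _) _; apply: le_trans (normc_Re _) _.
  by rewrite normcZ normc_conj.
have lamz' : normc (z - w) ^+ 2 / 2 <= lam z'.
  have := lam_lip z z'; rewrite lamz (normc_dist z z') => h.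
  have : normc (z - w) * normc (z' - z) <= normc (z - w) * (normc (z - w) / 2).
    by rewrite ler_pM2l// ltW.
  by move: h; rewrite expr2; lra.
pose S (k : R) := [set x : C | normc (x - z0) <= m /\ k <= lam x].
have Sconv k : conv (S k).
  move=> a b [a1 a2] [b1 b2] s s01; split; first exact: pt_dist.
  by rewrite lam_pt; case/andP: s01 => ? ?; nra.
have Sin k x : S k x -> normc (x - z0) < rho by move=> [h _]; exact: le_lt_trans h mr.
have Sclosed k y : (forall e : R, 0 < e -> exists2 x, S k x & normc (x - y) < e) -> S k y.
  move=> h; split.
    apply/ler_addgt0Pr => e e0; have [x [xm _] xy] := h e e0.
    have -> : y - z0 = (y - x) + (x - z0) by ring.
    apply: le_trans (normcD _ _) _.
    by move: xm xy; rewrite (normc_dist x y); lra.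
  apply/ler_addgt0Pr => e e0.
  have e1 : 0 < e / normc (z - w) by rewrite divr_gt0.
  have [x [_ xk] xy] := h _ e1.
  have : normc (z - w) * normc (x - y) <= e.
    by rewrite mulrC -ler_pdivlMr// ltW.
  by have := lam_lip x y; move: xk; lra.
(* The quadrilateral with vertices z, z' and their images under the homothety is cut by a diagonal
   into two triangles, both inside the half-plane of level [k]. *)
have quad s : 0 < s <= 1 ->
    seg f w z + seg f z z' - seg f w z' =
    seg f w (pt w z s) - seg f w (pt w z' s) + seg f (pt w z s) (pt w z' s).
  move=> /andP[s0 s1]; have s01 : 0 <= s <= 1 by rewrite (ltW s0).
  pose k := s * (normc (z - w) ^+ 2 / 2).
  have l0 : 0 < normc (z - w) ^+ 2 / 2 by rewrite divr_gt0// exprn_gt0.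
  have k0 : 0 < k by rewrite mulr_gt0.
  have kl : k <= normc (z - w) ^+ 2 / 2 by rewrite ler_piMl// ltW.
  have mw : normc (w - z0) <= m by rewrite le_max lexx.
  have mz : normc (z - z0) <= m by rewrite !le_max lexx !orbT.
  have mz' : normc (z' - z0) <= m by rewrite !le_max lexx !orbT.
  have Sz : S k z by split=> //; rewrite lamz; lra.
  have Sz' : S k z' by split=> //; exact: le_trans kl lamz'.
  have Szs : S k (pt w z s).
    by split; [exact: pt_dist|rewrite lam_pt lamw lamz mulr0 add0r /k ler_pM2l//; lra].
  have Szs' : S k (pt w z' s).
    by split; [exact: pt_dist|rewrite lam_pt lamw mulr0 add0r /k ler_pM2l].
  have cS x : S k x -> contat f x by move=> /Sin; exact: cf.
  have dS x : S k x -> exists e, hder f x e.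
    move=> xS; apply: df; first exact: Sin xS.
    by apply/eqP => xw; case: xS => _; rewrite xw lamw; lra.
  have G := goursat (Sconv k) cS (Sclosed k) dS.
  have T1 := G _ _ _ Szs Sz Sz'; have T2 := G _ _ _ Szs Sz' Szs'.
  have cS2 a b : S k a -> S k b -> forall t, 0 <= t <= 1 -> contat f (pt a b t).
    by move=> /Sin ha /Sin hb; exact: cseg.
  rewrite /tri in T1 T2.
  have R1 := seg_rev f _ _ (cS2 _ _ Szs Sz').
  have R2 := seg_rev f _ _ (cS2 _ _ Szs Szs').
  have R3 := seg_rev f _ _ (cS2 _ _ Szs' Sz').
  have spl x : normc (x - z0) < rho -> seg f w x = seg f w (pt w x s) + seg f (pt w x s) x.
    move=> xr; have [H hH] := seg_sub f w x (cseg _ _ w0 xr).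
    have := hH 0 1; rewrite pt0 pt1 => ->; rewrite ?lexx ?ler01//.
    have := hH 0 s; rewrite pt0 => ->; rewrite ?lexx ?ler01//.
    have := hH s 1; rewrite pt1 => ->; rewrite ?lexx ?ler01//.
    by ring.
  rewrite (spl z)// (spl z')//.
  move: T1 T2; rewrite R1 R2 R3 => T1 T2.
  apply/eqP; rewrite -subr_eq0; apply/eqP.
  by have T := congr2 +%R T1 T2; rewrite addr0 in T; rewrite -[RHS]T; ring.
have [M [eta eta0 hM]] : exists M, exists2 eta : R, 0 < eta & forall x, normc (x - w) < eta -> normc (f x) <= M.
  have [eta eta0 h] := (cvgC_nbhsP f w (f w)).1 (cf w w0) 1 ltr01.
  exists (normc (f w) + 1), eta => // x /h/ltW xx.
  by rewrite -lerBlDl; apply: le_trans (normcB _ _) xx.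
have M0 : 0 <= M by apply: le_trans (normc_ge0 (f w)) (hM w _); rewrite subrr normc_zero.
pose L := normc (z - w) + normc (z' - w) + normc (z' - z).
have L0 : 0 <= L by rewrite !addr_ge0// normc_ge0.
have bnd (e : R) : 0 < e -> normc (seg f w z + seg f z z' - seg f w z') <= e.
  move=> e0.
  have [s s01 [sz sz' se]] : exists2 s, 0 < s <= 1 & [/\ s * normc (z - w) < eta, s * normc (z' - w) < eta & M * (s * L) <= e].
    (* With s = 1 / D the three smallness requirements on s hold at once, and s <= 1. *)
    pose D := 1 + L + L / eta + M * L / e.
    have D1 : 1 <= D.
      have h1 : 0 <= L / eta by rewrite divr_ge0// ltW.
      have h2 : 0 <= M * L / e by rewrite divr_ge0 ?mulr_ge0// ltW.
      by rewrite /D; move: L0 h1 h2; lra.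
    have D0 : 0 < D by apply: lt_le_trans D1.
    have Le : L / eta <= D - 1.
      rewrite /D; have : 0 <= M * L / e by rewrite divr_ge0 ?mulr_ge0// ltW.
      by move: L0; lra.
    have MLe : M * L / e <= D - 1.
      rewrite /D; have : 0 <= L / eta by rewrite divr_ge0// ltW.
      by move: L0; lra.
    have se x : x <= L -> D^-1 * x < eta.
      move=> xL; rewrite mulrC ltr_pdivrMr//.
      rewrite ler_pdivrMr// in Le; apply: le_lt_trans xL _; apply: le_lt_trans Le _.
      by rewrite mulrC ltr_pM2l// gtrDl ltrN10.
    exists D^-1; first by rewrite invr_gt0 D0 invf_le1.
    split.
    - by apply: se; rewrite /L -addrA lerDl addr_ge0// normc_ge0.
    - by apply: se; rewrite /L addrAC lerDr addr_ge0// normc_ge0.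
    - rewrite mulrCA mulrC ler_pdivrMr//; rewrite ler_pdivrMr// in MLe.
      by apply: le_trans MLe _; rewrite mulrC ler_pM2l// gerDl lerN10.
  have [s0 s1] := andP s01; have s01' : 0 <= s <= 1 by rewrite (ltW s0).
  rewrite (quad s s01).
  have ptw x : pt w x s - w = s%:C * (x - w) by rewrite /pt; ring.
  have nptw x : normc (pt w x s - w) = s * normc (x - w).
    by rewrite ptw normcZ normc_real gtr0_norm.
  have ww : normc (w - w) < eta by rewrite subrr normc_zero.
  have ps : normc (pt w z s - w) < eta by rewrite nptw.
  have ps' : normc (pt w z' s - w) < eta by rewrite nptw.
  have inr a b : normc (a - z0) < rho -> normc (b - z0) < rho ->
     normc (a - w) < eta -> normc (b - w) < eta ->
     normc (seg f a b) <= M * normc (b - a).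
    move=> ha hb ea eb; apply: seg_bound; first exact: cseg.
    by move=> t t01; apply: hM; exact: pt_dist_lt.
  have zs0 : normc (pt w z s - z0) < rho by exact: pt_dist_lt.
  have zs0' : normc (pt w z' s - z0) < rho by exact: pt_dist_lt.
  apply: le_trans (normcD _ _) _; apply: le_trans (lerD (normcD _ _) (lexx _)) _.
  rewrite normc_opp.
  apply: le_trans (lerD (lerD (inr _ _ w0 zs0 ww ps) (inr _ _ w0 zs0' ww ps')) (inr _ _ zs0 zs0' ps ps')) _.
  rewrite !nptw; have -> : pt w z' s - pt w z s = s%:C * (z' - z) by rewrite /pt; ring.
  rewrite normcZ normc_real gtr0_norm// -!mulrDr -/L; exact: se.
have : seg f w z + seg f z z' - seg f w z' = 0.
  apply/eqP; rewrite -normc_eq0 eq_le normc_ge0 andbT; apply/ler_addgt0Pr => e e0.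
  by rewrite add0r; exact: bnd.
move=> E; apply/eqP; rewrite -subr_eq0 -[X in _ == X]oppr0 -E; apply/eqP; ring.
Qed.

End Primitive.

(** * Cauchy's formula *)

Section Circle.
Context {R : realType}.
Local Notation C := (Cx R).
Implicit Types (f F : C -> C) (g G phi gam : R -> C) (a b c w z : C) (s t r M : R).

Lemma Re_conj z : Re ((z^*)%C : C) = Re z.
Proof.
have zE : z = Complex (Re z) (Im z) by exact: Cx_eq.
by rewrite [in LHS]zE.
Qed.
Lemma Im_conj z : Im ((z^*)%C : C) = - Im z.
Proof.
have zE : z = Complex (Re z) (Im z) by exact: Cx_eq.
by rewrite [in LHS]zE.
Qed.
Lemma conjCB z w : ((z - w)^*)%C = ((z^*)%C : C) - (w^*)%C.
Proof. exact: rmorphB. Qed.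
Lemma conjCM z w : ((z * w)^*)%C = ((z^*)%C : C) * (w^*)%C.
Proof. exact: rmorphM. Qed.
Lemma conjCV z : ((z^-1)^*)%C = ((z^*)%C : C)^-1.
Proof. exact: fmorphV. Qed.

Lemma rder_scale G (c : R) s d : rder G (c * s) d ->
  rder (fun t => G (c * t)) s (c%:C * d).
Proof.
move=> [k [ke kd kx]].
have cv : (fun t => c * t) @ s --> c * s.
  by apply: (@cvgM _ _ (nbhs s)); [exact: cvg_cst|by move=> ?].
exists (fun t => c%:C * k (c * t)); split.
- have : \forall t \near s, G (c * t) - G (c * s) = k (c * t) * ((c * t)%:C - (c * s)%:C).
    exact: cv _ ke.
  by apply: filterS => t ->; rewrite !rmorphM /=; ring.
- apply: (@cvgM _ _ (nbhs s)); first exact: cvg_cst.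
  exact: (@cvg_comp _ _ _ (fun t => c * t) k (nbhs s) (nbhs (c * s)) _ cv kd).
- by rewrite kx.
Qed.

Definition cis t : C := Complex (cos t) (sin t).
Definition circ z r s : C := z + r%:C * cis (2 * pi * s).

Lemma normc_cis t : normc (cis t) = 1.
Proof. by rewrite /= cos2Dsin2 sqrtr1. Qed.

Lemma rder_cis t : rder cis t (Complex 0 1 * cis t).
Proof.
have -> : Complex 0 1 * cis t = Complex (- sin t) (cos t) :> C.
  by apply: Cx_eq; rewrite ?ReM ?ImM /=; ring.
exact: rder_ReIm.
Qed.

Lemma rder_circ z r s :
  rder (circ z r) s ((2 * pi)%:C * Complex 0 1 * (circ z r s - z)).
Proof.
have h : rder (fun t => r%:C * cis (2 * pi * t)) s
    (r%:C * ((2 * pi)%:C * (Complex 0 1 * cis (2 * pi * s)))).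
  by apply: cderivZ; [exact: real_cvg|apply: rder_scale; exact: rder_cis].
have -> : (2 * pi)%:C * Complex 0 1 * (circ z r s - z) =
    0 + (r%:C * ((2 * pi)%:C * (Complex 0 1 * cis (2 * pi * s)))).
  by rewrite /circ; ring.
by apply: cderivD => //; exact: cderiv_cst.
Qed.

Lemma circ_cvg z r s : {for s, continuous (circ z r)}.
Proof. by apply: cderiv_cvg (rder_circ z r s); exact: real_cvg. Qed.

Lemma circ01 z r : circ z r 1 = circ z r 0.
Proof.
by rewrite /circ /cis mulr1 mulr0 mulr_natl cos2pi sin2pi cos0 sin0.
Qed.

Lemma normc_circ z r s : 0 <= r -> normc (circ z r s - z) = r.
Proof.
by move=> r0; rewrite /circ addrC addKr normcZ normc_real normc_cis mulr1 ger0_norm.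
Qed.

Lemma cont01_comp f gam : cont01 gam ->
  (forall s, 0 <= s <= 1 -> contat f (gam s)) -> cont01 (fun s => f (gam s)).
Proof.
move=> cg cf s s01.
exact: (@cvg_comp _ _ _ gam f (nbhs s) (nbhs (gam s)) _ (cg s s01) (cf s s01)).
Qed.

(** The weight [circ z r s - z] is the velocity of the circle divided by 2 pi i, so this is a
    contour integral up to that factor; it vanishes since the circle closes up. *)
Lemma cint_circ_deriv f F z r :
  (forall s, 0 <= s <= 1 -> hder F (circ z r s) (f (circ z r s))) ->
  cint (fun s => f (circ z r s) * (circ z r s - z)) = 0.
Proof.
move=> hF; pose k : C := (2 * pi)%:C * Complex 0 1.
have k0 : k != 0.
  rewrite -normc_eq0 normcZ normc_real /= expr0n expr1n add0r sqrtr1 mulr1.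
  by rewrite normr_eq0 mulf_neq0 ?pnatr_eq0// gt_eqF// pi_gt0.
rewrite (prim_cint _ (fun s => k^-1 * F (circ z r s))); first by rewrite circ01 subrr.
move=> s s01.
have -> : f (circ z r s) * (circ z r s - z) = k^-1 * (f (circ z r s) * (k * (circ z r s - z))).
  by field.
apply: cderivZ; first exact: real_cvg.
by apply: cderiv_comp (hF s s01) (rder_circ z r s); exact: real_cvg.
Qed.

Lemma cint_conj g : cont01 g -> cint (fun s => (g s)^*%C : C) = ((cint g)^*%C : C).
Proof.
move=> /cont01_prim[G gG ->].
rewrite (prim_cint _ (fun s => (G s)^*%C : C)); first by rewrite conjCB.
move=> s /gG[q [qe qd qx]]; exists (fun t => (q t)^*%C); split; last by rewrite qx.
  apply: filterS qe => t; rewrite -conjCB => ->.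
  by apply: Cx_eq; rewrite !(Re_conj, Im_conj, ReM, ImM, ReB, ImB, ReM, ImM, Re_conj, Im_conj) /=; ring.
have cr := cvgC_Re _ _ qd; have ci := cvgC_Im _ _ qd.
have -> : ((g s)^*)%C = (Complex (Re (g s)) (- Im (g s)) : C).
  by apply: Cx_eq; rewrite (Re_conj, Im_conj).
have -> : (fun t => ((q t)^*)%C) = (fun t => Complex (Re (q t)) (- Im (q t)) : C).
  by apply/funext => t; apply: Cx_eq; rewrite (Re_conj, Im_conj).
by apply: cvgC_ReIm; [exact: cr|apply: cvgN; exact: ci].
Qed.

Definition cdifferentiable f z := exists d, hder f z d.

Lemma hderV f z d : f z != 0 -> hder f z d -> cdifferentiable (fun z => (f z)^-1) z.
Proof.
move=> f0 hd; have cf := hder_contat _ _ _ hd; move: hd => [q [qe qd qx]].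
(* The middle branch covers points where f y = 0 and the inverse has its default value; there the
   plain difference quotient keeps the identity true. By continuity of [f] this branch does not
   occur near [z]. *)
exists (- d / (f z * f z)), (fun y => if y == z then - d / (f z * f z) else if f y == 0 then ((f y)^-1 - (f z)^-1) / (y - z) else - q y / (f y * f z)); split.
- apply: (@filterS _ (nbhs z) _ _ _ _ qe) => y e; case: eqVneq => [->|yz].
    by rewrite !subrr mulr0.
  case: eqVneq => [fy|fy]; first by rewrite divfK// subr_eq0.
  have -> : - q y / (f y * f z) * (y - z) = - (f y - f z) / (f y * f z) by rewrite e; ring.
  by field; rewrite ?f0 ?fy.
- have h : (fun y => - q y / (f y * f z)) @ nbhs z --> - d / (f z * f z).
    apply: (@cvgM _ _ (nbhs z)); first exact: (@cvgN _ _ _ (nbhs z)).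
    apply: (@cvgV _ _ (nbhs z)); first by rewrite mulf_neq0.
    by apply: (@cvgM _ _ (nbhs z)); [exact: cf|exact: cvg_cst].
  apply: cvg_trans h; apply: near_eq_cvg.
  have fn0 : 0 < normc (f z) by rewrite normc_gt0.
  have [e e0 he] := (cvgC_nbhsP f z (f z)).1 cf _ fn0.
  apply/nbhsCP; exists e => // y /he h; case: eqVneq => [->|yz]; first by rewrite qx.
  case: eqVneq => // fy; move: h; rewrite fy sub0r normc_opp ltxx.
  by [].
- by rewrite eqxx.
Qed.

Lemma cdiff_contat f z : cdifferentiable f z -> contat f z.
Proof. by move=> [d]; exact: hder_contat. Qed.

(** With zeta = circ z r s - z, the integrand is 1 + a / (zeta - a), and the mean of 1 / (zeta - a)
    vanishes: on the circle its conjugate equals zeta / (r ^ 2 - conj(a) zeta), because zeta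
    conj(zeta) = r ^ 2, and 1 / (r ^ 2 - conj(a) zeta) is holomorphic on a larger disc. *)
Lemma cint_cauchy_kernel z r w : normc (w - z) < r ->
  cint (fun s => (circ z r s - z) / (circ z r s - w)) = 1.
Proof.
move=> wr; have r0 : 0 < r by apply: le_lt_trans wr; exact: normc_ge0.
pose a := w - z; pose zeta s := circ z r s - z.
have nz s : normc (zeta s) = r by rewrite /zeta normc_circ// ltW.
have cz : cont01 zeta.
  move=> s _; apply: (@cvgB _ _ _ (nbhs s)); [exact: circ_cvg|exact: cvg_cst].
have za s : zeta s - a != 0.
  rewrite -normc_gt0; apply: lt_le_trans (normcB _ _).
  by rewrite nz subr_gt0.
pose h x : C := ((r ^+ 2)%:C - (a^*%C : C) * (x - z))^-1.
(* The harmonic mean of r and r ^ 2 / |a|: it lies strictly between the radius of the circle and the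
   modulus of the reflected pole, and still makes sense for a = 0. *)
pose rho := 2 * r ^+ 2 / (normc a + r).
have ar0 : 0 < normc a + r by rewrite ltr_wpDl// normc_ge0.
have rrho : r < rho.
  have : r * normc a < r * r by rewrite ltr_pM2l.
  by rewrite /rho ltr_pdivlMr// expr2; lra.
have arho : normc a * rho < r ^+ 2.
  rewrite /rho mulrA ltr_pdivrMr// mulrC -mulrA [in X in X < _]mulrC -mulrA.
  rewrite ltr_pM2l ?exprn_gt0// mulr_natr mulr2n ltrD2l.
  exact: wr.
have hd x : normc (x - z) < rho -> (r ^+ 2)%:C - (a^*%C : C) * (x - z) != 0.
  move=> xr; rewrite -normc_gt0; apply: lt_le_trans (normcB _ _).
  rewrite normcZ normc_conj normc_real ger0_norm ?exprn_ge0 ?ltW// subr_gt0.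
  by apply: le_lt_trans arho; rewrite ler_wpM2l ?normc_ge0// ltW.
have hdiff x : normc (x - z) < rho -> cdifferentiable h x.
  move=> xr; apply: hderV; first exact: hd.
  by apply: hderB; [exact: hder_cst|exact: hder_lin].
have [F hF] : exists F, forall x, normc (x - z) < rho -> hder F x (h x).
  apply: (@disc_prim _ z rho z).
  - by rewrite subrr normc_zero (lt_trans r0).
  - by move=> x /hdiff; exact: cdiff_contat.
  - by move=> x xr _; exact: hdiff.
have c0 : cint (fun s => h (circ z r s) * zeta s) = 0.
  apply: cint_circ_deriv => s _; apply: hF; rewrite -/(zeta s) nz; exact: rrho.
have chz : cont01 (fun s => h (circ z r s) * zeta s).
  apply: cont01M; last exact: cz.
  apply: cont01_comp => s _; first exact: circ_cvg.
  by apply/cdiff_contat/hdiff; rewrite -/(zeta s) nz; exact: rrho.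
have cinv : cont01 (fun s => (zeta s - a)^-1).
  apply: cont01V => [|s _]; last exact: za.
  by apply: cont01B; [exact: cz|exact: cont01_cst].
have inv0 : cint (fun s => (zeta s - a)^-1) = 0.
  have -> : 0 = ((0 : C)^*%C : C) by apply: Cx_eq => /=; rewrite ?oppr0.
  rewrite -c0 -cint_conj; last exact: chz.
  apply: eq_cint => s _; rewrite /h -/(zeta s).
  rewrite conjCM conjCV conjCB conjCM conjcK.
  have rr : (r ^+ 2)%:C = zeta s * (zeta s)^*%C :> C by rewrite mulC_conj nz.
  have -> : ((r ^+ 2)%:C^*)%C = (r ^+ 2)%:C :> C by exact: conjc_real.
  rewrite rr -mulrBl.
  have cz0 : (zeta s)^*%C != 0 :> C by rewrite -normc_eq0 normc_conj nz gt_eqF.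
  by rewrite invfM divfK.
have -> : cint (fun s => zeta s / (circ z r s - w)) = cint (fun s => 1 + a * (zeta s - a)^-1).
  apply: eq_cint => s _.
  have -> : circ z r s - w = zeta s - a by rewrite /zeta /a; ring.
  by field; exact: za.
rewrite cintD; [|exact: cont01_cst|exact: cont01Z].
by rewrite cint_cst cintZ; [rewrite inv0|exact: cinv]; rewrite ?mulr0 ?addr0.
Qed.

(** The parametrization by [0, 1] absorbs the usual factor 2 pi i into the weight
    [circ z r s - z]. *)
Lemma cauchy_formula f z rho r w : 0 < r < rho -> normc (w - z) < r ->
  (forall x, normc (x - z) < rho -> cdifferentiable f x) ->
  f w = cint (fun s => f (circ z r s) * (circ z r s - z) / (circ z r s - w)).
Proof.
move=> /andP[r0 rrho] wr df.
have wrho : normc (w - z) < rho by exact: lt_trans rrho.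
have [d hd] := df w wrho.
have [q [qe qd qw]] := hd.
pose K x := if x == w then d else (f x - f w) / (x - w).
have cr s : normc (circ z r s - z) < rho by rewrite normc_circ ?ltW.
have nw s : circ z r s - w != 0.
  have -> : circ z r s - w = (circ z r s - z) - (w - z) by ring.
  rewrite -normc_gt0; apply: lt_le_trans (normcB _ _).
  by rewrite normc_circ ?ltW// subr_gt0.
have Koff x : x != w -> normc (x - z) < rho -> cdifferentiable K x.
  move=> xw xr; have [e he] := df x xr.
  have [k hk] : cdifferentiable (fun x => (x - w)^-1) x.
    apply: (@hderV (fun x => x - w) _ (1 - 0)); first by rewrite subr_eq0.
    by apply: hderB; [exact: hder_id|exact: hder_cst].
  have := hderM _ _ _ _ _ (hderB _ _ _ _ _ he (hder_cst (f w) x)) hk.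
  set D := (X in hder _ _ X -> _) => hD; exists D; apply: cderiv_near_eq hD.
    have xw0 : 0 < normc (x - w) by rewrite normc_gt0 subr_eq0.
    apply/nbhsCP; exists (normc (x - w)) => // y yx; rewrite /K.
    by case: eqVneq => // yw; move: yx; rewrite yw normc_dist ltxx.
  by rewrite /K (negbTE xw).
have Kw : contat K w.
  (* Near [w] the quotient [K] coincides with the Carathéodory slope of [f], whose continuity at [w]
     is differentiability itself. *)
  rewrite /contat {2}/K eqxx; apply: cvg_trans qd; apply: near_eq_cvg.
  apply: (@filterS _ (nbhs w) _ _ _ _ qe) => x e.
  rewrite /K; case: eqVneq => [->|xw]; first by rewrite qw.
  by rewrite e mulfK// subr_eq0.
have [F hF] : exists F, forall x, normc (x - z) < rho -> hder F x (K x).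
  apply: (@disc_prim _ z rho w); first exact: wrho.
    move=> x xr; have [->|xw] := eqVneq x w; first exact: Kw.
    by apply/cdiff_contat/Koff.
  by move=> x xr xw; exact: Koff.
have c0 : cint (fun s => K (circ z r s) * (circ z r s - z)) = 0.
  by apply: cint_circ_deriv => s _; apply: hF; exact: cr.
have cc : cont01 (circ z r) by move=> s _; exact: circ_cvg.
have ck : cont01 (fun s => (circ z r s - z) / (circ z r s - w)).
  apply: cont01M; first by apply: cont01B; [exact: cc|exact: cont01_cst].
  apply: cont01V => [|s _]; last exact: nw.
  by apply: cont01B; [exact: cc|exact: cont01_cst].
have cfc : cont01 (fun s => f (circ z r s)).
  by apply: cont01_comp => [|s _]; [exact: cc|apply/cdiff_contat/df; exact: cr].
have : cint (fun s => f (circ z r s) * ((circ z r s - z) / (circ z r s - w)) - f w * ((circ z r s - z) / (circ z r s - w))) = 0.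
  rewrite -c0; apply: eq_cint => s _; rewrite /K -subr_eq0 (negbTE (nw s)).
  by field; exact: nw.
rewrite cintB; [|by apply: cont01M; [exact: cfc|exact: ck]|by apply: cont01Z; exact: ck].
rewrite cintZ; last exact: ck.
rewrite cint_cauchy_kernel; last exact: wr.
rewrite mulr1 => /eqP; rewrite subr_eq0 => /eqP <-.
by apply: eq_cint => s _; rewrite mulrA.
Qed.

End Circle.

(** * Consequences of Cauchy's formula: derivatives and removable singularities *)

Section Taylor.
Context {R : realType}.
Local Notation C := (Cx R).
Implicit Types (f F : C -> C) (g G phi gam : R -> C) (a b c w z : C) (s t r M : R).

Lemma hder_unique f z d e : hder f z d -> hder f z e -> d = e.
Proof.
move=> [q [qe qd _]] [p [pe pd _]].
have h1 := slope_is_derive f q z d qe qd.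
have h2 := slope_is_derive f p z e pe pd.
by rewrite -(@derive_val _ _ _ _ _ _ _ h1) (@derive_val _ _ _ _ _ _ _ h2).
Qed.

Lemma hder_near f (g : C -> C) z d : (\forall y \near nbhs z, f y = g y) -> hder f z d -> hder g z d.
Proof.
move=> fg; apply: cderiv_near_eq; first exact: fg.
exact: (nbhs_singleton fg).
Qed.

Lemma cont01_bounded g : cont01 g -> exists2 M, 0 < M & forall s, 0 <= s <= 1 -> normc (g s) <= M.
Proof.
move=> cg; have ch : {within `[0, 1], continuous (fun s => normc (g s))}.
  apply: continuous_in_subspaceT => s; rewrite inE/= in_itv/= => s01.
  by apply: cvgC_normc; exact: cg.
have [c _ hc] := EVT_max ler01 ch.
exists (normc (g c) + 1); first by rewrite ltr_wpDl// normc_ge0.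
move=> s s01; have := hc s; rewrite in_itv/= => /(_ s01) h.
by apply: le_trans h _; rewrite lerDl.
Qed.

(** Differentiation under the integral sign without a convergence theorem: [Q] is an exact
    difference quotient in the parameter, with a Lipschitz bound at w0 uniform in s. *)
Lemma hder_cint (T Q : C -> R -> C) w0 (d0 L : R) : 0 < d0 ->
  (forall w, normc (w - w0) < d0 -> cont01 (T w) /\ cont01 (Q w)) ->
  (forall w, normc (w - w0) < d0 -> forall s, 0 <= s <= 1 ->
     T w s - T w0 s = Q w s * (w - w0) /\
     normc (Q w s - Q w0 s) <= L * normc (w - w0)) ->
  hder (fun w => cint (T w)) w0 (cint (Q w0)).
Proof.
move=> d0p cTQ hTQ; have w00 : normc (w0 - w0) < d0 by rewrite subrr normc_zero.
have [cT0 cQ0] := cTQ _ w00.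
exists (fun w => cint (Q w)); split; last by [].
- apply/nbhsCP; exists d0 => // w wd; have [cT cQ] := cTQ _ wd.
  rewrite -cintB; [|exact: cT|exact: cT0].
  rewrite mulrC -cintZ; last exact: cQ.
  by apply: eq_cint => s s01; have [-> _] := hTQ w wd s s01; rewrite mulrC.
- apply/cvgC_nbhsP => e e0.
  have L0 : 0 < `|L| + 1 by rewrite ltr_wpDl.
  exists (Num.min d0 (e / (`|L| + 1))); first by rewrite lt_min d0p divr_gt0.
  move=> w; rewrite lt_min => /andP[wd we]; have [cT cQ] := cTQ _ wd.
  rewrite -cintB; [|exact: cQ|exact: cQ0].
  apply: (@le_lt_trans _ _ (`|L| * normc (w - w0))).
    apply: cint_bound; first by apply: cont01B; [exact: cQ|exact: cQ0].
    move=> s s01; have [_ h] := hTQ w wd s s01; apply: le_trans h _.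
    by rewrite ler_wpM2r ?normc_ge0// ler_norm.
  apply: le_lt_trans (_ : _ <= (`|L| + 1) * normc (w - w0)) _.
    by rewrite ler_wpM2r ?normc_ge0// lerDl.
  by rewrite mulrC -ltr_pdivlMr.
Qed.

Section CauchyType.
Context {phi gam : R -> C} {w0 : C} {eta : R}.
Hypotheses (cphi : cont01 phi) (cgam : cont01 gam) (eta0 : 0 < eta)
  (gw : forall s, 0 <= s <= 1 -> eta <= normc (gam s - w0)).

Let u w s := (gam s - w)^-1.

Let gw2 w s : normc (w - w0) < eta / 2 -> 0 <= s <= 1 ->
  gam s - w != 0 /\ normc (u w s) <= 2 / eta.
Proof.
move=> wd s01; have h : eta / 2 <= normc (gam s - w).
  have := normcB (gam s - w0) (w - w0).
  have -> : gam s - w0 - (w - w0) = gam s - w by ring.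
  by have := gw s s01; lra.
have h0 : 0 < normc (gam s - w) by apply: lt_le_trans h; rewrite divr_gt0.
split; first by rewrite -normc_gt0.
by rewrite /u normcI -[2 / eta]invrK invf_div lef_pV2 ?posrE// divr_gt0.
Qed.

Let cu w : normc (w - w0) < eta / 2 -> cont01 (u w).
Proof.
move=> wd; apply: cont01V => [|s s01]; last by have [] := gw2 _ _ wd s01.
by apply: cont01B; [exact: cgam|exact: cont01_cst].
Qed.

Let w00 : normc (w0 - w0) < eta / 2.
Proof. by rewrite subrr normc_zero divr_gt0. Qed.

(** The resolvent identity; it supplies the exact difference quotients of the Cauchy kernels. *)
Let udiff w s : normc (w - w0) < eta / 2 -> 0 <= s <= 1 ->
  u w s - u w0 s = u w s * u w0 s * (w - w0).
Proof.
move=> wd s01; have [h1 _] := gw2 _ _ wd s01; have [h2 _] := gw2 _ _ w00 s01.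
by rewrite /u; field; rewrite h1 h2.
Qed.

Lemma hder_cauchy1 :
  hder (fun w => cint (fun s => phi s * u w s)) w0
       (cint (fun s => phi s * (u w0 s * u w0 s))).
Proof.
have [M M0 hM] := cont01_bounded _ cphi.
apply: (@hder_cint (fun w s => phi s * u w s) (fun w s => phi s * (u w s * u w0 s))
  w0 (eta / 2) (M * (2 / eta) ^+ 3)); first by rewrite divr_gt0.
  move=> w wd; split; apply: cont01M; [exact: cphi|exact: cu|exact: cphi|].
  by apply: cont01M; exact: cu.
move=> w wd s s01; have [_ b1] := gw2 _ _ wd s01; have [_ b2] := gw2 _ _ w00 s01.
have E := udiff _ _ wd s01; split; first by rewrite -mulrBr E; ring.
have -> : phi s * (u w s * u w0 s) - phi s * (u w0 s * u w0 s) =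
    phi s * (u w s * u w0 s * u w0 s) * (w - w0).
  have -> : phi s * (u w s * u w0 s) - phi s * (u w0 s * u w0 s) =
    phi s * u w0 s * (u w s - u w0 s) by ring.
  by rewrite E; ring.
rewrite !normcZ ler_wpM2r ?normc_ge0// ler_pM ?mulr_ge0 ?normc_ge0//; first exact: hM.
by rewrite exprSr expr2 !ler_pM ?mulr_ge0 ?normc_ge0.
Qed.

(** The integral found as derivative in [hder_cauchy1] is differentiable in turn; hence derivatives
    of holomorphic functions are holomorphic. In the Lipschitz constant, each kernel contributes 2 /
    eta and the factor 3 counts the terms of u w + 2 u w0. *)
Lemma hder_cauchy2 : cdifferentiable (fun w => cint (fun s => phi s * (u w s * u w s))) w0.
Proof.
have [M M0 hM] := cont01_bounded _ cphi.
eexists; apply: (@hder_cint (fun w s => phi s * (u w s * u w s))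
  (fun w s => phi s * (u w s * u w0 s * (u w s + u w0 s)))
  w0 (eta / 2) (M * ((2 / eta) ^+ 3 * (3 * (2 / eta))))); first by rewrite divr_gt0.
  move=> w wd; split; apply: cont01M; [exact: cphi| |exact: cphi|].
    by apply: cont01M; exact: cu.
  apply: cont01M; first by apply: cont01M; exact: cu.
  by apply: cont01D; exact: cu.
move=> w wd s s01; have [_ b1] := gw2 _ _ wd s01; have [_ b2] := gw2 _ _ w00 s01.
have E := udiff _ _ wd s01; split.
  have -> : phi s * (u w s * u w s) - phi s * (u w0 s * u w0 s) =
    phi s * (u w s + u w0 s) * (u w s - u w0 s) by ring.
  by rewrite E; ring.
have -> : phi s * (u w s * u w0 s * (u w s + u w0 s)) -
    phi s * (u w0 s * u w0 s * (u w0 s + u w0 s)) =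
    phi s * ((u w s * u w0 s * u w0 s) * (u w s + u w0 s + u w0 s)) * (w - w0).
  have -> : phi s * (u w s * u w0 s * (u w s + u w0 s)) -
    phi s * (u w0 s * u w0 s * (u w0 s + u w0 s)) =
    phi s * u w0 s * (u w s + u w0 s + u w0 s) * (u w s - u w0 s) by ring.
  by rewrite E; ring.
rewrite normcZ ler_wpM2r ?normc_ge0// normcZ ler_pM ?normc_ge0//; first exact: hM.
rewrite normcZ ler_pM ?normc_ge0//.
  by rewrite !normcZ exprSr expr2 !ler_pM ?mulr_ge0 ?normc_ge0.
apply: le_trans (normcD _ _) _; apply: le_trans (lerD (normcD _ _) (lexx _)) _.
by lra.
Qed.

End CauchyType.

Lemma circ_far z r w : normc (w - z) < r -> forall s, 0 <= s <= 1 ->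
  r - normc (w - z) <= normc (circ z r s - w).
Proof.
move=> wr s _; have r0 : 0 <= r by apply: le_trans (ltW wr); exact: normc_ge0.
have -> : circ z r s - w = (circ z r s - z) - (w - z) by ring.
by apply: le_trans (normcB _ _); rewrite normc_circ.
Qed.

Definition cder f z := xget 0 [set d | hder f z d].

Lemma cderP f z : cdifferentiable f z -> hder f z (cder f z).
Proof. by move=> [d hd0]; rewrite /cder; case: xgetP => [e ->//|/(_ d)]. Qed.

Lemma circ_cont z r : cont01 (circ z r).
Proof. by move=> s _; exact: circ_cvg. Qed.

Section Holomorphic.
Context {f : C -> C} {z : C} {rho : R}.
Hypotheses (rho0 : 0 < rho)
  (df : forall x, normc (x - z) < rho -> cdifferentiable f x).

Let r : R := rho / 2.
Let r0 : 0 < r. Proof. by rewrite divr_gt0. Qed.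
Let rrho : r < rho.
Proof. by rewrite /r ltr_pdivrMr// mulr_natr mulr2n ltrDl. Qed.
Let phi s := f (circ z r s) * (circ z r s - z).

Let cphi : cont01 phi.
Proof.
apply: cont01M; last by apply: cont01B; [exact: circ_cont|exact: cont01_cst].
apply: cont01_comp => [|s s01]; first exact: circ_cont.
by apply/cdiff_contat/df; rewrite normc_circ; [exact: rrho|exact: ltW r0].
Qed.

Let fE w : normc (w - z) < r ->
  f w = cint (fun s => phi s * (circ z r s - w)^-1).
Proof.
by move=> wr; apply: (cauchy_formula _ _ rho); [rewrite r0 rrho|exact: wr|exact: df].
Qed.

Let hfw w : normc (w - z) < r ->
  hder f w (cint (fun s => phi s * ((circ z r s - w)^-1 * (circ z r s - w)^-1))).
Proof.
move=> wr; have e0 : 0 < r - normc (w - z) by rewrite subr_gt0.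
apply: hder_near (hder_cauchy1 cphi (circ_cont z r) e0 (circ_far _ _ _ wr)).
apply/nbhsCP; exists (r - normc (w - z)) => // y yw; apply/esym/fE.
have -> : y - z = (y - w) + (w - z) by ring.
by apply: le_lt_trans (normcD _ _) _; rewrite -ltrBrDr.
Qed.

Lemma cdiff_cder_center : cdifferentiable (cder f) z.
Proof.
have zr : normc (z - z) < r by rewrite subrr normc_zero.
have e0 : 0 < r - normc (z - z) by rewrite subr_gt0.
have [d hd2] := hder_cauchy2 cphi (circ_cont z r) e0 (circ_far _ _ _ zr).
exists d; apply: hder_near hd2; apply/nbhsCP; exists r => // y yr.
apply: hder_unique (hfw _ yr) _; apply: cderP.
by exists (cint (fun s => phi s * ((circ z r s - y)^-1 * (circ z r s - y)^-1))); exact: hfw.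
Qed.

(** Removability of the singularity of the difference quotient: near [z] it is again a Cauchy type
    integral, with density [phi] divided by zeta - z. *)
Lemma cdiff_quot_center :
  cdifferentiable (fun w => if w == z then cder f z else (f w - f z) / (w - z)) z.
Proof.
have zr : normc (z - z) < r by rewrite subrr normc_zero.
have e0 : 0 < r - normc (z - z) by rewrite subr_gt0.
have far := circ_far _ _ _ zr.
have nz s : 0 <= s <= 1 -> circ z r s - z != 0.
  by move=> /far h; rewrite -normc_gt0; apply: lt_le_trans h.
have cpsi : cont01 (fun s => phi s * (circ z r s - z)^-1).
  apply: cont01M; first exact: cphi.
  apply: cont01V nz; apply: cont01B; [exact: circ_cont|exact: cont01_cst].
have hq := hder_cauchy1 cpsi (circ_cont z r) e0 far.
eexists; apply: hder_near hq; apply/nbhsCP; exists r => // y yr.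
have e1 : 0 < r - normc (y - z) by rewrite subr_gt0.
have fary := circ_far _ _ _ yr.
have ny s : 0 <= s <= 1 -> circ z r s - y != 0.
  by move=> /fary h; rewrite -normc_gt0; apply: lt_le_trans h.
have cy : cont01 (fun s => phi s * (circ z r s - y)^-1).
  apply: cont01M; first exact: cphi.
  apply: cont01V ny; apply: cont01B; [exact: circ_cont|exact: cont01_cst].
case: eqVneq => [->|yz].
  rewrite (hder_unique _ _ _ _ (cderP f z (df z _)) (hfw z zr)); last by rewrite subrr normc_zero.
  by apply: eq_cint => s s01; rewrite mulrA.
apply: (@mulIf _ (y - z)); first by rewrite subr_eq0.
rewrite divfK ?subr_eq0// (fE _ yr) (fE _ zr).
rewrite -cintB; [|exact: cy|exact: cpsi].
rewrite mulrC -cintZ.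
  apply: eq_cint => s s01; have h1 := nz s s01; have h2 := ny s s01.
  by field; rewrite h1 h2.
apply: cont01M; first exact: cpsi.
apply: cont01V ny; apply: cont01B; [exact: circ_cont|exact: cont01_cst].
Qed.

(** On the concentric disc of half the radius the kernel (zeta - z) / (zeta - w) has modulus at most
    2. The bound is uniform in [f], which lets it be applied to all quotients of a function by
    powers of x - z. *)
Lemma cauchy_bound M w : (forall s, 0 <= s <= 1 -> normc (f (circ z r s)) <= M) ->
  normc (w - z) < r / 2 -> normc (f w) <= 2 * M.
Proof.
move=> hM wr; have wr' : normc (w - z) < r by move: r0 wr; lra.
rewrite fE//; have far := circ_far _ _ _ wr'.
have hr : r / 2 <= r - normc (w - z) by move: wr; lra.
have nw s : 0 <= s <= 1 -> circ z r s - w != 0.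
  by move=> /far h; rewrite -normc_gt0; apply: lt_le_trans h; rewrite subr_gt0.
apply: cint_bound.
  apply: cont01M; first exact: cphi.
  apply: cont01V nw; apply: cont01B; [exact: circ_cont|exact: cont01_cst].
move=> s s01; rewrite /phi !normcZ normc_circ; last exact: ltW r0.
have h0 : 0 < normc (circ z r s - w) by rewrite normc_gt0 nw.
rewrite normcI ler_pdivrMr//.
have h1 := hM s s01.
have h2 : r <= 2 * normc (circ z r s - w) by have := far s s01; lra.
apply: le_trans (ler_pM (normc_ge0 _) (ltW r0) h1 h2) _.
by rewrite mulrCA mulrA.
Qed.

End Holomorphic.

Lemma cdiff_cder f z rho : (forall x, normc (x - z) < rho -> cdifferentiable f x) ->
  forall x, normc (x - z) < rho -> cdifferentiable (cder f) x.
Proof.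
move=> df x xr; have e0 : 0 < rho - normc (x - z) by rewrite subr_gt0.
apply: (cdiff_cder_center e0) => y yx; apply: df.
have -> : y - z = (y - x) + (x - z) by ring.
by apply: le_lt_trans (normcD _ _) _; rewrite -ltrBrDr.
Qed.

Lemma cdiff_quot f z rho : 0 < rho ->
  (forall x, normc (x - z) < rho -> cdifferentiable f x) ->
  exists2 K : C -> C, forall x, normc (x - z) < rho -> cdifferentiable K x
    & forall x, f x = f z + (x - z) * K x.
Proof.
move=> rho0 df.
exists (fun w => if w == z then cder f z else (f w - f z) / (w - z)); last first.
  move=> x; case: eqVneq => [->|xz]; first by rewrite subrr mul0r addr0.
  by field; rewrite subr_eq0.
move=> x xr; have [->|xz] := eqVneq x z; first exact: (cdiff_quot_center rho0 df).
have [e he] := df x xr.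
have [k hk] : cdifferentiable (fun y => (y - z)^-1) x.
  apply: (@hderV _ (fun y => y - z) _ (1 - 0)); first by rewrite subr_eq0.
  by apply: hderB; [exact: hder_id|exact: hder_cst].
eexists; apply: hder_near (hderM _ _ _ _ _ (hderB _ _ _ _ _ he (hder_cst (f z) x)) hk).
have xz0 : 0 < normc (x - z) by rewrite normc_gt0 subr_eq0.
apply/nbhsCP; exists (normc (x - z)) => // y yx.
by case: eqVneq => // yz; move: yx; rewrite yz normc_dist ltxx.
Qed.

End Taylor.

(** * Orders of meromorphic functions *)

Section Local.
Context {R : realType}.
Local Notation C := (Cx R).
Implicit Types (f g h : C -> C) (a b c w x z : C) (d r M : R) (m n : int) (P Q S : set C).

Definition pnear z P := exists2 d : R, 0 < d & forall x, x != z -> normc (x - z) < d -> P x.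
Definition nearC z P := exists2 d : R, 0 < d & forall x, normc (x - z) < d -> P x.
Definition holo f z := nearC z (cdifferentiable f).

Lemma pnearP z P : pnear z P <-> \forall x \near z^', P x.
Proof. by split=> [h|/dnbhsCP//]; apply/dnbhsCP. Qed.

Lemma pnearS z P Q : (forall x, x != z -> P x -> Q x) -> pnear z P -> pnear z Q.
Proof. by move=> PQ [d d0 h]; exists d => // x xz xd; apply: PQ => //; exact: h. Qed.

Lemma pnearI z P Q : pnear z P -> pnear z Q -> pnear z (fun x => P x /\ Q x).
Proof.
move=> [d d0 hP] [e e0 hQ]; exists (Num.min d e); first by rewrite lt_min d0.
by move=> x xz; rewrite lt_min => /andP[xd xe]; split; [exact: hP|exact: hQ].
Qed.

Lemma nearC_pnear z P : nearC z P -> pnear z P.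
Proof. by move=> [d d0 h]; exists d => // x _; exact: h. Qed.

Lemma pnear_ex z P : pnear z P -> exists x, x != z /\ P x.
Proof.
move=> [d d0 h]; exists (z + (d / 2)%:C).
have d2 : 0 < d / 2 by rewrite divr_gt0.
have xz : z + (d / 2)%:C != z.
  by rewrite -subr_eq0 addrC addKr -normc_eq0 normc_real gtr0_norm// gt_eqF.
split=> //; apply: h => //; rewrite addrC addKr normc_real gtr0_norm//.
by rewrite ltr_pdivrMr// mulr_natr mulr2n ltrDl.
Qed.

Lemma nearC_near z P : nearC z P -> nearC z (fun x => nearC x P).
Proof.
move=> [d d0 h]; exists d => // x xd.
exists (d - normc (x - z)); first by rewrite subr_gt0.
move=> y yx; apply: h; have -> : y - z = (y - x) + (x - z) by ring.
by apply: le_lt_trans (normcD _ _) _; rewrite -ltrBrDr.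
Qed.

Lemma pnear_near z P : pnear z P -> pnear z (fun x => nearC x P).
Proof.
move=> [d d0 h]; exists d => // x xz xd.
exists (Num.min (d - normc (x - z)) (normc (x - z))).
  by rewrite lt_min !subr_gt0 xd normc_gt0 subr_eq0.
move=> y; rewrite lt_min => /andP[y1 y2]; apply: h.
  by apply/eqP => yz; move: y2; rewrite yz normc_dist ltxx.
have -> : y - z = (y - x) + (x - z) by ring.
by apply: le_lt_trans (normcD _ _) _; rewrite -ltrBrDr.
Qed.

Lemma cdiff_near f g z : nearC z (fun x => f x = g x) -> cdifferentiable f z -> cdifferentiable g z.
Proof. by move=> fg [d hd]; exists d; apply: hder_near hd; apply/nbhsCP. Qed.

Lemma holoP f z : holomorphic_near f z <-> holo f z.
Proof.
split.
  move=> /(nbhsCP z)[d d0 h]; exists d => // x xd.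
  have [q [qe qx]] := derivable_slope f x (h x xd).
  exists (q x), q; split; [|exact: qx|by []].
  by apply/nbhsCP; exists 1.
move=> [d d0 h]; apply/(nbhsCP z); exists d => // x xd.
have [e [q [qe qx _]]] := h x xd.
exact: (@ex_derive _ _ _ _ _ _ _ (slope_is_derive f q x e qe qx)).
Qed.

Lemma cdiff_cst a z : cdifferentiable (fun=> a) z.
Proof. by exists 0; exact: hder_cst. Qed.
Lemma cdiff_sub a z : cdifferentiable (fun x => x - a) z.
Proof. by exists (1 - 0); apply: hderB; [exact: hder_id|exact: hder_cst]. Qed.
Lemma cdiffM f g z : cdifferentiable f z -> cdifferentiable g z ->
  cdifferentiable (fun x => f x * g x) z.
Proof. by move=> [d hd] [e he]; eexists; exact: hderM hd he. Qed.
Lemma cdiffD f g z : cdifferentiable f z -> cdifferentiable g z ->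
  cdifferentiable (fun x => f x + g x) z.
Proof. by move=> [d hd] [e he]; exists (d + e); exact: cderivD hd he. Qed.
Lemma cdiffV f z : f z != 0 -> cdifferentiable f z -> cdifferentiable (fun x => (f x)^-1) z.
Proof. by move=> fz [d hd]; exact: hderV fz hd. Qed.
Lemma cdiffX f z k : cdifferentiable f z -> cdifferentiable (fun x => f x ^+ k) z.
Proof.
move=> df; elim: k => [|k IH]; first exact: cdiff_cst.
have -> : (fun x => f x ^+ k.+1) = (fun x => f x * f x ^+ k) by apply/funext => x; rewrite exprS.
exact: cdiffM.
Qed.
Lemma cdiff_shift f a z : cdifferentiable f (z + a) -> cdifferentiable (fun x => f (x + a)) z.
Proof.
move=> [d hd]; exists (d * (1 + 0)).
have hi : hder (fun x => x + a) z (1 + 0).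
  by apply: cderivD; [exact: hder_id|exact: hder_cst].
have ic : (id : C -> C) @ nbhs z --> (id z : C) by move=> ?.
exact: (cderiv_comp ic f (fun x => x + a) (1 + 0) d hd hi).
Qed.

Lemma holo_op2 (o : (C -> C) -> (C -> C) -> C -> C) f g z :
  (forall x, cdifferentiable f x -> cdifferentiable g x -> cdifferentiable (o f g) x) ->
  holo f z -> holo g z -> holo (o f g) z.
Proof.
move=> ho [d d0 hf] [e e0 hg]; exists (Num.min d e); first by rewrite lt_min d0.
by move=> x; rewrite lt_min => /andP[xd xe]; apply: ho; [exact: hf|exact: hg].
Qed.

Lemma holoM f g z : holo f z -> holo g z -> holo (fun x => f x * g x) z.
Proof. by apply: (holo_op2 (fun f g x => f x * g x)) => x; exact: cdiffM. Qed.
Lemma holoD f g z : holo f z -> holo g z -> holo (fun x => f x + g x) z.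
Proof. by apply: (holo_op2 (fun f g x => f x + g x)) => x; exact: cdiffD. Qed.
Lemma holo_cst a z : holo (fun=> a) z.
Proof. by exists 1 => // x _; exact: cdiff_cst. Qed.
Lemma holo_sub a z : holo (fun x => x - a) z.
Proof. by exists 1 => // x _; exact: cdiff_sub. Qed.
Lemma holoX f z k : holo f z -> holo (fun x => f x ^+ k) z.
Proof. by move=> [d d0 hf]; exists d => // x xd; apply: cdiffX; exact: hf. Qed.
Lemma holo_shift f a z : holo f (z + a) -> holo (fun x => f (x + a)) z.
Proof.
move=> [d d0 hf]; exists d => // x xd; apply: cdiff_shift; apply: hf.
by have -> : x + a - (z + a) = x - z by ring.
Qed.

Lemma holo_contat f z : holo f z -> contat f z.
Proof. by move=> [d d0 h]; apply/cdiff_contat/h; rewrite subrr normc_zero. Qed.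

Lemma contat_neq0 f z : contat f z -> f z != 0 -> nearC z (fun x => f x != 0).
Proof.
move=> cf f0; have n0 : 0 < normc (f z) by rewrite normc_gt0.
have [d d0 h] := (cvgC_nbhsP f z (f z)).1 cf _ n0; exists d => // x /h.
by case: eqVneq => [->|//]; rewrite sub0r normc_opp ltxx.
Qed.

Lemma holoV f z : f z != 0 -> holo f z -> holo (fun x => (f x)^-1) z.
Proof.
move=> f0 hf; have [d d0 hn] := contat_neq0 _ _ (holo_contat _ _ hf) f0.
have [e e0 he] := hf; exists (Num.min d e); first by rewrite lt_min d0.
by move=> x; rewrite lt_min => /andP[/hn xd /he]; exact: cdiffV.
Qed.

Lemma cont_eq_punctured f g z : contat f z -> contat g z ->
  pnear z (fun x => f x = g x) -> f z = g z.
Proof.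
move=> cf cg [d d0 h]; apply/eqP; rewrite -subr_eq0 -normc_eq0 eq_le normc_ge0 andbT.
apply/ler_addgt0Pr => e e0; rewrite add0r.
have e20 : 0 < e / 2 by rewrite divr_gt0.
have [d1 d10 h1] := (cvgC_nbhsP f z (f z)).1 cf _ e20.
have [d2 d20 h2] := (cvgC_nbhsP g z (g z)).1 cg _ e20.
have [x [xz [fgx [x1 x2]]]] : exists x, x != z /\ (f x = g x /\ (normc (x - z) < d1 /\ normc (x - z) < d2)).
  apply: pnear_ex; apply: pnearI; first by exists d.
  by apply: pnearI; [exists d1|exists d2].
have -> : f z - g z = (g x - g z) - (f x - f z) by rewrite fgx; ring.
apply: le_trans (normcD _ _) _; rewrite normc_opp.
by have := h1 _ x1; have := h2 _ x2; lra.
Qed.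

(** The order of the germ, positive at a zero and negative at a pole; a germ that vanishes
    identically has none. The value of [f] at [z] is irrelevant. *)
Definition ordat f z m := exists h, [/\ holo h z, h z != 0 & pnear z (fun x => f x = h x * (x - z) ^ m)].
Definition zeroat f z := pnear z (fun x => f x = 0).
(** A condition on the representative, including its value at [z]; it is therefore stronger than
    having order 0. *)
Definition regular f z := holo f z /\ f z != 0.

Lemma regular_ordat f z : regular f z -> ordat f z 0.
Proof. by move=> [hf f0]; exists f; split=> //; exists 1 => // x _ _; rewrite expr0z mulr1. Qed.

Lemma ordat_ext f g z m : pnear z (fun x => f x = g x) -> ordat f z m -> ordat g z m.
Proof.
move=> fg [h [hh h0 E]]; exists h; split=> //.
by apply: pnearS (pnearI _ _ _ fg E) => x _ [<-].
Qed.

Lemma zeroat_ext f g z : pnear z (fun x => f x = g x) -> zeroat f z -> zeroat g z.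
Proof. by move=> fg E; apply: pnearS (pnearI _ _ _ fg E) => x _ [<-]. Qed.

Lemma ordatM f g z m n : ordat f z m -> ordat g z n -> ordat (fun x => f x * g x) z (m + n).
Proof.
move=> [h [hh h0 E]] [k [hk k0 F]]; exists (fun x => h x * k x); split.
- exact: holoM.
- by rewrite mulf_neq0.
- apply: pnearS (pnearI _ _ _ E F) => x xz [-> ->].
  by rewrite expfzDr ?subr_eq0//; ring.
Qed.

Lemma ordatV f z m : ordat f z m -> ordat (fun x => (f x)^-1) z (- m).
Proof.
move=> [h [hh h0 E]]; exists (fun x => (h x)^-1); split; [exact: holoV|by rewrite invr_neq0|].
by apply: pnearS E => x xz ->; rewrite invfM invr_expz.
Qed.

Lemma ordat_sub a z : ordat (fun x => x - a) z (z == a)%:Z.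
Proof.
case: eqVneq => [->|za].
  exists (fun=> 1); split; [exact: holo_cst|exact: oner_neq0|].
  by exists 1 => // x _ _; rewrite mul1r expr1z.
by apply: regular_ordat; split; [exact: holo_sub|rewrite subr_eq0].
Qed.

(** Off [z] the function agrees, on a full neighbourhood of each point, with a product of
    nonvanishing holomorphic functions. The discreteness of zeros, of poles and of points with a
    wrong value all comes from here. *)
Lemma ordat_neq0 f z m : ordat f z m -> pnear z (regular f).
Proof.
move=> [h [hh h0 E]].
have hn := contat_neq0 _ _ (holo_contat _ _ hh) h0.
have := pnearI _ _ _ (nearC_pnear _ _ (nearC_near _ _ hh)) (pnearI _ _ _ (nearC_pnear _ _ hn) (pnearI _ _ _ E (pnear_near _ _ E))).
apply: pnearS => x xz [hx [hx0 [Ex [d d0 En]]]]; split; last first.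
  by rewrite Ex mulf_neq0// expfz_neq0// subr_eq0.
have hp : holo (fun x => h x * (x - z) ^ m) x.
  apply: holoM => //; case: m {E Ex En} => k; first exact: (holoX _ _ k (holo_sub z x)).
  apply: (holoV (fun x => (x - z) ^+ k.+1)); first by rewrite expf_neq0// subr_eq0.
  exact: holoX (holo_sub z x).
have [e e0 he] := hp; exists (Num.min d e); first by rewrite lt_min d0.
move=> y; rewrite lt_min => /andP[yd ye]; apply: cdiff_near (he y ye).
exists (d - normc (y - x)); first by rewrite subr_gt0.
move=> w wy; apply/esym/En; have -> : w - x = (w - y) + (y - x) by ring.
by apply: le_lt_trans (normcD _ _) _; rewrite -ltrBrDr.
Qed.

Lemma ordat_zeroat f z m : ordat f z m -> zeroat f z -> False.
Proof.
move=> /ordat_neq0 h1 h2; have [x [xz [[_ /eqP]]]] := pnear_ex _ _ (pnearI _ _ _ h1 h2).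
by [].
Qed.

Lemma ordat0_unique f z m : ordat f z m -> ordat f z 0 -> m = 0.
Proof.
wlog m0 : f m / 0 <= m.
  move=> H fm f0; have [m0|m0] := leP 0 m; first exact: H fm f0.
  have := H _ (- m) _ (ordatV _ _ _ fm) (ordatV _ _ _ f0).
  rewrite oppr_ge0 (ltW m0) => /(_ isT) /eqP.
  by rewrite oppr_eq0 => /eqP.
case: m m0 => // -[//|k] _ [h [hh h0 E]] [g [hg g0 F]].
have : g z = h z * (z - z) ^+ k.+1.
  apply: (cont_eq_punctured g (fun x => h x * (x - z) ^+ k.+1)).
  - exact: holo_contat.
  - by apply: holo_contat; apply: holoM => //; exact: holoX (holo_sub z z).
  - by apply: pnearS (pnearI _ _ _ E F) => x _ [->]; rewrite expr0z mulr1 => <-.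
by rewrite subrr expr0n mulr0 => /eqP; rewrite (negbTE g0).
Qed.

Lemma ordat_unique f z m n : ordat f z m -> ordat f z n -> m = n.
Proof.
move=> fm fn; apply/eqP; rewrite -subr_eq0; apply/eqP.
have h := ordatM _ _ _ _ _ fm (ordatV _ _ _ fn).
apply: (ordat0_unique _ _ _ h).
have r1 : regular (fun=> 1) z by split; [exact: holo_cst|exact: oner_neq0].
apply: ordat_ext (regular_ordat _ _ r1).
by apply: pnearS (ordat_neq0 _ _ _ fm) => x _ [_ f0]; rewrite mulfV.
Qed.

(** Without finite order, [f] equals (x - z) ^ k times a function g holomorphic on the whole disc,
    for every k. If |f| <= M on the circle of radius r, then |g| <= 2 M / r ^ k on the disc of
    radius r / 2, whence |f| <= 2 M / 2 ^ k there for every k. *)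
Lemma holo_cases f z : holo f z -> zeroat f z \/ exists k : nat, ordat f z k%:Z.
Proof.
move=> [rho rho0 df].
have [//|no] := pselect (exists k : nat, ordat f z k%:Z); first by right.
left.
have hk (k : nat) : exists2 g : C -> C, forall x, normc (x - z) < rho -> cdifferentiable g x
    & forall x, f x = (x - z) ^+ k * g x.
  elim: k => [|k [g dg fg]]; first by exists f => // x; rewrite expr0 mul1r.
  have g0 : g z = 0.
    apply/eqP; apply: contrapT => /negP g0; apply: no; exists k, g; split=> //.
      by exists rho.
    by exists 1 => // x _ _; rewrite fg mulrC.
  have [K dK gK] := cdiff_quot g z rho rho0 dg.
  by exists K => // x; rewrite fg gK g0 add0r exprSr mulrA.
pose r := rho / 2; have r0 : 0 < r by rewrite divr_gt0.
have rr : r < rho by rewrite /r ltr_pdivrMr// mulr_natr mulr2n ltrDl.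
have [M M0 hM] : exists2 M : R, 0 < M & forall s, 0 <= s <= 1 -> normc (f (circ z r s)) <= M.
  apply: (cont01_bounded (fun s => f (circ z r s))).
  apply: cont01_comp => [|s _]; first exact: circ_cont.
  by apply/cdiff_contat/df; rewrite normc_circ; [exact: rr|exact: ltW r0].
exists (r / 2); first by rewrite divr_gt0.
move=> w _ wr; apply/eqP; rewrite -normc_eq0 eq_le normc_ge0 andbT.
have bnd (k : nat) : normc (f w) <= 2 * M / 2 ^+ k.
  have [g dg fg] := hk k.
  have rk : 0 < r ^+ k by rewrite exprn_gt0.
  have gM : normc (g w) <= 2 * (M / r ^+ k).
    apply: (cauchy_bound rho0 dg); last exact: wr.
    move=> s s01; rewrite ler_pdivlMr// mulrC.
    have := hM s s01; rewrite fg normcZ normcX normc_circ; last exact: ltW r0.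
    by [].
  rewrite fg normcZ normcX.
  have h1 : normc (w - z) ^+ k <= (r / 2) ^+ k.
    by rewrite lerXn2r ?nnegrE ?normc_ge0 ?divr_ge0 ?(ltW r0)// ltW.
  apply: le_trans (ler_pM _ (normc_ge0 _) h1 gM) _; first by rewrite exprn_ge0 ?normc_ge0.
  rewrite expr_div_n le_eqVlt; apply/orP; left; apply/eqP.
  by field; rewrite !expf_neq0 ?pnatr_eq0 ?gt_eqF.
apply/ler_addgt0Pr => e e0; rewrite add0r.
have [k hk2] := expr2_large (2 * M / e); apply: le_trans (bnd k) _.
rewrite ltr_pdivrMr// in hk2; rewrite ler_pdivrMr ?exprn_gt0// [e * _]mulrC.
exact: ltW.
Qed.

End Local.

(** * Meromorphic functions and the identity theorem *)

Section Mero.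
Context {R : realType}.
Local Notation C := (Cx R).
Implicit Types (f g h : C -> C) (a b c w x z : C) (d r M : R) (m n : int) (P Q S : set C).

Definition merol f z := exists (k : nat) g, holo g z /\ pnear z (fun x => f x = g x / (x - z) ^+ k).

Lemma meroP f : meromorphic f <-> forall z, merol f z.
Proof.
split=> mf z; have [k [g [hg E]]] := mf z; exists k, g; split.
- exact/holoP.
- exact/pnearP.
- exact/holoP.
- exact/pnearP.
Qed.

Lemma merol_cst a z : merol (fun=> a) z.
Proof.
exists 0%N, (fun=> a); split; first exact: holo_cst.
by exists 1 => // x _ _; rewrite expr0 divr1.
Qed.

Lemma merolD f g z : merol f z -> merol g z -> merol (fun x => f x + g x) z.
Proof.
move=> [k [f1 [hf E]]] [l [g1 [hg F]]].
exists (k + l)%N, (fun x => f1 x * (x - z) ^+ l + g1 x * (x - z) ^+ k); split.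
  by apply: holoD; apply: holoM => //; exact: holoX (holo_sub z z).
apply: pnearS (pnearI _ _ _ E F) => x xz [-> ->]; rewrite exprD.
by field; rewrite !expf_neq0 ?subr_eq0.
Qed.

Lemma merolM f g z : merol f z -> merol g z -> merol (fun x => f x * g x) z.
Proof.
move=> [k [f1 [hf E]]] [l [g1 [hg F]]].
exists (k + l)%N, (fun x => f1 x * g1 x); split; first exact: holoM.
apply: pnearS (pnearI _ _ _ E F) => x xz [-> ->]; rewrite exprD.
by field; rewrite !expf_neq0 ?subr_eq0.
Qed.

Lemma merol_shift f a z : merol f (z + a) -> merol (fun x => f (x + a)) z.
Proof.
move=> [k [g [hg [d d0 E]]]]; exists k, (fun x => g (x + a)); split; first exact: holo_shift.
exists d => // x xz xd; rewrite E.
- by have -> : x + a - (z + a) = x - z by ring.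
- by rewrite (inj_eq (addIr a)).
- by have -> : x + a - (z + a) = x - z by ring.
Qed.

Lemma merol_cases f z : merol f z -> zeroat f z \/ exists m, ordat f z m.
Proof.
move=> [k [g [hg E]]]; have [g0|[n gn]] := holo_cases _ _ hg; [left|right].
  by apply: pnearS (pnearI _ _ _ E g0) => x _ [-> ->]; rewrite mul0r.
move: gn => [h [hh h0 F]]; exists (n%:Z - k%:Z), h; split=> //.
apply: pnearS (pnearI _ _ _ E F) => x xz [-> ->].
by rewrite expfzDr ?subr_eq0// -mulrA -invr_expz.
Qed.

Lemma zeroat_near f z : zeroat f z -> pnear z (zeroat f).
Proof. by move=> /pnear_near; apply: pnearS => x _; exact: nearC_pnear. Qed.

(** The identity theorem, by connectedness of a segment from a point [b] with zero germ to a point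
    [a] of finite order. Let c be the supremum of the parameters up to which all germs vanish. A
    zero germ at c would extend the vanishing beyond c, and a finite order at c would exclude zero
    germs just before it. *)
Lemma mero_dichotomy f : meromorphic f ->
  (forall z, zeroat f z) \/ (forall z, exists m, ordat f z m).
Proof.
move=> /meroP mf.
have [//|nz] := pselect (forall z, zeroat f z); first by left.
right=> b; have [zb|//] := merol_cases f b (mf b).
exfalso; apply: nz => a; have [//|[m fm]] := merol_cases f a (mf a); exfalso.
have ab : a != b by apply/eqP => ab; rewrite ab in fm; exact: ordat_zeroat fm zb.
pose E := [set s : R | 0 <= s <= 1 /\ forall t, 0 <= t <= s -> zeroat f (pt b a t)].
have E0 : E 0.
  split=> [|t]; first by rewrite lexx ler01.
  by rewrite -eq_le => /eqP <-; rewrite pt0.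
have supE : has_sup E by split; [exists 0|exists 1 => s [/andP[]]].
pose c := sup E.
have [Ene Eub] := supE.
have c0 : 0 <= c by apply: ub_le_sup; [exact: Eub|exact: E0].
have c1 : c <= 1 by apply: ge_sup; [exact: Ene|move=> s [/andP[]]].
have ba : 0 < normc (a - b) by rewrite normc_gt0 subr_eq0.
have dist s t : normc (pt b a s - pt b a t) = `|s - t| * normc (a - b).
  have -> : pt b a s - pt b a t = (s - t)%:C * (a - b) by rewrite /pt rmorphB /=; ring.
  by rewrite normcZ normc_real.
have neq s t : s != t -> pt b a s != pt b a t.
  move=> st; rewrite -subr_eq0 -normc_eq0 dist mulf_neq0 ?normr_eq0 ?subr_eq0//.
  by rewrite normc_eq0 subr_eq0.
have below t : 0 <= t < c -> zeroat f (pt b a t).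
  move=> /andP[t0 tc]; have [s [s01 hs] ts] := sup_gt Ene tc.
  by apply: hs; rewrite t0 ltW.
have small (d e : R) : 0 < d -> e <= d / (2 * normc (a - b)) -> e * normc (a - b) < d.
  move=> d0; rewrite ler_pdivlMr ?mulr_gt0// => h.
  have -> : e * normc (a - b) = e * (2 * normc (a - b)) / 2 by field.
  by apply: le_lt_trans (ler_wpM2r _ h) _; rewrite ?invr_ge0// ltr_pdivrMr// mulr_natr mulr2n ltrDl.
have [zc|[n cn]] := merol_cases f (pt b a c) (mf (pt b a c)).
- have [d d0 hd] := zeroat_near _ _ zc.
  have [c1'|c1'] := ltP c 1; last first.
    have cE : c = 1 by apply/eqP; rewrite eq_le c1.
    by move: zc; rewrite cE pt1; exact: ordat_zeroat fm.
  pose e := Num.min (1 - c) (d / (2 * normc (a - b))).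
  have e0 : 0 < e by rewrite lt_min subr_gt0 c1' divr_gt0// mulr_gt0.
  suff : c + e <= c by move: e0; lra.
  apply: ub_le_sup; first exact: Eub.
  split.
      have e1 : e <= 1 - c by rewrite ge_min lexx.
      by apply/andP; split; move: e0 c0 e1; lra.
    move=> t /andP[t0 te]; have [tc|ct|->] := ltgtP t c; [|  |exact: zc].
      by apply: below; rewrite t0.
    apply: hd; first by rewrite neq// gt_eqF.
    rewrite dist gtr0_norm ?subr_gt0//.
    apply: le_lt_trans (_ : _ <= e * normc (a - b)) _.
      by rewrite ler_wpM2r ?normc_ge0// lerBlDl.
    by apply: small => //; rewrite ge_min lexx orbT.
- have [d d0 hd] := ordat_neq0 _ _ _ cn.
  have cp : 0 < c.
    rewrite lt_neqAle c0 andbT; apply/eqP => cE.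
    by move: cn; rewrite -cE pt0 => /ordat_zeroat; apply.
  pose e := Num.min c (d / (2 * normc (a - b))).
  have e0 : 0 < e by rewrite lt_min cp divr_gt0// mulr_gt0.
  have z1 : zeroat f (pt b a (c - e)).
    by apply: below; rewrite subr_ge0 ge_min lexx/= gtrBl.
  have r1 : regular f (pt b a (c - e)).
    apply: hd; first by rewrite neq// lt_eqF// gtrBl.
    rewrite dist addrAC subrr sub0r normrN gtr0_norm//.
    by apply: small => //; rewrite ge_min lexx orbT.
  exact: ordat_zeroat (regular_ordat _ _ r1) z1.
Qed.

Lemma mero_eqP f g : mero_eq f g <-> forall z, pnear z (fun x => f x = g x).
Proof. by split=> h z; apply/pnearP; exact: h. Qed.

Lemma has_poleP f z (k : nat) : has_pole f z k <-> (0 < k)%N /\ ordat f z (- k%:Z).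
Proof.
have xE x : (x - z) ^ (- k%:Z) = ((x - z) ^+ k)^-1 by rewrite -invr_expz.
split=> [[k0 [g [/holoP hg g0 /pnearP E]]]|[k0 [h [hh h0 E]]]]; split=> //.
  by exists g; split=> //; apply: pnearS E => x _ ->; rewrite xE.
exists h; split=> //; first exact/holoP.
by apply/pnearP; apply: pnearS E => x _ ->; rewrite xE.
Qed.

(** The negative part: the multiplicity as a pole of a point of order [m]. For -m it is the
    multiplicity as a zero. *)
Definition nat_neg m : nat := if m is Negz k then k.+1 else 0%N.

Lemma pole_mult_ordat f z m : ordat f z m -> pole_mult f z = nat_neg m.
Proof.
move=> fm; rewrite /pole_mult; case: xgetP => [k _ /has_poleP[k0 fk]|no].
  by rewrite (ordat_unique _ _ _ _ fm fk); case: k k0 {fk} => // k _; rewrite -NegzE.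
case: m fm => // k; rewrite NegzE => fk; case: (no k.+1).
exact/has_poleP.
Qed.

End Mero.

(** * Counting functions *)

Section Counting.
Context {R : realType}.
Local Notation C := (Cx R).
Local Notation leb := (@lebesgue_measure R).
Implicit Types (a b w x z : C) (r t : R) (mu : R[i] -> nat).

Lemma inv_integrable (al r : R) : 0 < al ->
  leb.-integrable `[al, r] (EFin \o (fun t => t^-1)).
Proof.
move=> al0; apply: continuous_compact_integrable; first exact: segment_compact.
apply: continuous_in_subspaceT => t; rewrite inE/= in_itv/= => /andP[h _].
by apply: (@cvgV _ _ (nbhs t)); [rewrite gt_eqF// (lt_le_trans al0)|by move=> ?].
Qed.

Lemma inv_integral (al r : R) : 0 < al -> al < r ->
  \int[leb]_(t in `]al, r[) t^-1 = ln r - ln al.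
Proof.
move=> al0 alr; have I := inv_integrable _ r al0.
rewrite Rintegral_itv_obnd_cbnd; last first.
  by apply: integrableS I => //; exact: subset_itv_oo_cc.
rewrite Rintegral_itv_bndo_bndc; last first.
  by apply: integrableS I => //; exact: subset_itv_co_cc.
rewrite /Rintegral (@continuous_FTC2 R (fun t => t^-1) (@ln R) al r alr) //.
- apply: continuous_in_subspaceT => t; rewrite inE/= in_itv/= => /andP[h _].
  by apply: (@cvgV _ _ (nbhs t)); [rewrite gt_eqF// (lt_le_trans al0)|by move=> ?].
- split.
  + move=> t; rewrite in_itv/= => /andP[h _].
    by have [] := is_derive1_ln (lt_trans al0 h).
  + by apply: cvg_at_right_filter; exact: continuous_ln.
  + by apply: cvg_at_left_filter; apply: continuous_ln; exact: lt_trans alr.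
- move=> t; rewrite in_itv/= => /andP[h _].
  by rewrite derive1E (@derive_val _ _ _ _ _ _ _ (is_derive1_ln (lt_trans al0 h))).
Qed.

(** The contribution to n(t) / t of one point of modulus [al]; the inequality is strict because
    [ncount] uses open discs. *)
Definition step (al t : R) : R := if al < t then t^-1 else 0.

Lemma step_restrict (al : R) : step al = (fun t => t^-1) \_ `]al, +oo[.
Proof.
apply/funext => t; rewrite /step /patch; case: ifPn => h.
  by rewrite ifT// inE/= in_itv/= h.
by rewrite ifF//; apply/negbTE; rewrite notin_setE/= in_itv/= andbT; exact/negP.
Qed.

Lemma itv_al (al r : R) : 0 < al ->
  [set` `]0, r[] `&` [set` `]al, +oo[] = [set` `]al, r[].
Proof.
move=> al0; apply/seteqP; split=> t /=; rewrite !in_itv/= ?andbT.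
  by move=> [/andP[_ ->] ->].
by move=> /andP[h ->]; rewrite h (lt_trans al0 h).
Qed.

Lemma step_integrable (al r : R) : 0 < al -> leb.-integrable `]0, r[ (EFin \o step al).
Proof.
move=> al0; rewrite step_restrict -restrict_EFin; apply/integrable_restrict => //.
rewrite itv_al//; apply: integrableS (inv_integrable _ r al0) => //.
exact: subset_itv_oo_cc.
Qed.

Lemma step_integral (al r : R) : 0 < al -> al < r ->
  \int[leb]_(t in `]0, r[) step al t = ln r - ln al.
Proof. by move=> al0 alr; rewrite step_restrict -Rintegral_mkcondr itv_al// inv_integral. Qed.

Lemma sum_step_integral (Z : seq C) (k : C -> R) r :
  (forall a, a \in Z -> a != 0 /\ normc a < r) ->
  leb.-integrable `]0, r[ (EFin \o (fun t => \sum_(a <- Z) k a * step (normc a) t)) /\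
  \int[leb]_(t in `]0, r[) (\sum_(a <- Z) k a * step (normc a) t) =
    \sum_(a <- Z) k a * (ln r - ln (normc a)).
Proof.
elim: Z => [|a Z IH] hZ.
  have -> : (fun t => \sum_(a <- [::]) k a * step (normc a) t) = (fun=> 0).
    by apply/funext => t; rewrite big_nil.
  split; last by rewrite big_nil Rintegral_cst// mul0r.
  have -> : EFin \o (fun=> 0) = cst 0%E :> (R -> \bar R) by [].
  exact: integrable0.
have hZ' b : b \in Z -> b != 0 /\ normc b < r.
  by move=> bZ; apply: hZ; rewrite in_cons bZ orbT.
have [IH1 IH2] := IH hZ'.
have [a0 ar] := hZ a (mem_head _ _); rewrite -normc_gt0 in a0.
have -> : (fun t => \sum_(b <- a :: Z) k b * step (normc b) t) =
    (fun t => k a * step (normc a) t + \sum_(b <- Z) k b * step (normc b) t).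
  by apply/funext => t; rewrite big_cons.
have I1 : leb.-integrable `]0, r[ (EFin \o (fun t => k a * step (normc a) t)).
  have -> : EFin \o (fun t => k a * step (normc a) t) =
     (fun t => ((k a)%:E * (EFin \o step (normc a)) t)%E) by [].
  by apply: integrableZl => //; exact: step_integrable.
split.
  have -> : EFin \o (fun t => k a * step (normc a) t + \sum_(b <- Z) k b * step (normc b) t) =
    (EFin \o (fun t => k a * step (normc a) t)) \+ (EFin \o (fun t => \sum_(b <- Z) k b * step (normc b) t)).
    by apply/funext => t.
  exact: integrableD.
rewrite RintegralD// IH2 big_cons; congr (_ + _).
by rewrite RintegralZl ?step_integral//; exact: step_integrable.
Qed.

(** Integrating the contribution of each point separately turns the counting function into a sum of
    ln (r / |a|). The list only has to contain the support, so one list can serve several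
    weights. *)
Lemma Ncount_formula mu r (Z : seq C) : 0 < r -> uniq Z ->
  (forall a, a \in Z -> a != 0 /\ normc a < r) ->
  (forall a, a != 0 -> normc a < r -> mu a != 0%N -> a \in Z) ->
  Ncount mu r = \sum_(a <- Z) (mu a)%:R * (ln r - ln (normc a)) + (mu 0)%:R * ln r.
Proof.
move=> r0 uZ hZ sZ; rewrite /Ncount; congr (_ + _).
have [_ <-] := sum_step_integral Z (fun a => (mu a)%:R) r hZ.
apply: eq_Rintegral => t; rewrite inE/= in_itv/= => /andP[t0 tr].
have nZ0 : 0 \notin Z by apply/negP => /hZ[]; rewrite eqxx.
have -> : ncount mu t = \sum_(a <- 0 :: [seq a <- Z | normc a < t]) (mu a)%:R.
  rewrite /ncount (fsbigE (0 :: [seq a <- Z | normc a < t])); last first.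
  - move=> a /= at_; rewrite in_cons negb_or mem_filter at_ /= => /andP[a0 aZ].
    apply/eqP; rewrite pnatr_eq0; apply: contraNT aZ; apply: sZ => //.
    exact: lt_trans tr.
  - move=> a /=; rewrite in_cons mem_filter => /orP[/eqP ->|/andP[]//].
    by rewrite normc_zero.
  - by rewrite /= mem_filter (negbTE nZ0) andbF/= filter_uniq.
  rewrite big_mkcond; apply: eq_big_seq => a.
  rewrite in_cons mem_filter => /orP[/eqP ->|/andP[h _]].
    have z0t : normc (0 : C) < t by rewrite normc_zero.
    by rewrite ifT// inE; exact: z0t.
  by rewrite ifT// inE.
rewrite big_cons addrAC subrr add0r big_filter big_mkcond mulr_suml.
apply: eq_bigr => a _; rewrite /step; case: ifP => // _.
by rewrite mul0r mulr0.
Qed.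

Lemma square_compact (r : R) :
  compact ([set z : C | `|Re z| <= r /\ `|Im z| <= r]).
Proof.
have -> : [set z : C | `|Re z| <= r /\ `|Im z| <= r] =
   (fun p : R * R => Complex p.1 p.2 : C) @` (`[-r, r] `*` `[-r, r]).
  apply/seteqP; split=> [z [/= h1 h2]|z [[p q] /= [h1 h2] <-]].
    exists (Re z, Im z); last by exact: Cx_eq.
    by split; rewrite /= in_itv/= -ler_norml.
  by rewrite /= !ler_norml; move: h1 h2; rewrite /= !in_itv.
apply: continuous_compact; last by apply: compact_setX; exact: segment_compact.
apply: continuous_subspaceT => p.
by apply: (@cvgC_ReIm _ _ (nbhs p)); [exact: cvg_fst|exact: cvg_snd].
Qed.

(** Each point has a neighbourhood that meets [S] at most in the point itself. Finitely many of
    these cover a compact square containing the disc, and their centres form the list. *)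
Lemma finite_support (S : set C) (r : R) :
  (forall z, pnear z (fun x => ~ S x)) ->
  exists2 Z : seq C, uniq Z & forall a, normc a <= r -> S a -> a \in Z.
Proof.
move=> hS.
have /choice[d hd] : forall z, exists d : R, 0 < d /\
    forall x, x != z -> normc (x - z) < d -> ~ S x.
  by move=> z; have [d d0 h] := hS z; exists d.
have := square_compact r; rewrite compact_cover => cov.
have [|z _|D _ hD] := cov C setT (fun z => [set x | normc (x - z) < d z]).
- move=> z _; rewrite openE => x /= xz; apply/nbhsCP.
  exists (d z - normc (x - z)); first by rewrite subr_gt0.
  move=> y yx /=; have -> : y - z = (y - x) + (x - z) :> C by ring.
  by apply: le_lt_trans (normcD _ _) _; rewrite -ltrBrDr.
- by exists z => //=; rewrite subrr normc_zero; case: (hd z).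
exists (finmap.enum_fset D); first exact: finmap.fset_uniq.
move=> a ar Sa.
have [|z zD /= az] := hD a.
  by split; apply: le_trans ar; [exact: normc_Re|exact: normc_Im].
have [->//|anz] := eqVneq a z.
by case: ((hd z).2 a anz az Sa).
Qed.

Lemma finite_support_disc (S : set C) (r : R) :
  (forall z, pnear z (fun x => ~ S x)) ->
  exists Z : seq C, [/\ uniq Z, forall a, a \in Z -> a != 0 /\ normc a < r
    & forall a, a != 0 -> normc a < r -> S a -> a \in Z].
Proof.
move=> /(finite_support _ r)[Z uZ hZ].
exists [seq a <- Z | (a != 0) && (normc a < r)]; split.
- exact: filter_uniq.
- by move=> a; rewrite mem_filter => /andP[/andP[]].
- move=> a a0 ar Sa; rewrite mem_filter a0 ar/=; apply: hZ => //; exact: ltW.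
Qed.

Definition discrete_supp mu := forall z : C, pnear z (fun x => mu x = 0%N).

(** Stated for pairs of weights because [odd_counting] adds the counts of poles and of zeros, and
    only the pointwise sum of the two weights is controlled. *)
Lemma Ncount_add mu1 nu1 mu2 nu2 r : 0 < r ->
  discrete_supp mu1 -> discrete_supp nu1 -> discrete_supp mu2 -> discrete_supp nu2 ->
  (forall z, (mu1 z + nu1 z = mu2 z + nu2 z)%N) ->
  Ncount mu1 r + Ncount nu1 r = Ncount mu2 r + Ncount nu2 r.
Proof.
move=> r0 m1 n1 m2 n2 E.
have [Z [uZ hZ sZ]] := finite_support_disc
  [set x | ~ [/\ mu1 x = 0%N, nu1 x = 0%N, mu2 x = 0%N & nu2 x = 0%N]] r
  (fun z => pnearS _ _ _ (fun x _ h => fun k => k (let: conj a (conj b (conj c d)) := h in And4 a b c d))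
    (pnearI _ _ _ (m1 z) (pnearI _ _ _ (n1 z) (pnearI _ _ _ (m2 z) (n2 z))))).
rewrite !(Ncount_formula _ r Z)//.
- rewrite !(addrACA _ (_ * ln r)) -!mulrDl -!natrD E; congr (_ + _).
  rewrite -!big_split; apply: eq_bigr => a _.
  by rewrite /= -!mulrDl -!natrD E.
all: by move=> a a0 ar /eqP h; apply: sZ => // -[? ? ? ?].
Qed.

(** The condition on [r] makes the coefficient [ln r] of the origin nonnegative; the other
    coefficients ln (r / |a|) are positive in any case. *)
Lemma Ncount_le mu nu r : 1 <= r -> discrete_supp mu -> discrete_supp nu ->
  (forall z, (mu z <= nu z)%N) -> Ncount mu r <= Ncount nu r.
Proof.
move=> r1 hm hn le; have r0 : 0 < r by apply: lt_le_trans r1.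
have [Z [uZ hZ sZ]] := finite_support_disc [set x | ~ (mu x = 0%N /\ nu x = 0%N)] r
  (fun z => pnearS _ _ _ (fun x _ h => fun k => k h) (pnearI _ _ _ (hm z) (hn z))).
rewrite !(Ncount_formula _ r Z)//.
- apply: lerD; last by rewrite ler_wpM2r ?ln_ge0// ler_nat.
  rewrite !big_seq; apply: ler_sum => a /hZ[a0 ar].
  rewrite ler_wpM2r ?ler_nat// subr_ge0 ler_ln ?posrE ?normc_gt0//; exact: ltW.
all: by move=> a a0 ar /eqP h; apply: sZ => // -[].
Qed.

Lemma Ncount_ge0 mu r : 1 <= r -> discrete_supp mu -> 0 <= Ncount mu r.
Proof.
move=> r1 hm; have r0 : 0 < r by apply: lt_le_trans r1.
have [Z [uZ hZ sZ]] := finite_support_disc [set x | ~ (mu x = 0%N)] r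
  (fun z => pnearS _ _ _ (fun x _ h => fun k => k h) (hm z)).
rewrite (Ncount_formula _ r Z)//; last by move=> a a0 ar /eqP h; exact: sZ.
rewrite addr_ge0 ?mulr_ge0 ?ln_ge0// big_seq sumr_ge0// => a /hZ[a0 ar].
by rewrite mulr_ge0// subr_ge0 ler_ln ?posrE ?normc_gt0// ltW.
Qed.

Lemma Ncount_ge_ln mu r : 1 <= r -> discrete_supp mu -> (0 < mu 0%R)%N -> ln r <= Ncount mu r.
Proof.
move=> r1 hm m0; have r0 : 0 < r by apply: lt_le_trans r1.
have [Z [uZ hZ sZ]] := finite_support_disc [set x | ~ (mu x = 0%N)] r
  (fun z => pnearS _ _ _ (fun x _ h => fun k => k h) (hm z)).
rewrite (Ncount_formula _ r Z)//; last by move=> a a0 ar /eqP h; exact: sZ.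
apply: ler_wpDl; last by rewrite ler_peMl ?ln_ge0// ler1n.
rewrite big_seq sumr_ge0// => a /hZ[a0 ar].
by rewrite mulr_ge0// subr_ge0 ler_ln ?posrE ?normc_gt0// ltW.
Qed.

End Counting.

(** * Parity of the orders *)

Section Parity.
Context {R : realType}.
Local Notation C := (Cx R).
Implicit Types (A B f g : C -> C) (a b w x z : C) (m n : int).

Lemma merol_Gfun A B f z : merol A z -> merol B z -> merol f z -> merol (Gfun A B f) z.
Proof.
move=> mA mB mf.
have -> : Gfun A B f = (fun z => (A z + 4) * (f z * f z) + (- 4) * B z).
  by apply/funext => x; rewrite /Gfun; ring.
apply: merolD; apply: merolM; [|exact: merolM|exact: merol_cst|exact: mB].
by apply: merolD; [exact: mA|exact: merol_cst].
Qed.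

(** [A * G] is the discriminant of the equation, a quadratic in [f (z + 1)]. *)
Lemma discriminant_square A B f : solution A B f -> forall z,
  pnear z (fun x => A x * Gfun A B f x =
    (2 * f (x + 1) - (2 + A x) * f x) * (2 * f (x + 1) - (2 + A x) * f x)).
Proof.
move=> [_ /mero_eqP E] z; apply: pnearS (E z) => x _; rewrite /fdelta /Gfun => e.
(* The equation eliminates A B; what remains is a polynomial identity in A, f(z) and f(z + 1). *)
have AB : A x * B x = A x * (f x * f (x + 1)) - (f (x + 1) - f x) ^+ 2.
  by rewrite e; ring.
transitivity (A x * (A x + 4) * f x ^+ 2 - 4 * (A x * B x)); first by ring.
by rewrite AB; ring.
Qed.

Lemma odd_nat_neg m : (odd (nat_neg m) + odd (nat_neg (- m)))%N = odd `|m|.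
Proof. by case: m => -[|n] //=; rewrite ?addn0. Qed.

Lemma odd_absz_square m n k : m + n = k + k -> odd `|n| = odd `|m|.
Proof. by move=> h; lia. Qed.

Lemma odd_mults A B f z m n : solution A B f -> ordat A z m ->
  ordat (Gfun A B f) z n ->
  ((odd (pole_mult (Gfun A B f) z) : nat) +
    (odd (pole_mult (fun x => (Gfun A B f x)^-1) z) : nat) = odd `|m|)%N.
Proof.
move=> sol Am Gn; have [mf _] := sol.
rewrite (pole_mult_ordat _ _ _ Gn) (pole_mult_ordat _ _ _ (ordatV _ _ _ Gn)).
rewrite odd_nat_neg; congr nat_of_bool.
have Sq := discriminant_square _ _ _ sol z.
pose S x := 2 * f (x + 1) - (2 + A x) * f x.
have AG := ordatM _ _ _ _ _ Am Gn.
have mA : merol A z.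
  have [h [hh h0 E]] := Am; case: m Am E {AG} => k _ E.
    exists 0%N, (fun x => h x * (x - z) ^+ k); split.
      by apply: holoM; [exact: hh|exact: holoX (holo_sub z z)].
    by apply: pnearS E => x _ ->; rewrite expr0 divr1.
  by exists k.+1, h; split; [exact: hh|apply: pnearS E => x _ ->].
have mS : merol S z.
  have mfz : forall z, merol f z by exact/meroP.
  have -> : S = (fun x => 2 * f (x + 1) + (- 1) * ((2 + A x) * f x)).
    by apply/funext => x; rewrite /S; ring.
  apply: merolD; apply: merolM; [exact: merol_cst|exact: merol_shift|exact: merol_cst|].
  by apply: merolM; [apply: merolD; [exact: merol_cst|exact: mA]|exact: mfz].
(* A zero germ of the square root [S] would make the product of [A] and [Gfun A B f] vanish near
   [z], although that product has a finite order. *)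
have [S0|[k Sk]] := merol_cases S z mS.
  case: (ordat_zeroat _ _ _ AG); apply: pnearS (pnearI _ _ _ Sq S0) => x _ [-> h].
  by rewrite -/(S x) h mul0r.
apply: (@odd_absz_square _ _ k).
exact: ordat_unique (ordat_ext _ _ _ _ Sq AG) (ordatM _ _ _ _ _ Sk Sk).
Qed.

Lemma pole_mult_regular f z : regular f z -> pole_mult f z = 0%N.
Proof. by move=> /regular_ordat /pole_mult_ordat ->. Qed.

Lemma regularV f z : regular f z -> regular (fun x => (f x)^-1) z.
Proof. by move=> [hf f0]; split; [exact: holoV|rewrite invr_eq0]. Qed.

Lemma discrete_pole_mult f : (forall z, exists m, ordat f z m) -> discrete_supp (pole_mult f).
Proof.
move=> fo z; have [m fm] := fo z.
by apply: pnearS (ordat_neq0 _ _ _ fm) => x _ /pole_mult_regular.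
Qed.

Lemma odd_counting_eq A B f1 f2 r : 0 < r ->
  (forall z, exists m, ordat A z m) -> solution A B f1 -> solution A B f2 ->
  (forall z, exists m, ordat (Gfun A B f1) z m) ->
  (forall z, exists m, ordat (Gfun A B f2) z m) ->
  odd_counting (Gfun A B f1) r = odd_counting (Gfun A B f2) r.
Proof.
move=> r0 oA s1 s2 o1 o2.
have ds f : (forall z, exists m, ordat f z m) ->
    discrete_supp (fun z => odd (pole_mult f z) : nat).
  by move=> /discrete_pole_mult h z; apply: pnearS (h z) => x _ ->.
have oV f : (forall z, exists m, ordat f z m) -> forall z, exists m, ordat (fun x => (f x)^-1) z m.
  by move=> h z; have [m fm] := h z; exists (- m); exact: ordatV.
apply: Ncount_add => //; try by apply: ds => //; exact: oV.
move=> z; have [m Am] := oA z; have [n1 G1] := o1 z; have [n2 G2] := o2 z.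
by rewrite (odd_mults _ _ _ _ _ _ s1 Am G1) (odd_mults _ _ _ _ _ _ s2 Am G2).
Qed.

End Parity.

(** * Jensen's formula *)

Section Regularization.
Context {R : realType}.
Local Notation C := (Cx R).
Implicit Types (f g h q : C -> C) (a b w x z : C) (r rho t : R) (m n : int).

Lemma regularM f g z : regular f z -> regular g z -> regular (fun x => f x * g x) z.
Proof. by move=> [hf f0] [hg g0]; split; [exact: holoM|rewrite mulf_neq0]. Qed.

Lemma regularXz f z n : regular f z -> regular (fun x => f x ^ n) z.
Proof.
case: n => k [hf f0].
  by split; [exact: (holoX f z k hf)|rewrite expf_neq0].
apply: (regularV (fun x => f x ^+ k.+1)); split; [exact: holoX|by rewrite expf_neq0].
Qed.

Lemma regular_cst a z : a != 0 -> regular (fun=> a) z.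
Proof. by move=> a0; split; [exact: holo_cst|exact: a0]. Qed.

Lemma regular_prod (I : eqType) (s : seq I) (F : I -> C -> C) z :
  (forall i, i \in s -> regular (F i) z) -> regular (fun x => \prod_(i <- s) F i x) z.
Proof.
elim: s => [|i s IH] hF.
  have -> : (fun x => \prod_(i <- [::]) F i x) = (fun=> 1).
    by apply/funext => x; rewrite big_nil.
  by apply: regular_cst; exact: oner_neq0.
have -> : (fun x => \prod_(j <- i :: s) F j x) = (fun x => F i x * \prod_(j <- s) F j x).
  by apply/funext => x; rewrite big_cons.
apply: regularM; first by apply: hF; exact: mem_head.
by apply: IH => j js; apply: hF; rewrite in_cons js orbT.
Qed.

Lemma ordatXz f z m n : ordat f z m -> ordat (fun x => f x ^ n) z (m * n).
Proof.
move=> [h [hh h0 E]].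
have [hk k0] := regularXz _ _ n (conj hh h0).
exists (fun x => h x ^ n); split; [exact: hk|exact: k0|].
by apply: pnearS E => x xz ->; rewrite expfzMl exprz_exp.
Qed.

Lemma ordat_prod (I : eqType) (s : seq I) (F : I -> C -> C) (k : I -> int) z :
  (forall i, i \in s -> ordat (F i) z (k i)) ->
  ordat (fun x => \prod_(i <- s) F i x) z (\sum_(i <- s) k i).
Proof.
elim: s => [|i s IH] hF.
  have -> : (fun x => \prod_(i <- [::]) F i x) = (fun=> 1).
    by apply/funext => x; rewrite big_nil.
  by rewrite big_nil; apply/regular_ordat/regular_cst; exact: oner_neq0.
have -> : (fun x => \prod_(j <- i :: s) F j x) = (fun x => F i x * \prod_(j <- s) F j x).
  by apply/funext => x; rewrite big_cons.
rewrite big_cons; apply: ordatM; first by apply: hF; exact: mem_head.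
by apply: IH => j js; apply: hF; rewrite in_cons js orbT.
Qed.

Lemma regular_near f g z : nearC z (fun x => f x = g x) -> regular f z -> regular g z.
Proof.
move=> fg [[d d0 hd] f0]; have fgn := nearC_near _ _ fg.
have fgz : f z = g z by case: fg => e e0; apply; rewrite subrr normc_zero.
split; last by rewrite -fgz.
move: fgn => [e e0 he]; exists (Num.min d e); first by rewrite lt_min d0.
move=> x; rewrite lt_min => /andP[xd xe].
exact: cdiff_near (he x xe) (hd x xd).
Qed.

(** H z is the value at [z] of a chosen holomorphic germ representing [q] there. By continuity the
    germs chosen at neighbouring points agree, so H coincides locally with a single one of them. *)
Lemma regularize q rho : (forall z, normc z < rho -> ordat q z 0) ->
  exists H : C -> C, forall z, normc z < rho ->
    [/\ regular H z, regular q z -> H z = q z & pnear z (fun x => H x = q x)].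
Proof.
move=> oq.
have /choice[h hP] : forall z, exists h, normc z < rho ->
    [/\ holo h z, h z != 0 & pnear z (fun x => q x = h x)].
  move=> z; have [zr|zr] := ltP (normc z) rho; last by exists id.
  have [h [hh h0 E]] := oq z zr; exists h => _; split=> //.
  by apply: pnearS E => x _ ->; rewrite expr0z mulr1.
have near_rho z : normc z < rho -> nearC z (fun x => normc x < rho).
  move=> zr; exists (rho - normc z); first by rewrite subr_gt0.
  move=> x xz; have -> : x = (x - z) + z by ring.
  by apply: le_lt_trans (normcD _ _) _; rewrite -ltrBrDr.
pose H z := h z z; exists H => z zr; have [hz hz0 Ez] := hP z zr.
have HE : pnear z (fun x => H x = h z x).
  have P1 := nearC_pnear _ _ (nearC_near _ _ hz).
  have P2 := nearC_pnear _ _ (near_rho _ zr).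
  apply: pnearS (pnearI _ _ _ P1 (pnearI _ _ _ P2 (pnear_near _ _ Ez))) => x xz [hx [xr En]].
  have [hxx _ Ex] := hP x xr; rewrite /H; apply: (cont_eq_punctured (h x) (h z) x).
  - exact: holo_contat hxx.
  - exact: holo_contat hx.
  - by apply: pnearS (pnearI _ _ _ Ex (nearC_pnear _ _ En)) => y _ [<-].
split.
- apply: (@regular_near (h z)); last by split.
  have [d d0 hd] := HE; exists d => // x xd; have [->//|xz] := eqVneq x z.
  by rewrite hd.
- move=> [hq _]; rewrite /H; apply: (cont_eq_punctured (h z) q z).
  + exact: holo_contat hz.
  + exact: holo_contat hq.
  + by apply: pnearS Ez => x _ ->.
- by apply: pnearS (pnearI _ _ _ HE Ez) => x _ [-> ->].
Qed.

End Regularization.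

(** * The mean value property of the logarithm of a zero-free function *)

Section MeanValue.
Context {R : realType}.
Local Notation C := (Cx R).
Local Notation leb := (@lebesgue_measure R).
Implicit Types (f g h q H : C -> C) (a b w x z : C) (r rho t : R).

Lemma rderIm (G : R -> C) t d : rder G t d -> is_derive t 1 (fun s => Im (G s)) (Im d).
Proof.
move=> hG; have h : rder (fun s => Complex 0 (-1) * G s) t (Complex 0 (-1) * d).
  by apply: cderivZ; [exact: real_cvg|exact: hG].
have := rderRe _ _ _ h.
have E x : Re (Complex 0 (-1) * x : C) = Im x by rewrite ReM /=; ring.
rewrite E.
by have -> : (fun s => Re (Complex 0 (-1) * G s : C)) = (fun s => Im (G s)) by apply/funext => s; exact: E.
Qed.

(** The logarithmic derivative G' / G has real part (ln |G|)'. Squaring the modulus avoids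
    differentiating a square root, which explains the factor 2. *)
Lemma is_derive_lnc (G : R -> C) t d : G t != 0 -> rder G t d ->
  is_derive t 1 (fun s => ln (normc (G s) ^+ 2)) (2 * Re (d / G t)).
Proof.
move=> G0 hG; have n0 : 0 < normc (G t) ^+ 2 by rewrite exprn_gt0// normc_gt0.
have hre := rderRe _ _ _ hG; have him := rderIm _ _ _ hG.
have hv : is_derive t 1 (fun s => normc (G s) ^+ 2) (2 * (Re (G t) * Re d + Im (G t) * Im d)).
  have -> : (fun s => normc (G s) ^+ 2) = (fun s => Re (G s)) * (fun s => Re (G s)) + (fun s => Im (G s)) * (fun s => Im (G s)).
    by apply/funext => s; rewrite sqr_normcE !expr2.
  have h := is_deriveD (is_deriveM hre hre) (is_deriveM him him).
  apply: (is_derive_eq h); rewrite /GRing.scale /=; ring.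
have h := @is_derive1_comp R (@ln R) (fun s => normc (G s) ^+ 2) t _ _ (is_derive1_ln n0) hv.
apply: (is_derive_eq h).
have -> : d / G t = d * ((G t)^*%C : C) * ((normc (G t) ^+ 2)^-1)%:C.
  by rewrite fmorphV /= -mulC_conj; field; rewrite G0 -normc_eq0 normc_conj normc_eq0 G0.
rewrite ReM /= mulr0 subr0 ReM Re_conj Im_conj; ring.
Qed.

Lemma circle_pointE r t : circle_point r t = r%:C * cis t :> C.
Proof. by apply: Cx_eq; rewrite ?ReM ?ImM /=; ring. Qed.

Lemma rder_circle_point r t :
  rder (fun t => circle_point r t : C) t (Complex 0 1 * (circle_point r t : C)).
Proof.
have h : rder (fun t => r%:C * cis t) t (r%:C * (Complex 0 1 * cis t)).
  by apply: cderivZ; [exact: real_cvg|exact: rder_cis].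
have -> : Complex 0 1 * (circle_point r t : C) = r%:C * (Complex 0 1 * cis t).
  by rewrite circle_pointE; ring.
have -> // : (fun t => circle_point r t : C) = (fun t => r%:C * cis t).
by apply/funext => s; exact: circle_pointE.
Qed.

Lemma normc_circle_point r t : 0 <= r -> normc (circle_point r t : C) = r.
Proof. by move=> r0; rewrite circle_pointE normcZ normc_cis mulr1 normc_real ger0_norm. Qed.

Lemma two_pi_gt0 : 0 < 2 * pi :> R.
Proof. by rewrite mulr_gt0// pi_gt0. Qed.

(** A primitive Q of H' / H with Q 0 = 0 gives ln |H| = ln |H 0| + Re Q. Writing Q = z K and letting
    P be a primitive of K, the derivative of P along the circle is i z K = i Q, so Im P is an
    antiderivative of Re Q in the angle; it takes the same value at 0 and 2 pi. *)
Lemma mean_ln_regular H r rho : 0 < r < rho ->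
  (forall z, normc z < rho -> regular H z) ->
  \int[leb]_(t in `[0, 2 * pi]) ln (normc (H (circle_point r t))) = 2 * pi * ln (normc (H 0)).
Proof.
move=> /andP[r0 rrho] rH; have rho0 : 0 < rho by exact: lt_trans rrho.
have toz z : normc (z - 0) < rho -> normc z < rho by rewrite subr0.
have dH z : normc (z - 0) < rho -> cdifferentiable H z.
  by move=> /toz/rH[[d d0 h] _]; apply: h; rewrite subrr normc_zero.
have H0 z : normc (z - 0) < rho -> H z != 0 by move=> /toz/rH[].
have dL z : normc (z - 0) < rho -> cdifferentiable (fun z => cder H z * (H z)^-1) z.
  move=> zr; apply: cdiffM; first exact: (cdiff_cder _ _ _ dH z zr).
  by apply: cdiffV; [exact: H0|exact: dH].
have z00 : normc ((0 : C) - 0) < rho by rewrite subrr normc_zero.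
have [Q0 hQ0] : exists F, forall z, normc (z - 0) < rho -> hder F z (cder H z * (H z)^-1).
  apply: (@disc_prim _ 0 rho 0) => [//|z zr|z zr _]; first exact/cdiff_contat/dL.
  exact: dL.
pose Q z := Q0 z - Q0 0.
have hQ z : normc (z - 0) < rho -> hder Q z (cder H z * (H z)^-1).
  by move=> zr; rewrite -[X in hder _ _ X]subr0; apply: hderB; [exact: hQ0|exact: hder_cst].
have lnE z : normc (z - 0) < rho -> ln (normc (H z)) = ln (normc (H 0)) + Re (Q z).
  move=> zr; have inr s : 0 <= s <= 1 -> normc (pt 0 z s - 0) < rho.
    by move=> s01; exact: pt_dist_lt.
  (* This function has derivative zero along the radius to [z]; comparing its ends gives the
     formula. *)
  pose u s := ln (normc (H (pt 0 z s)) ^+ 2) - 2 * Re (Q (pt 0 z s)).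
  have du (s : R) : 0 <= s <= 1 -> is_derive s 1 u 0.
    move=> s01; have h1 := rder_pt _ _ _ _ _ (cderP _ _ (dH _ (inr s s01))).
    have h2 := rder_pt _ _ _ _ _ (hQ _ (inr s s01)).
    have d1 := is_derive_lnc _ _ _ (H0 _ (inr s s01)) h1.
    have d2 := rderRe _ _ _ h2.
    have h := is_deriveB d1 (is_deriveZ 2 d2).
    apply: (is_derive_eq h); rewrite /GRing.scale /= mulrAC subrr.
    by [].
  have hc : {within `[0, 1], continuous u}.
    apply: derivable_within_continuous => s; rewrite in_itv/= => s01.
    by have [] := du s s01.
  have du' (s : R) : s \in `]0, 1[ -> is_derive s 1 u ((fun=> 0) s).
    by move=> /subset_itv_oo_cc; rewrite /= in_itv/= => s01; exact: du.
  have [c _] := MVT ltr01 du' hc.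
  rewrite /u pt0 pt1 mul0r /Q subrr /= mulr0 subr0.
  rewrite !lnXn ?normc_gt0 ?H0// => /eqP; rewrite subr_eq0 => /eqP.
  rewrite !mulr2n; lra.
have [K dK QK] : exists2 K : C -> C, forall x, normc (x - 0) < rho -> cdifferentiable K x
    & forall x, Q x = Q 0 + (x - 0) * K x.
  apply: cdiff_quot; first exact: rho0.
  by move=> x xr; eexists; exact: hQ xr.
have [P hP] : exists F, forall z, normc (z - 0) < rho -> hder F z (K z).
  apply: (@disc_prim _ 0 rho 0) => [//|z zr|z zr _]; first exact/cdiff_contat/dK.
  exact: dK.
have incirc t : normc ((circle_point r t : C) - 0) < rho.
  by rewrite subr0 normc_circle_point// ltW.
pose c := ln (normc (H 0)).
pose W t := c * t + Im (P (circle_point r t)).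
have dW t : is_derive t 1 W (ln (normc (H (circle_point r t)))).
  have h1 : rder (fun t => P (circle_point r t)) t (K (circle_point r t) * (Complex 0 1 * (circle_point r t : C))).
    by apply: cderiv_comp; [exact: real_cvg|exact: hP|exact: rder_circle_point].
  have h2 := rderIm _ _ _ h1.
  have h3 : is_derive t 1 (fun t => c * t) c.
    have h := is_deriveZ c (is_derive_id t 1).
    by apply: (is_derive_eq h); rewrite /GRing.scale /= mulr1.
  have h := is_deriveD h3 h2.
  apply: (is_derive_eq h); rewrite lnE// -/c; congr (_ + _).
  rewrite QK /Q !subrr subr0 add0r mulrCA [Complex 0 1 * _]mulrC ImM /=.
  by rewrite mulr1 mulr0 addr0; congr (Re _); ring.
have cont t : {for t, continuous (fun t => ln (normc (H (circle_point r t))))}.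
  apply: (@cvg_comp _ _ _ (fun t => normc (H (circle_point r t))) (@ln R) (nbhs t) (nbhs (normc (H (circle_point r t))))).
    apply: cvgC_normc.
    apply: (@cvg_comp _ _ _ (fun t => circle_point r t : C) H (nbhs t) (nbhs (circle_point r t : C))).
      by apply: cderiv_cvg (rder_circle_point r t); exact: real_cvg.
    by apply/cdiff_contat/dH.
  by apply: continuous_ln; rewrite normc_gt0 H0.
rewrite /Rintegral (@continuous_FTC2 R _ W 0 (2 * pi) two_pi_gt0).
- rewrite /W /= /circle_point !mulr_natl cos2pi sin2pi cos0 sin0 !mulr0 add0r.
  by rewrite addrK mulrC.
- by apply: continuous_in_subspaceT => t _; exact: cont.
- have dWc t : {for t, continuous W}.
    by apply: differentiable_continuous; apply/derivable1_diffP; have [] := dW t.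
  split; first by move=> t _; have [] := dW t.
    by apply: cvg_at_right_filter; exact: dWc.
  by apply: cvg_at_left_filter; exact: dWc.
- by move=> t _; rewrite derive1E (@derive_val _ _ _ _ _ _ _ (dW t)).
Qed.

End MeanValue.

Section Jensen.
Context {R : realType}.
Local Notation C := (Cx R).
Local Notation leb := (@lebesgue_measure R).
Implicit Types (f g h q H : C -> C) (a b w x z : C) (r rho t : R) (m n : int).

(** Finitely many conditions that persist when the radius shrinks are met by one radius beyond r. *)
Lemma common_radius (Z : seq C) (Q : C -> R -> Prop) r :
  (forall a rho rho', Q a rho -> rho' <= rho -> Q a rho') ->
  (forall a, a \in Z -> exists2 rho, r < rho & Q a rho) ->
  exists2 rho, r < rho & forall a, a \in Z -> Q a rho.
Proof.
move=> mono; elim: Z => [|a Z IH] hZ; first by exists (r + 1); rewrite ?ltrDl.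
have [|rho1 r1 h1] := IH; first by move=> b bZ; apply: hZ; rewrite in_cons bZ orbT.
have [rho2 r2 h2] := hZ a (mem_head _ _).
exists (Num.min rho1 rho2); first by rewrite lt_min r1.
move=> b; rewrite in_cons => /orP[/eqP ->|/h1 bQ].
  by apply: mono h2 _; rewrite ge_min lexx orbT.
by apply: mono bQ _; rewrite ge_min lexx.
Qed.

(** The Blaschke factor of the disc of radius [r] with zero [a]. *)
Definition bl r a x : C := r%:C * (x - a) * ((r ^+ 2)%:C - (a^*%C : C) * x)^-1.

Section Blaschke.
Context {r rho : R} {a : C}.
Hypotheses (r0 : 0 < r) (arho : normc a * rho < r ^+ 2).

(** For a != 0 the pole of the factor is the reflection r ^ 2 / conj(a) of [a] in the circle; [arho]
    keeps it outside the disc of radius rho. *)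
Lemma bl_den x : normc x < rho -> (r ^+ 2)%:C - (a^*%C : C) * x != 0.
Proof.
move=> xr; rewrite -normc_gt0; apply: lt_le_trans (normcB _ _).
rewrite normcZ normc_conj normc_real ger0_norm ?exprn_ge0 ?ltW// subr_gt0.
by apply: le_lt_trans arho; rewrite ler_wpM2l ?normc_ge0// ltW.
Qed.

Lemma regular_bl_den x : normc x < rho ->
  regular (fun x => ((r ^+ 2)%:C - (a^*%C : C) * x)^-1) x.
Proof.
move=> xr; apply: regularV; split; last exact: bl_den.
have -> : (fun x => (r ^+ 2)%:C - (a^*%C : C) * x) =
    (fun x => (r ^+ 2)%:C + (- (a^*%C : C)) * (x - 0)).
  by apply/funext => y; ring.
by apply: holoD; [exact: holo_cst|apply: holoM; [exact: holo_cst|exact: holo_sub]].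
Qed.

Let rC0 : r%:C != 0 :> C.
Proof. by rewrite -normc_eq0 normc_real normr_eq0 gt_eqF. Qed.

Lemma ordat_bl x : normc x < rho -> ordat (bl r a) x (x == a)%:Z.
Proof.
move=> xr; rewrite -[(x == a)%:Z]add0r -[0 + _]addr0.
apply: ordatM; last exact/regular_ordat/regular_bl_den.
by apply: ordatM; [exact/regular_ordat/regular_cst|exact: ordat_sub].
Qed.

Lemma regular_bl x : normc x < rho -> x != a -> regular (bl r a) x.
Proof.
move=> xr xa; apply: regularM; last exact: regular_bl_den.
by apply: regularM; [exact: regular_cst|split; [exact: holo_sub|rewrite subr_eq0]].
Qed.

(** On the circle r ^ 2 = x conj(x), so the denominator is x conj(x - a). *)
Lemma normc_bl_circle x : normc x = r -> x != a -> normc (bl r a x) = 1.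
Proof.
move=> xr xa; have -> : bl r a x = r%:C * (x - a) / (x * (((x - a)^*)%C : C)).
  by rewrite /bl -xr -mulC_conj conjCB; congr (_ / _); ring.
rewrite !normcZ normcI normcZ normc_conj normc_real gtr0_norm// xr mulfV//.
by rewrite mulf_neq0 ?normc_eq0 ?subr_eq0// gt_eqF.
Qed.

End Blaschke.

Lemma ln_expz (x : R) n : 0 < x -> ln (x ^ n) = n%:~R * ln x.
Proof.
move=> x0; case: n => n; first by rewrite -exprnP lnXn// mulr_natl.
by rewrite NegzE -invr_expz lnV ?posrE ?exprz_gt0// -exprnP lnXn// mulrNz mulNr mulr_natl.
Qed.

Lemma ln_prod (I : eqType) (s : seq I) (F : I -> R) : (forall i, i \in s -> 0 < F i) ->
  0 < \prod_(i <- s) F i /\ ln (\prod_(i <- s) F i) = \sum_(i <- s) ln (F i).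
Proof.
elim: s => [|i s IH] hF; first by rewrite !big_nil ln1.
have [|p1 p2] := IH; first by move=> j js; apply: hF; rewrite in_cons js orbT.
have p3 := hF i (mem_head _ _).
by rewrite !big_cons lnM ?posrE// p2 mulr_gt0.
Qed.

Lemma normc_prod (I : Type) (s : seq I) (F : I -> C) :
  normc (\prod_(i <- s) F i) = \prod_(i <- s) normc (F i).
Proof.
elim: s => [|i s IH]; first by rewrite !big_nil normc_one.
by rewrite !big_cons normcZ IH.
Qed.

Lemma sum_delta (s : seq C) (F : C -> int) z : uniq s ->
  \sum_(a <- s) (z == a)%:Z * F a = if z \in s then F z else 0.
Proof.
elim: s => [|a s IH]; first by rewrite big_nil.
rewrite /= => /andP[as_ us]; rewrite big_cons IH// in_cons.
case: eqVneq => [->|za]; first by rewrite (negbTE as_) addr0 mul1r.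
by rewrite mul0r add0r.
Qed.

Lemma nat_neg_sub m : ((nat_neg (- m))%:R - (nat_neg m)%:R : R) = m%:~R.
Proof. by case: m => -[|n] /=; rewrite ?subr0 ?sub0r ?NegzE ?mulrNz. Qed.

(** The constant is ln |h0 0|, the logarithm of the modulus of the leading coefficient at the
    origin, and does not depend on r. The mean value property is applied to [g] times powers of
    Blaschke factors, made holomorphic and zero-free past the circle; evaluating it at 0 produces
    the sums of ln (r / |a|). *)
Lemma jensen g : (forall z, exists m, ordat g z m) -> exists K : R,
  forall r, 0 < r -> (forall z, normc z = r -> regular g z) ->
  \int[leb]_(t in `[0, 2 * pi]) ln (normc (g (circle_point r t))) =
  2 * pi * (K + pole_counting (fun x => (g x)^-1) r - pole_counting g r).
Proof.
move=> og; have /choice[m hm] := og.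
have [h0 [hh0 h00 Eh0]] := hm 0.
exists (ln (normc (h0 0))) => r r0 good.
have disc z : pnear z (fun x => ~ ~ regular g x).
  by apply: pnearS (ordat_neq0 _ _ _ (hm z)) => x _ h; apply.
have [Z0 uZ0 hZ0] := finite_support (fun x => ~ regular g x) (r + 1) disc.
pose Z : seq C := [seq a <- Z0 | (a != 0) && (normc a < r)].
have uZ : uniq (0 :: Z) by rewrite /= mem_filter eqxx/= filter_uniq.
have hZ a : a \in Z -> a != 0 /\ normc a < r.
  by rewrite mem_filter => /andP[/andP[]].
have hZ' a : a \in 0 :: Z -> normc a < r.
  by rewrite in_cons => /orP[/eqP ->|/hZ[]//]; rewrite normc_zero.
(* The circle itself carries no point where [g] fails to be regular, and only finitely many lie
   between the radii r and r + 1; so none occurs in a thin annulus beyond the circle. *)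
have [rho1 r1 hr1] : exists2 rho, r < rho & forall a, a \in Z0 ->
    regular g a \/ normc a < r \/ rho <= normc a.
  apply: common_radius => [a x y [h|[h|h]] yx|a aZ]; [by left|by right; left| |].
    by right; right; exact: le_trans h.
  have [ar|ra|ar] := ltgtP (normc a) r.
  - by exists (r + 1); [rewrite ltrDl|right; left].
  - by exists (normc a); [|right; right].
  - by exists (r + 1); [rewrite ltrDl|left; exact: good].
have [rho2 r2 hr2] : exists2 rho, r < rho & forall a, a \in 0 :: Z -> normc a * rho < r ^+ 2.
  apply: common_radius => [a x y h yx|a /hZ' ar].
    by apply: le_lt_trans h; rewrite ler_wpM2l ?normc_ge0.
  have ar0 : 0 < normc a + r by rewrite ltr_wpDl// normc_ge0.
  have na := normc_ge0 a.
  (* Again the harmonic mean of r and r ^ 2 / |a|, lying before the reflected pole of the Blaschke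
     factor. *)
  exists (2 * r ^+ 2 / (normc a + r)).
    have : r * normc a < r * r by rewrite ltr_pM2l.
    by rewrite ltr_pdivlMr// expr2; lra.
  have : r ^+ 2 * normc a < r ^+ 2 * r by rewrite ltr_pM2l ?exprn_gt0.
  by rewrite mulrA ltr_pdivrMr//; lra.
pose rho := Num.min (r + 1) (Num.min rho1 rho2).
have rrho : r < rho by rewrite !lt_min ltrDl ltr01 r1.
have rhor : rho <= r + 1 by rewrite ge_min lexx.
have rho_1 : rho <= rho1 by rewrite !ge_min lexx orbT.
have rho_2 a : a \in 0 :: Z -> normc a * rho < r ^+ 2.
  move=> /hr2; apply: le_lt_trans; rewrite ler_wpM2l ?normc_ge0//.
  by rewrite !ge_min lexx !orbT.
have reg z : normc z < rho -> z \notin 0 :: Z -> regular g z.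
  move=> zr zZ; have [//|nreg] := pselect (regular g z).
  have zZ0 : z \in Z0 by apply: hZ0 => //; apply: ltW; exact: lt_le_trans rhor.
  have [//|[h|h]] := hr1 z zZ0; last first.
    by have := lt_le_trans zr (le_trans rho_1 h); rewrite ltxx.
  by move: zZ; rewrite in_cons negb_or mem_filter h zZ0 !andbT negbK => /andP[/negP].
(* The order of the product at each point of [0 :: Z] cancels that of [g], and all factors have
   modulus one on the circle. *)
pose q x := g x * \prod_(a <- 0 :: Z) bl r a x ^ (- m a).
have oq z : normc z < rho -> ordat q z 0.
  move=> zr; have -> : 0 = m z + \sum_(a <- (0 : C) :: Z) ((z == a)%:Z * (- m a)).
    rewrite sum_delta//; case: ifPn => [_|zZ]; first by rewrite subrr.
    by rewrite addr0 (ordat_unique _ _ _ _ (hm z) (regular_ordat _ _ (reg z zr zZ))).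
  apply: ordatM (hm z) _; apply: ordat_prod => a aZ; apply: ordatXz.
  exact: (ordat_bl r0 (rho_2 a aZ)).
have [H hH] := regularize q rho oq.
have nea a z : a \in 0 :: Z -> normc z = r -> z != a.
  by move=> /hZ' ar zr; apply/eqP => za; move: ar; rewrite -za zr ltxx.
have Hcirc z : normc z = r -> normc (H z) = normc (g z).
  move=> zr; have zrho : normc z < rho by rewrite zr.
  have [_ Hq _] := hH z zrho; rewrite Hq; last first.
    apply: regularM; first exact: good.
    apply: regular_prod => a aZ; apply: regularXz.
    by apply: (regular_bl r0 (rho_2 a aZ)) => //; exact: nea.
  rewrite /q normcZ normc_prod big_seq big1 ?mulr1// => a aZ.
  rewrite normcXz normc_bl_circle//; first by rewrite exp1rz.
  exact: nea.
have -> : \int[leb]_(t in `[0, 2 * pi]) ln (normc (g (circle_point r t))) =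
   \int[leb]_(t in `[0, 2 * pi]) ln (normc (H (circle_point r t))).
  apply: eq_Rintegral => t _; rewrite Hcirc//.
  by apply: normc_circle_point; exact: ltW.
rewrite (mean_ln_regular _ _ rho).
- congr (_ * _).
  (* The expression of [q] near 0 after cancellation: the factor with a = 0 is x / r, so its power
     removes x ^ m 0 and leaves r ^ m 0, the source of the terms in ln r. *)
  pose k x := h0 x * (r%:C : C) ^ (m 0) * \prod_(a <- Z) bl r a x ^ (- m a).
  have z0rho : normc (0 : C) < rho by rewrite normc_zero (lt_trans r0).
  have rC0 : r%:C != 0 :> C by rewrite -normc_eq0 normc_real normr_eq0 gt_eqF.
  have regk : regular k 0.
    apply: regularM.
      apply: regularM; first by split.
      by apply: regular_cst; rewrite expfz_neq0.
    apply: regular_prod => a aZ; apply: regularXz.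
    apply: (@regular_bl r rho) => //; first by apply: rho_2; rewrite in_cons aZ orbT.
    by have [a0 _] := hZ a aZ; rewrite eq_sym.
  have [[holH _] _ EH] := hH 0 z0rho.
  have -> : H 0 = k 0.
    apply: (cont_eq_punctured H k 0); first exact: holo_contat holH.
      exact: holo_contat regk.1.
    apply: pnearS (pnearI _ _ _ EH Eh0) => x x0 [-> E].
    rewrite /q E big_cons /k -!mulrA; congr (_ * _).
    rewrite mulrA; congr (_ * _).
    have -> : bl r 0 x = x / r%:C.
      by rewrite /bl conjc0 mul0r !subr0 rmorphXn /=; field.
    have y0 : x / r%:C != 0 by rewrite mulf_neq0 ?invr_neq0.
    by rewrite subr0 -{1}(divfK rC0 x) expfzMl mulrAC -expfzDr// subrr expr0z mul1r.
  have bl0 a : a \in Z -> normc (bl r a 0) = normc a / r.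
    move=> aZ; rewrite /bl mulr0 subr0 sub0r !normcZ normcI normc_opp !normc_real.
    by rewrite !gtr0_norm ?exprn_gt0//; field; rewrite gt_eqF.
  have pos a : a \in Z -> 0 < (normc a / r) ^ (- m a).
    by move=> /hZ[a0 _]; rewrite exprz_gt0// divr_gt0// normc_gt0.
  have [pp lp] := ln_prod _ _ _ pos.
  have -> : normc (k 0) = normc (h0 0) * r ^ (m 0) * \prod_(a <- Z) (normc a / r) ^ (- m a).
    rewrite /k !normcZ normcXz normc_real gtr0_norm// normc_prod; congr (_ * _).
    by apply: eq_big_seq => a aZ; rewrite normcXz bl0.
  have n0 : 0 < normc (h0 0) by rewrite normc_gt0.
  have rm : 0 < r ^ m 0 by rewrite exprz_gt0.
  rewrite lnM ?posrE ?mulr_gt0// lnM ?posrE// lp ln_expz//.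
  have sup mu : (forall a, regular g a -> mu a = 0%N) -> forall a, a != 0 -> normc a < r -> mu a != 0%N -> a \in Z.
    move=> hmu a a0 ar ma; have [//|aZ] := boolP (a \in Z).
    case/negP: ma; apply/eqP/hmu/reg; first exact: lt_trans rrho.
    by rewrite in_cons negb_or a0.
  have uZ' : uniq Z by case/andP: uZ.
  rewrite /pole_counting (Ncount_formula _ r Z r0 uZ' hZ); last first.
    by apply: sup => a /regularV /pole_mult_regular.
  rewrite (Ncount_formula _ r Z r0 uZ' hZ); last first.
    by apply: sup => a /pole_mult_regular.
  have pm a : (pole_mult (fun x => (g x)^-1) a)%:R - (pole_mult g a)%:R = (m a)%:~R :> R.
    by rewrite (pole_mult_ordat _ _ _ (hm a)) (pole_mult_ordat _ _ _ (ordatV _ _ _ (hm a))) nat_neg_sub.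
  rewrite -pm; set s1 := (X in _ + X = _); set s2 := (X in _ = _ + (X + _) - _); set s3 := (X in _ = _ - (X + _)).
  have -> : s1 = s2 - s3.
    rewrite /s1 /s2 /s3 -sumrB; apply: eq_big_seq => a aZ; have [a0 _] := hZ a aZ.
    rewrite ln_expz ?divr_gt0 ?normc_gt0// lnM ?posrE ?invr_gt0 ?normc_gt0// lnV ?posrE//.
    by rewrite -mulrBl pm mulrNz; ring.
  by ring.
- by rewrite r0.
- by move=> z zr; have [] := hH z zr.
Qed.

End Jensen.

(** * Exceptional sets *)

Section Exceptional.
Context {R : realType}.
Local Notation C := (Cx R).
Local Notation leb := (@lebesgue_measure R).
Implicit Types (E Bad : set R).

(** Otherwise a half-line would be covered by E1, E2 and a null set, although its logarithmic
    measure is infinite. *)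
Lemma large_outside E1 E2 Bad (M : R) :
  finite_log_measure E1 -> finite_log_measure E2 -> countable Bad ->
  exists r, [/\ M < r, ~ E1 r, ~ E2 r & ~ Bad r].
Proof.
move=> [mE1 E11 I1] [mE2 E21 I2] cB; apply: contrapT => no.
have hno r : M < r -> E1 r \/ E2 r \/ Bad r.
  move=> Mr; have [|n1] := pselect (E1 r); first by left.
  have [|n2] := pselect (E2 r); first by right; left.
  have [|n3] := pselect (Bad r); first by right; right.
  by case: no; exists r.
pose g : R -> \bar R := EFin \o (fun t : R => t^-1).
have mgR (A : set R) : measurable A -> A `<=` [set t | 0 < t] ->
    measurable_fun A (fun t : R => t^-1).
  move=> mA A0.
  have m0 : measurable_fun ([set` `]0, +oo[] : set R) (fun t : R => t^-1).
    apply: open_continuous_measurable_fun; first exact: interval_open.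
    move=> t; rewrite inE/= in_itv/= andbT => t0.
    by apply: (@cvgV _ _ (nbhs t)); [rewrite gt_eqF|by move=> ?].
  apply: measurable_funS m0 => //.
  by move=> t /A0; rewrite /= in_itv/= andbT.
have E1pos : E1 `<=` [set t | 0 < t].
  by move=> t /E11; rewrite /= in_itv/= andbT; exact: lt_le_trans.
have E2pos : E2 `<=` [set t | 0 < t].
  by move=> t /E21; rewrite /= in_itv/= andbT; exact: lt_le_trans.
have g0 (A : set R) : A `<=` [set t | 0 < t] -> forall t, A t -> (0 <= g t)%E.
  by move=> A0 t /A0 t0; rewrite lee_fin invr_ge0 ltW.
have fin (A : set R) : A `<=` [set t | 0 < t] -> ((\int[leb]_(t in A) g t)%E < +oo)%E ->
    exists x : R, (\int[leb]_(t in A) g t)%E = x%:E.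
  move=> A0 h; exists (fine ((\int[leb]_(t in A) g t)%E)); rewrite fineK// ge0_fin_numE//.
  by apply: integral_ge0; exact: g0.
have [x1 e1] := fin _ E1pos I1; have [x2 e2] := fin _ E2pos I2.
pose a := Num.max M 1.
have a0 : 0 < a by rewrite lt_max ltr01 orbT.
(* The interval from a to b has logarithmic measure |x1| + |x2| + 1, which exceeds the total x1 + x2
   of the two exceptional sets. *)
pose b := a * expR (`|x1| + `|x2| + 1).
have b0 : 0 < b by rewrite mulr_gt0// expR_gt0.
have lnb : ln b - ln a = `|x1| + `|x2| + 1.
  by rewrite lnM ?posrE ?expR_gt0// expRK; ring.
have ab : a < b by rewrite -ltr_ln ?posrE// -subr_gt0 lnb ltr_wpDl// addr_ge0.
pose D := [set` `]a, b[] : set R.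
have mD : measurable D by exact: measurable_itv.
have Dpos : D `<=` [set t | 0 < t].
  by move=> t; rewrite /D/= in_itv/= => /andP[h _]; exact: lt_trans h.
have ID : (\int[leb]_(t in D) g t)%E = (`|x1| + `|x2| + 1)%:E.
  rewrite -lnb -(inv_integral _ _ a0 ab) /Rintegral fineK//.
  apply: integrable_fin_num => //.
  by apply: integrableS (inv_integrable a b a0) => //; exact: subset_itv_oo_cc.
(* A disjoint measurable decomposition; X3 is built from D, E1 and E2 alone, so it is measurable,
   and it is null as a subset of [Bad]. *)
pose X1 := D `&` E1; pose X2 := (D `&` E2) `\` E1; pose X3 := D `\` (E1 `|` E2).
have mX1 : measurable X1 by exact: measurableI.
have mX2 : measurable X2 by apply: measurableD => //; exact: measurableI.
have mX3 : measurable X3 by apply: measurableD => //; exact: measurableU.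
have X1D : X1 `<=` [set t | 0 < t] by move=> t [/Dpos].
have X2D : X2 `<=` [set t | 0 < t] by move=> t [[/Dpos]].
have X3D : X3 `<=` [set t | 0 < t] by move=> t [/Dpos].
have DX : D = X1 `|` (X2 `|` X3).
  apply/seteqP; split=> t.
    move=> Dt; have [h1|h1] := pselect (E1 t); first by left.
    have [h2|h2] := pselect (E2 t); first by right; left.
    by right; right; split=> // -[].
  by move=> [[]//|[[[]//]|[]//]].
have X3B : X3 `<=` Bad.
  move=> t [Dt nE]; have Mt : M < t.
    move: Dt; rewrite /D/= in_itv/= => /andP[h _].
    by apply: le_lt_trans h; rewrite le_max lexx.
  by have [h|[h|//]] := hno t Mt; case: nE; [left|right].
have lX3 : leb X3 = 0%E.
  by apply: countable_lebesgue_measure0; apply: sub_countable cB; exact: subset_card_le.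
have i3 : (\int[leb]_(t in X3) g t)%E = 0%E by apply: null_set_integral => //; apply/measurable_EFinP; exact: mgR.
have i1 : ((\int[leb]_(t in X1) g t)%E <= x1%:E)%E.
  by rewrite -e1; apply: ge0_subset_integral => //; [by apply/measurable_EFinP; exact: mgR|exact: g0|move=> t []].
have i2 : ((\int[leb]_(t in X2) g t)%E <= x2%:E)%E.
  by rewrite -e2; apply: ge0_subset_integral => //; [by apply/measurable_EFinP; exact: mgR|exact: g0|move=> t [[]]].
have : ((\int[leb]_(t in D) g t)%E <= x1%:E + x2%:E)%E.
  rewrite {1}DX ge0_integral_setU//; [|exact: measurableU| | |].
  - apply: leeD => //; rewrite ge0_integral_setU//; [by rewrite i3 adde0| | |].
    + by apply/measurable_EFinP; apply: mgR; [exact: measurableU|move=> t [/X2D|/X3D]].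
    + by apply: g0 => t [/X2D|/X3D].
    + apply/disj_set2P/seteqP; split=> // t [[[_ h2] _] [_ nE]].
      by apply: nE; right.
  - by rewrite -DX; apply/measurable_EFinP; exact: mgR.
  - by rewrite -DX; exact: g0.
  - apply/disj_set2P/seteqP; split=> // t [[_ h1] [[_ n1]|[_ nE]]] //.
    by apply: nE; left.
rewrite ID -EFinD lee_fin; have := ler_norm x1; have := ler_norm x2; lra.
Qed.

Lemma infty_outsideP E (P : set R) : infty_outside E P ->
  exists M : R, forall r, M < r -> ~ E r -> P r.
Proof. by move=> [M [_ h]]; exists M => r Mr nE; exact: h. Qed.

(** The discs of integer radius exhaust the plane and each contains finitely many points of [S]. *)
Lemma bad_radii_countable (S : set C) : (forall z, pnear z (fun x => ~ S x)) ->
  countable [set r : R | exists2 z, S z & normc z = r].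
Proof.
move=> hS.
have /choice[Z hZ] : forall n : nat, exists Z : seq C, forall a, normc a <= n%:R -> S a -> a \in Z.
  by move=> n; have [Z _ h] := finite_support S n%:R hS; exists Z.
apply: (@sub_countable _ _ _ (\bigcup_n [set` map (@Normc.normc R) (Z n)])); last first.
  by apply: bigcup_countable => // n _; apply: finite_set_countable; exact: finite_seq.
apply: subset_card_le => r [z Sz zr].
exists (Num.bound (normc z)) => //=; rewrite -zr; apply: map_f; apply: hZ => //.
exact/ltW/archi_boundP/normc_ge0.
Qed.

End Exceptional.

(** * Characteristics *)

Section Proximity.
Context {R : realType}.
Local Notation C := (Cx R).
Local Notation leb := (@lebesgue_measure R).
Implicit Types (f g h : C -> C) (a b w x z c : C) (r t : R) (u v : R -> R) (m n : int).

Definition rcont u := forall t, {for t, continuous u}.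
Definition mean u : R := (2 * pi)^-1 * \int[leb]_(t in `[0, 2 * pi]) u t.

Lemma rcont_integrable u : rcont u -> leb.-integrable `[0, 2 * pi] (EFin \o u).
Proof.
move=> cu; apply: continuous_compact_integrable; first exact: segment_compact.
by apply: continuous_in_subspaceT => t _; exact: cu.
Qed.

Let pi2 : 0 < (2 * pi)^-1 :> R.
Proof. by rewrite invr_gt0 two_pi_gt0. Qed.

Lemma mean_le u v : rcont u -> rcont v -> (forall t, u t <= v t) -> mean u <= mean v.
Proof.
move=> cu cv uv; rewrite ler_pM2l//; apply: le_Rintegral => //; exact: rcont_integrable.
Qed.

Lemma meanD u v : rcont u -> rcont v -> mean (fun t => u t + v t) = mean u + mean v.
Proof. 
move=> cu cv; rewrite /mean -mulrDr RintegralD//; exact: rcont_integrable.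
 Qed.

Lemma meanB u v : rcont u -> rcont v -> mean (fun t => u t - v t) = mean u - mean v.
Proof. by move=> cu cv; rewrite /mean RintegralB ?mulrBr//; exact: rcont_integrable. Qed.

Lemma mean_cst (k : R) : mean (fun=> k) = k.
Proof.
rewrite /mean Rintegral_cst//; set X := fine _.
have -> : X = 2 * pi.
  transitivity (fine (2 * pi : R)%:E); last by [].
  congr fine; have := @lebesgue_measure_itv R `[0, 2 * pi].
  by rewrite /= lte_fin two_pi_gt0 -EFinD oppr0 addr0.
by rewrite mulrC mulfK// gt_eqF// two_pi_gt0.
Qed.

Lemma rcontD u v : rcont u -> rcont v -> rcont (fun t => u t + v t).
Proof. by move=> cu cv t; apply: (@cvgD _ _ _ (nbhs t)); [exact: cu|exact: cv]. Qed.

Lemma rcont_cst (k : R) : rcont (fun=> k).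
Proof. by move=> t; exact: cvg_cst. Qed.

(** In this form the function is visibly continuous at 0 as well, and its inequalities reduce to
    inequalities between products. *)
Lemma log_plusE (x : R) : 0 <= x -> log_plus x = ln (Num.max 1 x).
Proof.
move=> x0; rewrite /log_plus; have [x1|x1] := leP x 1.
  by rewrite ln1 max_l//; exact: ln_le0.
by rewrite max_r// ln_ge0// ltW.
Qed.

Lemma log_plus_ge0 (x : R) : 0 <= log_plus x.
Proof. by rewrite /log_plus le_max lexx. Qed.

Lemma max1_gt0 (x : R) : 0 < Num.max 1 x.
Proof. by rewrite lt_max ltr01. Qed.

Lemma log_plus_le (x y : R) : 0 <= x -> x <= y -> log_plus x <= log_plus y.
Proof.
move=> x0 xy; have y0 := le_trans x0 xy; rewrite !log_plusE//.
by rewrite ler_ln ?posrE ?max1_gt0// ge_max le_max lexx le_max xy orbT.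
Qed.

Lemma log_plusM (x y : R) : 0 <= x -> 0 <= y -> log_plus (x * y) <= log_plus x + log_plus y.
Proof.
move=> x0 y0; rewrite !log_plusE ?mulr_ge0// -lnM ?posrE ?max1_gt0//.
have h1 (k : R) : 1 <= Num.max 1 k by rewrite le_max lexx.
rewrite ler_ln ?posrE ?mulr_gt0 ?max1_gt0// ge_max; apply/andP; split.
  by have := h1 x; have := h1 y; nra.
by apply: ler_pM => //; rewrite le_max lexx orbT.
Qed.

Lemma log_plusD (x y : R) : 0 <= x -> 0 <= y ->
  log_plus (x + y) <= log_plus x + log_plus y + ln 2.
Proof.
move=> x0 y0; rewrite !log_plusE ?addr_ge0// -!lnM ?posrE ?mulr_gt0 ?max1_gt0//.
have h1 (k : R) : 1 <= Num.max 1 k by rewrite le_max lexx.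
have h2 (k : R) : k <= Num.max 1 k by rewrite le_max lexx orbT.
rewrite ler_ln ?posrE ?mulr_gt0 ?max1_gt0// ge_max; apply/andP; split.
  by have := h1 x; have := h1 y; nra.
by have := h1 x; have := h1 y; have := h2 x; have := h2 y; nra.
Qed.

Lemma log_plus_sqr (x : R) : 0 <= x -> log_plus (x ^+ 2) = log_plus x + log_plus x.
Proof.
move=> x0; have [->|xn] := eqVneq x 0; first by rewrite expr0n /log_plus ln0// maxxx addr0.
have xp : 0 < x by rewrite lt_neqAle eq_sym xn.
rewrite /log_plus lnXn// mulr2n; have [h|h] := leP (ln x) 0.
  by rewrite max_l ?addr0//; lra.
by rewrite max_r//; lra.
Qed.

Lemma log_plus_inv (x : R) : 0 < x -> log_plus x - log_plus x^-1 = ln x.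
Proof.
move=> x0; rewrite /log_plus lnV ?posrE//; have [h|h] := leP (ln x) 0.
  by rewrite max_r; lra.
by rewrite max_l; lra.
Qed.

Definition lp f r t : R := log_plus (normc (f (circle_point r t))).

Lemma proximityE f r : proximity f r = mean (lp f r).
Proof. by []. Qed.

Lemma circ_contat f r : 0 <= r -> (forall z, normc z = r -> contat f z) ->
  rcont (fun t => normc (f (circle_point r t))).
Proof.
move=> r0 cf t; apply: cvgC_normc.
apply: (@cvg_comp _ _ _ (fun t => circle_point r t : C) f (nbhs t) (nbhs (circle_point r t : C))).
  by apply: cderiv_cvg (rder_circle_point r t); exact: real_cvg.
by apply: cf; exact: normc_circle_point.
Qed.

Lemma lp_cont f r : 0 <= r -> (forall z, normc z = r -> contat f z) -> rcont (lp f r).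
Proof.
move=> r0 cf t.
have -> : lp f r = (fun s => ln (Num.max 1 (normc (f (circle_point r s))))).
  by apply/funext => s; rewrite /lp log_plusE// normc_ge0.
apply: (@cvg_comp _ _ _ (fun s => Num.max 1 (normc (f (circle_point r s)))) (@ln R)
  (nbhs t) (nbhs (Num.max 1 (normc (f (circle_point r t)))))).
  apply: (@continuous_max _ _ (fun=> 1) (fun s => normc (f (circle_point r s)))).
    exact: cst_continuous.
  exact: (circ_contat f r r0 cf t).
exact/continuous_ln/max1_gt0.
Qed.

Lemma proximity_ge0 f r : 0 <= proximity f r.
Proof.
by rewrite mulr_ge0 ?(ltW pi2)//; apply: Rintegral_ge0 => t _; exact: log_plus_ge0.
Qed.

Definition has_orders f := forall z, exists m, ordat f z m.
Definition good f r := forall z, normc z = r -> regular f z.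

Lemma good_contat f r : good f r -> forall z, normc z = r -> contat f z.
Proof. by move=> gf z /gf[hf _]; exact: holo_contat. Qed.

Lemma orders_inv f : has_orders f -> has_orders (fun x => (f x)^-1).
Proof. by move=> h z; have [m hm] := h z; exists (- m); exact: ordatV. Qed.

Lemma characteristic_ge0 f r : 1 <= r -> has_orders f -> 0 <= characteristic f r.
Proof.
move=> r1 of_; rewrite addr_ge0 ?proximity_ge0//.
by apply: Ncount_ge0 => //; exact: discrete_pole_mult.
Qed.

(** Nevanlinna's first fundamental theorem for the value 0: Jensen's formula with ln x split as the
    difference of [log_plus x] and [log_plus x^-1]. *)
Lemma characteristic_inv g : has_orders g -> exists K : R, forall r, 1 <= r -> good g r ->
  characteristic (fun x => (g x)^-1) r = characteristic g r + K.
Proof.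
move=> og; have [K hK] := jensen g og; exists (- K) => r r1 gr.
have r0 : 0 < r by apply: lt_le_trans r1.
have := hK r r0 gr; rewrite /characteristic !proximityE => E.
have n0 t : 0 < normc (g (circle_point r t)).
  by rewrite normc_gt0; have [] := gr _ (normc_circle_point r t (ltW r0)).
have gi : good (fun x => (g x)^-1) r by move=> z /gr/regularV.
have := meanB _ _ (lp_cont _ _ (ltW r0) (good_contat _ _ gr)) (lp_cont _ _ (ltW r0) (good_contat _ _ gi)).
have -> : (fun t => lp g r t - lp (fun x => (g x)^-1) r t) = (fun t => ln (normc (g (circle_point r t)))).
  by apply/funext => t; rewrite /lp normcI log_plus_inv.
by rewrite /mean E mulrA mulVf ?mul1r ?gt_eqF ?two_pi_gt0// => ?; lra.
Qed.

(** If f + c had a pole of larger multiplicity i than [f], then (x - z) ^ i times f + c would tend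
    both to a nonzero value and to 0. *)
Lemma pole_mult_add f c z : has_orders f -> has_orders (fun x => f x + c) ->
  (pole_mult (fun x => (f x + c)%R) z <= pole_mult f z)%N.
Proof.
move=> hf hg; have [m fm] := hf z; have [n gn] := hg z.
rewrite (pole_mult_ordat _ _ _ fm) (pole_mult_ordat _ _ _ gn) leqNgt; apply/negP => lt.
have n0 : n = - (nat_neg n)%:Z by case: n lt {gn} => -[|k] //=; rewrite ?NegzE.
have mn : 0 < m + (nat_neg n)%:Z by case: m lt {fm} => -[|k] /=; lia.
have [h [hh h0 E]] := fm; have [k [hk k0 F]] := gn.
have [j je] : exists j : nat, m + (nat_neg n)%:Z = j.+1%:Z.
  by case: (m + _) mn => // -[|j] // _; exists j.
have [i ie] : exists i : nat, nat_neg n = i.+1 by case: (nat_neg n) lt => // i _; exists i.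
have : k z = h z * (z - z) ^+ j.+1 + c * (z - z) ^+ i.+1.
  apply: (cont_eq_punctured k (fun x => h x * (x - z) ^+ j.+1 + c * (x - z) ^+ i.+1)).
  - exact: holo_contat.
  - apply: holo_contat; apply: holoD; apply: holoM; [exact: hh|exact: holoX (holo_sub z z)|exact: holo_cst|exact: holoX (holo_sub z z)].
  - apply: pnearS (pnearI _ _ _ E F) => x xz [e1 e2].
    have xz0 : x - z != 0 by rewrite subr_eq0.
    have -> : k x = (f x + c) * (x - z) ^ (nat_neg n)%:Z.
      by rewrite e2 {1}n0 -mulrA -expfzDr// addNr expr0z mulr1.
    by rewrite e1 mulrDl -mulrA -expfzDr// je ie.
by rewrite subrr !expr0n !mulr0 addr0 => /eqP; rewrite (negbTE k0).
Qed.

Lemma characteristic_add f c : has_orders f -> has_orders (fun x => f x + c) ->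
  exists K : R, forall r, 1 <= r -> good f r ->
  characteristic (fun x => f x + c) r <= characteristic f r + K.
Proof.
move=> hf hg; exists (log_plus (normc c) + ln 2) => r r1 gr.
have r0 : 0 < r by apply: lt_le_trans r1.
have N : pole_counting (fun x => f x + c) r <= pole_counting f r.
  by apply: Ncount_le => // [||z]; [exact: discrete_pole_mult|exact: discrete_pole_mult|exact: pole_mult_add].
have cf := lp_cont _ _ (ltW r0) (good_contat _ _ gr).
have M : proximity (fun x => f x + c) r <= proximity f r + (log_plus (normc c) + ln 2).
  rewrite !proximityE -[X in _ <= _ + X]mean_cst -meanD; [|exact: cf|exact: rcont_cst].
  apply: mean_le.
  - apply: lp_cont (ltW r0) _ => z zr; apply: holo_contat; apply: holoD; last exact: holo_cst.
    by have [] := gr z zr.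
  - by apply: rcontD; [exact: cf|exact: rcont_cst].
  - move=> t; rewrite /lp addrA; apply: le_trans (log_plusD _ _ (normc_ge0 _) (normc_ge0 _)).
    exact: log_plus_le (normc_ge0 _) (normcD _ _).
by rewrite /characteristic; lra.
Qed.

Lemma Ncount_double mu nu1 nu2 r : 1 <= r ->
  discrete_supp mu -> discrete_supp nu1 -> discrete_supp nu2 ->
  (forall z : C, (mu z + mu z <= nu1 z + nu2 z)%N) ->
  Ncount mu r + Ncount mu r <= Ncount nu1 r + Ncount nu2 r.
Proof.
move=> r1 h0 h1 h2 le; have r0 : 0 < r by apply: lt_le_trans r1.
have d12 : discrete_supp (fun z => (nu1 z + nu2 z)%N).
  by move=> z; apply: pnearS (pnearI _ _ _ (h1 z) (h2 z)) => x _ [-> ->].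
have d00 : discrete_supp (fun z => (mu z + mu z)%N).
  by move=> z; apply: pnearS (h0 z) => x _ ->.
(* Additivity with a zero weight as fourth term identifies a sum of two counts with the count of the
   sum. *)
have dz : @discrete_supp R (fun=> 0%N) by move=> z; exists 1.
have e1 := Ncount_add _ _ _ _ r r0 h1 h2 d12 dz (fun z => esym (addn0 _)).
have e0 := Ncount_add _ _ _ _ r r0 h0 h0 d00 dz (fun z => esym (addn0 _)).
by rewrite e0 e1 lerD2r; exact: Ncount_le.
Qed.

End Proximity.

(** * Excluding the identical vanishing of [Gfun] *)

Section Degenerate.
Context {R : realType}.
Local Notation C := (Cx R).
Implicit Types (A B f g : C -> C) (a b c w x z : C) (r : R) (m n : int).

Lemma merol_orders f : meromorphic f -> ~ mero_eq f (fun=> 0) -> has_orders f.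
Proof.
move=> mf nf; have [f0|//] := mero_dichotomy f mf; case: nf.
by apply/mero_eqP => z; exact: f0.
Qed.

Lemma nonconstant_orders A c : meromorphic A -> nonconstant A -> has_orders (fun x => A x + c).
Proof.
move=> mA ncA; apply: merol_orders.
  apply/meroP => z; apply: merolD; last exact: merol_cst.
  by move: z; exact/meroP.
move=> /mero_eqP h; apply: ncA; exists (- c); apply/mero_eqP => z.
by apply: pnearS (h z) => x _ /eqP; rewrite addr_eq0 => /eqP.
Qed.

Lemma nonconstant_orders0 A : meromorphic A -> nonconstant A -> has_orders A.
Proof.
move=> mA ncA; have := nonconstant_orders A 0 mA ncA.
by have -> : (fun x => A x + 0) = A by apply/funext => x; rewrite addr0.
Qed.

(** Either [A] has a pole at the origin or [A - A 0] has a zero there. *)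
Lemma characteristic_ge_ln A : meromorphic A -> nonconstant A ->
  exists c (K : R), forall r, 1 <= r -> good A r -> good (fun x => A x + c) r ->
  ln r <= characteristic A r + K.
Proof.
move=> mA ncA; have oA := nonconstant_orders0 _ mA ncA.
have [pz|pz] := posnP (pole_mult A 0); last first.
  exists 0, 0 => r r1 _ _; rewrite addr0.
  apply: le_trans (Ncount_ge_ln _ _ r1 (discrete_pole_mult _ oA) pz) _.
  by rewrite lerDr proximity_ge0.
have [m Am] := oA 0.
have m0 : 0 <= m by move: pz; rewrite (pole_mult_ordat _ _ _ Am); case: m {Am}.
case: m m0 Am => // k _ [h [hh h0 E]].
(* The value A 0 of the representative may be arbitrary; [phi] is the holomorphic extension of A at
   the origin, and its value there is subtracted. *)
pose phi x := h x * (x - 0) ^+ k; pose c := - phi 0.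
have hphi : holo phi 0 by apply: holoM; [exact: hh|exact: holoX (holo_sub 0 0)].
exists c; have oAc := nonconstant_orders _ c mA ncA.
have Ep : pnear 0 (fun x => phi x + c = A x + c) by apply: pnearS E => x _ ->.
have hpc : holo (fun x => phi x + c) 0 by apply: holoD; [exact: hphi|exact: holo_cst].
have [n An] := oAc 0.
have n0 : (0 < nat_neg (- n))%N.
  have [zp|[j pj]] := holo_cases _ _ hpc.
    by case: (ordat_zeroat _ _ _ An (zeroat_ext _ _ _ Ep zp)).
  have -> : n = j%:Z by apply: ordat_unique An (ordat_ext _ _ _ _ Ep pj).
  case: j pj => // -[g [hg g0 F]].
  have : g 0 = phi 0 + c.
    apply: (cont_eq_punctured g (fun x => phi x + c)); [exact: holo_contat|exact: holo_contat hpc|].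
    by apply: pnearS F => x _ ->; rewrite expr0z mulr1.
  by rewrite /c subrr => /eqP; rewrite (negbTE g0).
have [K1 h1] := characteristic_inv _ oAc; have [K2 h2] := characteristic_add A c oA oAc.
exists (K2 + K1) => r r1 gA gAc.
have := h2 r r1 gA; have := h1 r r1 gAc.
have pm : (0 < pole_mult (fun x => (A x + c)^-1)%R 0%R)%N.
  by rewrite (pole_mult_ordat _ _ _ (ordatV _ _ _ An)).
have := Ncount_ge_ln _ _ r1 (discrete_pole_mult _ (orders_inv _ oAc)) pm.
have := proximity_ge0 (fun x => (A x + c)^-1) r.
rewrite {1}/characteristic /pole_counting; lra.
Qed.

(** Here [(A + 4) f ^ 2 = 4 B]. *)
Lemma characteristic_degenerate A B f :
  meromorphic A -> meromorphic B -> nonconstant A -> nonconstant B ->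
  meromorphic f -> (forall z, zeroat (Gfun A B f) z) -> has_orders f /\
  exists K : R, forall r, 1 <= r -> good A r -> good B r -> good f r ->
    good (fun x => A x + 4) r ->
    2 * characteristic f r <= characteristic A r + characteristic B r + K.
Proof.
move=> mA mB ncA ncB mf G0.
have oA := nonconstant_orders0 _ mA ncA; have oB := nonconstant_orders0 _ mB ncB.
have oA4 := nonconstant_orders _ 4 mA ncA.
have four0 : (4 : C) != 0 by rewrite pnatr_eq0.
have eqn z : pnear z (fun x => (A x + 4) * (f x * f x) = 4 * B x).
  apply: pnearS (G0 z) => x _ /eqP; rewrite /Gfun subr_eq0 => /eqP <-.
  by rewrite expr2.
have of_ : has_orders f.
  apply: merol_orders => // /mero_eqP f0; have [m Bm] := oB 0.
  apply: (ordat_zeroat _ _ _ Bm); apply: pnearS (pnearI _ _ _ (f0 0) (eqn 0)) => x _ [->].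
  by rewrite !mulr0 => /esym/eqP; rewrite mulf_eq0 (negbTE four0) => /eqP.
split=> //.
have [K1 h1] := characteristic_inv _ oA4; have [K2 h2] := characteristic_add A 4 oA oA4.
exists (K1 + K2 + log_plus (normc (4 : C))) => r r1 gA gB gf gA4.
have r0 : 0 < r by apply: lt_le_trans r1.
have e1 := h1 r r1 gA4; have e2 := h2 r r1 gA.
(* At each point the orders satisfy 2 ord f = ord B - ord (A + 4), so twice the pole multiplicity of
   [f] is at most the sum of those of B and 1 / (A + 4). *)
have N : pole_counting f r + pole_counting f r <=
    pole_counting B r + pole_counting (fun x => (A x + 4)^-1) r.
  apply: Ncount_double => //; try exact: discrete_pole_mult.
    by apply: discrete_pole_mult; exact: orders_inv.
  move=> z; have [mf_ fm] := of_ z; have [ma am] := oA4 z; have [mb bm] := oB z.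
  rewrite (pole_mult_ordat _ _ _ fm) (pole_mult_ordat _ _ _ bm).
  rewrite (pole_mult_ordat _ _ _ (ordatV _ _ _ am)).
  have o1 := ordatM _ _ _ _ _ am (ordatM _ _ _ _ _ fm fm).
  have o2 := ordatM _ _ _ _ _ (regular_ordat _ _ (regular_cst 4 z four0)) bm.
  have := ordat_unique _ _ _ _ (ordat_ext _ _ _ _ (eqn z) o1) o2.
  have spec k : (k <= 0 /\ (nat_neg k)%:Z = - k) \/ (0 <= k /\ nat_neg k = 0%N).
    by case: k => k; [right|left]; rewrite /= ?NegzE ?opprK.
  by have := spec mf_; have := spec mb; have := spec (- ma); lia.
have gA4i : good (fun x => (A x + 4)^-1) r by move=> z /gA4/regularV.
have cf := lp_cont _ _ (ltW r0) (good_contat _ _ gf).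
have cB := lp_cont _ _ (ltW r0) (good_contat _ _ gB).
have cA := lp_cont _ _ (ltW r0) (good_contat _ _ gA4i).
have M : proximity f r + proximity f r <=
    proximity B r + proximity (fun x => (A x + 4)^-1) r + log_plus (normc (4 : C)).
  rewrite !proximityE -[X in _ <= _ + X]mean_cst.
  rewrite -(meanD _ _ cf cf) -(meanD _ _ cB cA).
  have cBA := rcontD _ _ cB cA.
  rewrite -(meanD _ _ cBA (rcont_cst _)).
  apply: mean_le; first exact: rcontD.
    by apply: rcontD; [exact: cBA|exact: rcont_cst].
  move=> t; have zr := normc_circle_point r t (ltW r0).
  set z : C := circle_point r t in zr *.
  have [hA4 A40] := gA4 z zr; have [hf _] := gf z zr; have [hB _] := gB z zr.
  (* The relation is known off discrete sets only; on a good circle both sides are continuous, so it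
     holds at every point. *)
  have E : (A z + 4) * (f z * f z) = 4 * B z.
    apply: (cont_eq_punctured (fun x => (A x + 4) * (f x * f x)) (fun x => 4 * B x)).
    - by apply: holo_contat; apply: holoM; [exact: hA4|exact: holoM].
    - by apply: holo_contat; apply: holoM; [exact: holo_cst|exact: hB].
    - exact: eqn.
  rewrite /lp -/z -log_plus_sqr ?normc_ge0// -normcX.
  have -> : f z ^+ 2 = B z * (A z + 4)^-1 * 4.
    apply: (mulfI A40); rewrite expr2 E; field; exact: A40.
  rewrite !normcZ; apply: le_trans (log_plusM _ _ _ _) _; rewrite ?mulr_ge0 ?normc_ge0//.
  by rewrite lerD2r log_plusM ?normc_ge0.
move: e1 e2; rewrite /characteristic; lra.
Qed.

Lemma not_degenerate A B f :
  meromorphic A -> meromorphic B -> nonconstant A -> nonconstant B ->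
  admissible_solution A B f -> ~ forall z, zeroat (Gfun A B f) z.
Proof.
move=> mA mB ncA ncB [[mf _] _ [E1 [lE1 sA]] [E2 [lE2 sB]]] G0.
have oA := nonconstant_orders0 _ mA ncA; have oB := nonconstant_orders0 _ mB ncB.
have oA4 := nonconstant_orders _ 4 mA ncA.
have [of_ [K hK]] := characteristic_degenerate A B f mA mB ncA ncB mf G0.
have [c [K' hK']] := characteristic_ge_ln A mA ncA.
have oAc := nonconstant_orders _ c mA ncA.
(* With 1/2 for both coefficients, T(A) + T(B) <= T(f), which leaves one of the two copies of T(f)
   bounded by the constant K. *)
have half : 0 < 2^-1 :> R by rewrite invr_gt0.
have [M1 h1] := infty_outsideP _ _ (sA _ half).
have [M2 h2] := infty_outsideP _ _ (sB _ half).
pose S := [set z : C | ~ [/\ regular A z, regular B z, regular f z,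
  regular (fun x => A x + 4) z & regular (fun x => A x + c) z]].
have cS : countable [set r : R | exists2 z, S z & normc z = r].
  apply: bad_radii_countable => z.
  have [ma am] := oA z; have [mb bm] := oB z; have [mf_ fm] := of_ z.
  have [m4 a4] := oA4 z; have [mc ac] := oAc z.
  apply: pnearS (pnearI _ _ _ (ordat_neq0 _ _ _ am) (pnearI _ _ _ (ordat_neq0 _ _ _ bm)
    (pnearI _ _ _ (ordat_neq0 _ _ _ fm) (pnearI _ _ _ (ordat_neq0 _ _ _ a4) (ordat_neq0 _ _ _ ac))))).
  by move=> x _ [? [? [? [? ?]]]] []; split.
(* Beyond this radius ln r > |K| + K', hence T(A) > |K|, whereas smallness gives T(A) <= T(f) / 2 <=
   K / 2. *)
pose M := Num.max (Num.max 1 (expR (`|K| + K'))) (Num.max M1 M2).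
have [r [Mr nE1 nE2 nS]] := large_outside E1 E2 _ M lE1 lE2 cS.
have {}nS z : normc z = r -> [/\ regular A z, regular B z, regular f z,
    regular (fun x => A x + 4) z & regular (fun x => A x + c) z].
  by move=> zr; apply: contrapT => h; apply: nS; exists z.
move: Mr; rewrite /M !gt_max => /andP[/andP[r1 rK] /andP[rM1 rM2]].
have r0 : 0 < r by apply: lt_trans r1.
have tf := characteristic_ge0 f r (ltW r1) of_.
have a1 := h1 r rM1 nE1; have a2 := h2 r rM2 nE2.
rewrite /= (ger0_norm tf) in a1 a2.
have b1 : 2 * characteristic f r <= characteristic A r + characteristic B r + K.
  by apply: hK; [exact: ltW|move=> z /nS[]..].
have b2 : ln r <= characteristic A r + K' by apply: hK'; [exact: ltW|move=> z /nS[]..].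
have b3 : `|K| + K' < ln r.
  by rewrite -[X in X < _]expRK ltr_ln ?posrE// expR_gt0.
have c1 := ler_norm (characteristic A r); have c2 := ler_norm (characteristic B r).
have c3 := ler_norm K.
lra.
Qed.

End Degenerate.

Theorem theorem5p1 (R : realType) (A B f1 f2 : R[i] -> R[i])
    (mA : meromorphic A) (mB : meromorphic B)
    (ncA : nonconstant A) (ncB : nonconstant B)
    (sol1 : admissible_solution A B f1) (sol2 : admissible_solution A B f2)
    (f1_neq_f2 : ~ mero_eq f1 f2) :
  (exists E : set R, finite_log_measure E /\
    exists e : R -> R, e x @[x --> infty_outside E] --> 0 /\
      \forall r \near infty_outside E,
        characteristic f1 r = characteristic f2 r * (1 + e r))
  \/
  (forall r : R, 0 < r ->
    odd_counting (Gfun A B f1) r = odd_counting (Gfun A B f2) r).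
Proof.
right=> r r0.
have oG f : admissible_solution A B f -> has_orders (Gfun A B f).
  move=> sol; have [[mf _] _ _ _] := sol.
  have mG : meromorphic (Gfun A B f).
    apply/(@meroP R) => z; apply: merol_Gfun.
    - exact: (meroP A).1.
    - exact: (meroP B).1.
    - exact: (meroP f).1.
  have [G0|//] := mero_dichotomy _ mG.
  by case: (not_degenerate A B f mA mB ncA ncB sol G0).
have [s1 _ _ _] := sol1; have [s2 _ _ _] := sol2.
apply: (@odd_counting_eq R A B f1 f2 r) => //; try exact: oG.
exact: nonconstant_orders0.
Qed.
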